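(* Let $m\ge2$ be an integer, $t\in[0,+\infty)$, and $k\ge2$ an integer. Let $P_m$ be the unit polydisc in $\mathbb C^m$ endowed with the $\mathrm{Aut}(P_m)$-invariant Kähler-Berwald metric $F_{t,k}$, and let $f(z)=(f_1(z),\dots,f_m(z)):P_m\to\mathbb C^m$ be a normalized biholomorphic convex mapping. Then for every $z\in P_m$ and vector $v\in T_z^{1,0}P_m\cong\mathbb C^m$, the following inequalities hold: $$\left[\frac{1-p(z)}{1+p(z)}\right]^2F_{t,k}^2(z;v)\le F_{t,k}^2\big(0;f_\ast(z)v\big)\le\left[\frac{1+p(z)}{1-p(z)}\right]^2F_{t,k}^2(z;v).$$ Moreover, one of the equalities holds at some point $z\neq0$ in these inequalities if and only if $f_l(z^l)=\dfrac{z^l}{1-e^{i\theta_l}z^l}$ for some $\theta_l\in\mathbb R$, $l=1,\dots,m$.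
   Context: $P_m=\{z=(z^1,\dots,z^m)\in\mathbb C^m:|z^l|<1,\ l=1,\dots,m\}$ is the unit polydisc, with holomorphic tangent space $T_z^{1,0}P_m\cong\mathbb C^m$, and $\mathrm{Aut}(P_m)$ is its group of holomorphic automorphisms. The metric is $$F_{t,k}(z;v)=\frac{1}{\sqrt{1+t}}\sqrt{\sum_{l=1}^m\frac{|v^l|^2}{(1-|z^l|^2)^2}+t\sqrt[k]{\sum_{l=1}^m\frac{|v^l|^{2k}}{(1-|z^l|^2)^{2k}}}},\quad z\in P_m,\ v=(v^1,\dots,v^m)\in\mathbb C^m.$$ $p(z)=\max_{1\le l\le m}|z^l|$ is the Minkowski functional of $P_m$. $f_\ast(z)$ denotes the complex Jacobian matrix (differential) of $f$ at $z$. A normalized biholomorphic convex mapping $f:P_m\to\mathbb C^m$ is a holomorphic map that is biholomorphic onto its image, whose image is convex, and which satisfies $f(0)=0$ and $f_\ast(0)=I_m$ (identity matrix). For every such $f$, each component $f_l(z)=f_l(z^l)$ depends only on $z^l$ and is a normalized biholomorphic convex function of the one complex variable $z^l$ on the unit disc, $l=1,\dots,m$. *)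

(* Defs.v *)
From HB Require Import structures.
From mathcomp Require Import all_boot all_order all_algebra.
From mathcomp Require Import complex.
From mathcomp Require Import all_classical all_reals all_analysis.

Set Implicit Arguments.
Unset Strict Implicit.
Unset Printing Implicit Defensive.

Import Order.TTheory GRing.Theory Num.Theory.
Import numFieldNormedType.Exports Normc.

Local Open Scope classical_set_scope.
Local Open Scope ring_scope.
Local Open Scope complex_scope.

(* The topology and norm on R[i] are those of R[i] as a numFieldType. *)
HB.instance Definition _ (R : rcfType) := NormedModule.copy R[i] R[i]^o.

(* normc is the modulus as an element of R; the norm `|c| : R[i] is its image
   under R -> R[i]. *)
Definition polydisc (R : realType) (m : nat) : set 'rV[R[i]]_m :=
  [set z | forall l, normc (z 0 l) < 1].

Definition gauge_polydisc (R : realType) (m : nat) (z : 'rV[R[i]]_m) : R :=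
  \big[Num.max/0]_(l < m) normc (z 0 l).

(* The k-th root of a nonnegative real is written as the power k^-1. *)
Definition metricF (R : realType) (m : nat) (t : R) (k : nat)
    (z v : 'rV[R[i]]_m) : R :=
  (Num.sqrt (1 + t))^-1 *
  Num.sqrt
    (\sum_(l < m) normc (v 0 l) ^+ 2 / (1 - normc (z 0 l) ^+ 2) ^+ 2 +
     t * (\sum_(l < m) normc (v 0 l) ^+ (2 * k)
                       / (1 - normc (z 0 l) ^+ 2) ^+ (2 * k)) `^ k%:R^-1).

(* Vectors of C^m are rows, so the tangent vector f_*(z) v is v *m 'J f z. *)
Definition tangent_map (R : realType) (m : nat)
    (f : 'rV[R[i]]_m -> 'rV[R[i]]_m) (z v : 'rV[R[i]]_m) : 'rV[R[i]]_m :=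
  v *m 'J f z.

(* Differentiability is over the field R[i], i.e. complex differentiability.
   Intended for open D. *)
Definition holomorphic_on (R : realType) (m : nat) (D : set 'rV[R[i]]_m)
    (f : 'rV[R[i]]_m -> 'rV[R[i]]_m) : Prop :=
  forall z, D z -> differentiable f z.

(* f maps D biholomorphically onto the open set f @` D. *)
Definition biholomorphic_onto_image (R : realType) (m : nat)
    (D : set 'rV[R[i]]_m) (f : 'rV[R[i]]_m -> 'rV[R[i]]_m) : Prop :=
  [/\ holomorphic_on D f,
      open (f @` D)
    & exists g : 'rV[R[i]]_m -> 'rV[R[i]]_m,
        holomorphic_on (f @` D) g /\ (forall z, D z -> g (f z) = z)].

(* In the partial order of R[i], 0 <= s <= 1 forces s to be real, so
   convex_set over R[i] is ordinary convexity. *)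
Definition normalized_biholomorphic_convex (R : realType) (m : nat)
    (f : 'rV[R[i]]_m -> 'rV[R[i]]_m) : Prop :=
  [/\ biholomorphic_onto_image (@polydisc R m) f,
      convex_set (f @` @polydisc R m),
      f 0 = 0
    & 'J f 0 = 1%:M].

Definition expi (R : realType) (theta : R) : R[i] :=
  cos theta +i* sin theta.

(* Main.v *)
(* Write D for the convex image of the polydisc P and g for the inverse of f. For
   curves X, Y in P the midpoint curve W = g((f(X) + f(Y))/2) stays in P. Take
   X = phi_p(x s), Y = phi_p(y s) with x, y in the closed polydisc and phi_p the
   automorphism of P sending 0 to p. Then each coordinate of phi_p^-1(W) is a
   holomorphic self-map F of the disc fixing 0, with F'(0) = (x_j + y_j)/2, and
   F''(0) is, up to explicit terms, the Hessian of f at p evaluated on x - y. The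
   Schwarz-type bounds |F''(0)| <= 2 and |F''(0)| <= 4(1 - F'(0)) for F'(0) >= 0
   show that all mixed second partials of f vanish and that
   d_j^2 f = kappa_j d_j f with |(1 - |z_j|^2) kappa_j - 2 conj(z_j)| <= 2.
   Integrating this equation along rays gives f_j(z) = h_j(z_j) and
   (1 + r)^-2 <= |h_j'| <= (1 - r)^-2. In case of equality at some z_j <> 0 the
   rate kappa_j is extremal on the ray from 0 to z_j, so h_j' (1 - e z)^2 = 1
   there for some |e| = 1, and on the whole disc by the identity theorem.
   Holomorphy being mere complex differentiability, the Cauchy formula is proved
   by Goursat's bisection, along the homotopy s |-> z + s (w - z) contracting the
   unit circle to z. *)
Require Import Defs.
From mathcomp Require Import all_boot all_order all_algebra.
From mathcomp Require Import complex ring lra.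
From mathcomp Require Import all_classical all_reals all_analysis.

Import Order.TTheory GRing.Theory Num.Theory.
Import numFieldNormedType.Exports Normc.

Local Open Scope classical_set_scope.
Local Open Scope ring_scope.
Local Open Scope complex_scope.

Set Implicit Arguments.
Unset Strict Implicit.
Unset Printing Implicit Defensive.

Local Notation Re := complex.Re.
Local Notation Im := complex.Im.

(** Equality at [z] is meant for all tangent vectors [v] at once, since at [v = 0] it always holds.
    Tested on coordinate vectors it determines every |h_l'(z_l)|, and strict monotonicity of (1 + r)
    / (1 - r) then forces each |z_l| to equal p(z). Thus all components become extremal, not just
    the one realising the maximum. The two Schwarz-type bounds have different tasks. Let c and d be
    the mean and half-difference of x and y; the constraint is coordinatewise, |c_l + d_l| <= 1 and
    |c_l - d_l| <= 1. Taking c_j = 1 makes 4(1 - F'(0)) vanish and kills the Hessian entries that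
    avoid the index j. Entries pairing j with another index need d_j <> 0: an imaginary d_j = i s
    costs only 1 - c_j = O(s^2), against a term linear in s. The plain bound 2, used at c = 0, gives
    the disc containing kappa_j. The metric depends only on the quotients |v_l| / (1 - |z_l|^2),
    monotonically and homogeneously, so the inequalities reduce to bounds on each |h_l'|
    separately. *)

Section Modulus.
Variable R : realType.
Implicit Types x y z w : R[i].

Lemma normc_ge0 z : 0 <= normc z.
Proof. by case: z => a b; exact: sqrtr_ge0. Qed.

Lemma normc_eq0 z : (normc z == 0) = (z == 0).
Proof. by apply/eqP/eqP => [/eq0_normc //|->]; rewrite normc0. Qed.

Lemma normc_gt0 z : (0 < normc z) = (z != 0).
Proof. by rewrite lt_def normc_ge0 andbT normc_eq0. Qed.

Lemma normcX z n : normc (z ^+ n) = normc z ^+ n.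
Proof. by elim: n => [|n IH]; rewrite ?expr0 ?normc1 // !exprS normcM IH. Qed.

Lemma normcB x y : normc (x - y) = normc (y - x).
Proof. by rewrite -normcN opprB. Qed.

Lemma ler_normcB x y : normc (x - y) <= normc x + normc y.
Proof. by rewrite -(normcN y); exact: le_normcD. Qed.

Lemma ler_dist_normc x y : normc x - normc y <= normc (x - y).
Proof. by have := le_normcD (x - y) y; rewrite subrK; lra. Qed.

Lemma normc_real (a : R) : normc a%:C = `|a|.
Proof. by rewrite /normc /= expr0n /= addr0 sqrtr_sqr. Qed.

Lemma sqr_normc_ReIm z : normc z ^+ 2 = Re z ^+ 2 + Im z ^+ 2.
Proof. by case: z => a b; rewrite sqr_sqrtr ?addr_ge0 ?sqr_ge0. Qed.

Lemma normRe_le z : `|Re z| <= normc z.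
Proof.
rewrite -(@ler_pXn2r _ 2) ?nnegrE ?normr_ge0 ?normc_ge0 //.
by rewrite sqr_normc_ReIm real_normK ?num_real // lerDl sqr_ge0.
Qed.

Lemma normIm_le z : `|Im z| <= normc z.
Proof.
rewrite -(@ler_pXn2r _ 2) ?nnegrE ?normr_ge0 ?normc_ge0 //.
by rewrite sqr_normc_ReIm real_normK ?num_real // lerDr sqr_ge0.
Qed.

Lemma Re_le_normc z : Re z <= normc z.
Proof. exact: le_trans (ler_norm _) (normRe_le z). Qed.

Lemma normc_le_ReIm z : normc z <= `|Re z| + `|Im z|.
Proof.
have h0 := normr_ge0 (Re z); have h1 := normr_ge0 (Im z).
rewrite -(@ler_pXn2r _ 2) ?nnegrE ?addr_ge0 ?normc_ge0 //.
rewrite sqr_normc_ReIm -(real_normK (num_real (Re z))).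
by rewrite -(real_normK (num_real (Im z))); nra.
Qed.

Lemma normc_conj z : normc z^* = normc z.
Proof. by case: z => a b; rewrite /normc /= sqrrN. Qed.

Lemma mul_conjc z : z * z^* = (normc z ^+ 2)%:C.
Proof.
rewrite sqr_normc_ReIm; case: z => a b /=.
by apply/eqP; rewrite eq_complex /=; apply/andP; split; apply/eqP; ring.
Qed.

Lemma Re_mulr_real (a : R) z : Re (a%:C * z) = a * Re z.
Proof. by case: z => x y /=; rewrite mul0r subr0. Qed.

Lemma Re_add x y : Re (x + y) = Re x + Re y.
Proof. by case: x; case: y. Qed.

Lemma Im_add x y : Im (x + y) = Im x + Im y.
Proof. by case: x; case: y. Qed.

Lemma Re_opp x : Re (- x) = - Re x.
Proof. by case: x. Qed.

Lemma Im_opp x : Im (- x) = - Im x.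
Proof. by case: x. Qed.

Lemma unit_rotation z : exists2 e : R[i], normc e = 1 & e * z = (normc z)%:C.
Proof.
have [->|z0] := eqVneq z 0; first by exists 1; rewrite ?normc1 // normc0 mulr0.
have n0 : normc z != 0 by rewrite normc_eq0.
exists ((normc z)^-1%:C * z^*).
  by rewrite normcM normc_real normc_conj ger0_norm ?invr_ge0 ?normc_ge0 // mulVf.
rewrite -mulrA [z^* * z]mulrC mul_conjc -rmorphM /= expr2 mulrA mulVf // mul1r //.
Qed.

Lemma normc_2 : normc (2 : R[i]) = 2.
Proof. by rewrite -[2]/(1 + 1) -(rmorph1 (real_complex R)) -rmorphD normc_real ger0_norm. Qed.

End Modulus.

(** * Complex derivatives *)

Section Derivative.
Variable R : realType.
Implicit Types (h k : R[i] -> R[i]) (z w d e : R[i]).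

Definition ccont h z := forall eps : R, 0 < eps -> exists2 del : R, 0 < del &
  forall w, normc (w - z) < del -> normc (h w - h z) <= eps.

(** Multiplied out and with a real [eps]: no quotient is formed, so the point [w = z] needs no
    exclusion. *)
Definition cderiv h z d := forall eps : R, 0 < eps -> exists2 del : R, 0 < del &
  forall w, normc (w - z) < del ->
    normc (h w - h z - d * (w - z)) <= eps * normc (w - z).

Lemma ccont_cst d z : ccont (fun=> d) z.
Proof. by move=> e e0; exists 1 => // w _; rewrite subrr normc0 ltW. Qed.

Lemma ccont_id z : ccont id z.
Proof. by move=> e e0; exists e => // w /ltW. Qed.

Lemma ccontD h k z : ccont h z -> ccont k z -> ccont (fun w => h w + k w) z.
Proof.
move=> ch ck e e0; have e20 : 0 < e / 2 by lra.
have [d d0 hd] := ch _ e20; have [d' d0' hd'] := ck _ e20.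
exists (Num.min d d'); first by rewrite lt_min d0.
move=> w; rewrite lt_min => /andP[/hd h1 /hd' h2].
have := le_normcD (h w - h z) (k w - k z).
by rewrite (_ : h w - h z + _ = h w + k w - (h z + k z)); [lra|ring].
Qed.

Lemma ccont_comp h k z : ccont k z -> ccont h (k z) -> ccont (fun w => h (k w)) z.
Proof.
move=> ck ch e e0; have [d d0 hd] := ch _ e0.
have [|d' d0' hd'] := ck (d / 2); first by lra.
by exists d' => // w /hd' h1; apply: hd; lra.
Qed.

Lemma ccontM h k z : ccont h z -> ccont k z -> ccont (fun w => h w * k w) z.
Proof.
move=> ch ck e e0.
pose M := normc (h z) + normc (k z) + 1.
have n1 := normc_ge0 (h z); have n2 := normc_ge0 (k z).
have M0 : 0 < M by rewrite /M; lra.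
pose e' := Num.min 1 (e / (2 * M)).
have e'0 : 0 < e' by rewrite lt_min ltr01 divr_gt0 // mulr_gt0.
have [d d0 hd] := ch _ e'0; have [d' d0' hd'] := ck _ e'0.
exists (Num.min d d'); first by rewrite lt_min d0.
move=> w; rewrite lt_min => /andP[/hd h1 /hd' h2].
rewrite (_ : _ - _ = (h w - h z) * (k w - k z) + (h w - h z) * k z + h z * (k w - k z)); last by ring.
apply: le_trans (le_normcD _ _) _; apply: le_trans (lerD (le_normcD _ _) (lexx _)) _.
rewrite !normcM.
have e'1 : e' <= 1 by rewrite ge_min lexx.
have e'2 : e' * (2 * M) <= e.
  by rewrite -ler_pdivlMr ?mulr_gt0 // ge_min lexx orbT.
have p1 := normc_ge0 (h w - h z); have p2 := normc_ge0 (k w - k z).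
apply: le_trans e'2; rewrite /M.
have i1 : normc (h w - h z) * normc (k w - k z) <= e' * 1.
  by apply: ler_pM => //; apply: le_trans h2 _.
have i2 : normc (h w - h z) * normc (k z) <= e' * normc (k z) by apply: ler_wpM2r.
have i3 : normc (h z) * normc (k w - k z) <= normc (h z) * e' by apply: ler_wpM2l.
have : 0 <= e' by exact: ltW.
nra.
Qed.

Lemma ccontN h z : ccont h z -> ccont (fun w => - h w) z.
Proof.
move=> ch e e0; have [d d0 hd] := ch _ e0; exists d => // w /hd.
by rewrite -opprD normcN.
Qed.

Lemma ccontB h k z : ccont h z -> ccont k z -> ccont (fun w => h w - k w) z.
Proof. by move=> ch ck; apply: ccontD => //; exact: ccontN. Qed.

Lemma ccontV h z : ccont h z -> h z != 0 -> ccont (fun w => (h w)^-1) z.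
Proof.
move=> ch hz e e0; have nz : 0 < normc (h z) by rewrite normc_gt0.
pose e' := Num.min (normc (h z) / 2) (e * normc (h z) ^+ 2 / 2).
have e'0 : 0 < e'.
  by rewrite lt_min; apply/andP; split; rewrite divr_gt0 // mulr_gt0 // exprn_gt0.
have [d d0 hd] := ch _ e'0; exists d => // w /hd h1.
have e'1 : e' <= normc (h z) / 2 by rewrite ge_min lexx.
have e'2 : e' <= e * normc (h z) ^+ 2 / 2 by rewrite ge_min lexx orbT.
have hw : normc (h z) / 2 <= normc (h w).
  have := ler_dist_normc (h z) (h w); rewrite normcB; lra.
have hw0 : h w != 0 by rewrite -normc_gt0; lra.
rewrite (_ : _ - _ = (h z - h w) / (h w * h z)); last by field; rewrite hz hw0.
rewrite normcM normcV normcM normcB ler_pdivrMr ?mulr_gt0 ?normc_gt0 //.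
apply: le_trans h1 _; apply: le_trans e'2 _.
rewrite -mulrA; apply: ler_wpM2l; first exact: ltW.
nra.
Qed.

Lemma cderiv_cont h z d : cderiv h z d -> ccont h z.
Proof.
move=> ch e e0; have [del d0 hd] := ch 1 ltr01.
have nd := normc_ge0 d.
exists (Num.min del (e / (1 + normc d))).
  by rewrite lt_min d0 divr_gt0 //; lra.
move=> w; rewrite lt_min ltr_pdivlMr; last by lra.
case/andP => /hd h1 h2.
have := le_normcD (h w - h z - d * (w - z)) (d * (w - z)); rewrite subrK normcM; lra.
Qed.

(** This is Caratheodory's form of differentiability. With a slope function continuous at [z], the
    sum, product and chain rules become ring identities between slopes. *)
Lemma cderivP h z d : cderiv h z d <->
  exists q, [/\ ccont q z, q z = d & forall w, h w = h z + q w * (w - z)].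
Proof.
split=> [ch|[q [cq qz hq]] e e0]; last first.
  have [del d0 hd] := cq _ e0; exists del => // w /hd.
  rewrite qz => h1; rewrite hq (_ : _ - _ = (q w - d) * (w - z)); last by ring.
  by rewrite normcM ler_wpM2r // normc_ge0.
exists (fun w => if w == z then d else (h w - h z) / (w - z)); split.
- move=> e e0; have [del d0 hd] := ch _ e0; exists del => // w wz.
  rewrite eqxx; case: eqVneq => [_|nwz]; first by rewrite subrr normc0 ltW.
  have wz0 : w - z != 0 by rewrite subr_eq0.
  rewrite (_ : _ - d = (h w - h z - d * (w - z)) / (w - z)); last by field.
  by rewrite normcM normcV ler_pdivrMr ?normc_gt0 //; exact: hd.
- by rewrite eqxx.
move=> w; case: eqVneq => [->|nwz]; first by ring.
by field; rewrite subr_eq0.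
Qed.

Lemma cderiv_cst d z : cderiv (fun=> d) z 0.
Proof. by apply/cderivP; exists (fun=> 0); split => // [|w]; [exact: ccont_cst|ring]. Qed.

Lemma cderiv_id z : cderiv id z 1.
Proof. by apply/cderivP; exists (fun=> 1); split => // [|w]; [exact: ccont_cst|ring]. Qed.

Lemma cderivD h k z d e :
  cderiv h z d -> cderiv k z e -> cderiv (fun w => h w + k w) z (d + e).
Proof.
move=> /cderivP[p [cp <- hp]] /cderivP[q [cq <- hq]]; apply/cderivP.
exists (fun w => p w + q w); split=> // [|w]; first exact: ccontD.
by rewrite hp hq; ring.
Qed.

Lemma cderivM h k z d e :
  cderiv h z d -> cderiv k z e -> cderiv (fun w => h w * k w) z (d * k z + h z * e).
Proof.
move=> hd /[dup] /cderiv_cont ck /cderivP[q [cq <- hq]].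
move: hd => /cderivP[p [cp <- hp]]; apply/cderivP.
exists (fun w => p w * k w + h z * q w); split=> // [|w].
  by apply: ccontD; apply: ccontM => //; exact: ccont_cst.
by rewrite hp [in LHS]hq [in RHS](hq w); ring.
Qed.

Lemma cderivZ c h z d : cderiv h z d -> cderiv (fun w => c * h w) z (c * d).
Proof.
move=> hd; have := cderivM (cderiv_cst c z) hd.
by rewrite mul0r add0r.
Qed.

Lemma cderivN h z d : cderiv h z d -> cderiv (fun w => - h w) z (- d).
Proof.
move=> /cderivP[p [cp <- hp]]; apply/cderivP; exists (fun w => - p w); split=> // [|w].
  exact: ccontN.
by rewrite hp; ring.
Qed.

Lemma cderivB h k z d e :
  cderiv h z d -> cderiv k z e -> cderiv (fun w => h w - k w) z (d - e).
Proof. by move=> ch ck; apply: cderivD => //; exact: cderivN. Qed.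

Lemma cderivV h z d :
  cderiv h z d -> h z != 0 -> cderiv (fun w => (h w)^-1) z (- d / h z ^+ 2).
Proof.
move=> /[dup] /cderiv_cont ch /cderivP[p [cp <- hp]] hz.
suff: cderiv (fun w => (h w)^-1) z (- (p z / (h z * h z))).
  by congr (cderiv _ _ _); rewrite expr2 mulNr.
(* The slope identity for 1/h holds only where [h] does not vanish, whereas [cderivP] asks for it
   everywhere; hence a direct epsilon argument on a neighbourhood free of zeros. *)
have [del d0 hd] : exists2 del : R, 0 < del & forall w, normc (w - z) < del -> h w != 0.
  have nz : 0 < normc (h z) by rewrite normc_gt0.
  have [|del d0 hd] := ch (normc (h z) / 2); first by lra.
  exists del => // w /hd; have := ler_dist_normc (h z) (h w).
  by rewrite normcB -normc_gt0; lra.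
have : ccont (fun w => - (p w / (h w * h z))) z.
  apply: ccontN; apply: ccontM => //; apply: ccontV; last by rewrite mulf_neq0.
  by apply: ccontM => //; exact: ccont_cst.
move=> /(_ _ _) cc e e0; have [del' d0' hd'] := cc _ e0.
exists (Num.min del del'); first by rewrite lt_min d0.
move=> w; rewrite lt_min => /andP[/hd hw /hd'].
rewrite (_ : _ - _ - _ = (- (p w / (h w * h z)) - - (p z / (h z * h z))) * (w - z)).
  by rewrite normcM => h1; rewrite ler_wpM2r ?normc_ge0.
have -> : (h w)^-1 - (h z)^-1 = - (p w * (w - z)) / (h w * h z).
  rewrite -[p w * (w - z)](addKr (h z)) -hp; field; by rewrite hw hz.
by field; rewrite hw hz.
Qed.

Lemma cderiv_comp h k z d e :
  cderiv k z e -> cderiv h (k z) d -> cderiv (fun w => h (k w)) z (d * e).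
Proof.
move=> /[dup] /cderiv_cont ck /cderivP[q [cq <- hq]] /cderivP[p [cp <- hp]].
apply/cderivP; exists (fun w => p (k w) * q w); split=> // [|w].
  by apply: ccontM => //; exact: ccont_comp.
by rewrite hp [in X in _ + _ * X]hq; ring.
Qed.

Lemma cderiv_near h k z d (del : R) : 0 < del ->
  (forall w, normc (w - z) < del -> h w = k w) -> cderiv h z d -> cderiv k z d.
Proof.
move=> d0 hk ch e e0; have [d' d0' hd] := ch _ e0.
exists (Num.min del d'); first by rewrite lt_min d0.
move=> w; rewrite lt_min => /andP[/hk <- /hd].
by rewrite (hk z) // subrr normc0.
Qed.

Lemma cderiv_eq h z d e : cderiv h z d -> d = e -> cderiv h z e.
Proof. by move=> + <-. Qed.

Lemma cderiv_uniq h z d e : cderiv h z d -> cderiv h z e -> d = e.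
Proof.
move=> hd he; have [//|nde] := eqVneq d e; exfalso.
have n0 : 0 < normc (d - e) by rewrite normc_gt0 subr_eq0.
have e0 : 0 < normc (d - e) / 4 by lra.
have [r1 r10 h1] := hd _ e0; have [r2 r20 h2] := he _ e0.
pose r := Num.min r1 r2 / 2.
have r0 : 0 < r by rewrite divr_gt0 // lt_min r10.
have rm : r < Num.min r1 r2 by rewrite /r ltr_pdivrMr // ltr_pMr ?lt_min ?r10 // ltr1n.
have nr : normc r%:C = r by rewrite normc_real gtr0_norm.
move: rm; rewrite lt_min => /andP[rr1 rr2].
have := h1 (z + r%:C); have := h2 (z + r%:C).
have -> : z + r%:C - z = r%:C by ring.
rewrite nr => /(_ rr2) i2 /(_ rr1) i1.
have := ler_normcB (h (z + r%:C) - h z - e * r%:C) (h (z + r%:C) - h z - d * r%:C).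
rewrite (_ : _ - (_ - _ - _) = (d - e) * r%:C); last by ring.
rewrite normcM nr; nra.
Qed.

End Derivative.

(** * Integrals of complex-valued functions *)

Section ComplexIntegral.
Variable R : realType.
Notation mu := (@lebesgue_measure R).
Implicit Types (u v : R -> R[i]) (a b c : R).

Definition rcont a b u := forall x, a <= x <= b -> forall eps : R, 0 < eps ->
  exists2 del : R, 0 < del & forall y, a <= y <= b -> `|y - x| < del ->
    normc (u y - u x) <= eps.

Definition cint a b u : R[i] :=
  (\int[mu]_(x in `[a, b]) Re (u x))%R +i* (\int[mu]_(x in `[a, b]) Im (u x))%R.

Lemma within_continuous_eps a b (f : R -> R) :
  (forall x, a <= x <= b -> forall eps : R, 0 < eps ->
  exists2 del : R, 0 < del & forall y, a <= y <= b -> `|y - x| < del ->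
    `|f y - f x| <= eps) -> {within `[a, b], continuous f}.
Proof.
move=> H; apply/subspace_continuousP => x /=; rewrite in_itv /= => xab.
apply/cvgrPdist_le => /= e e0; have [del d0 hd] := H _ xab _ e0.
near=> y.
rewrite distrC; apply: hd.
  by near: y; rewrite near_withinE; near=> y; rewrite /= in_itv.
by rewrite distrC; near: y; apply: cvg_within; exact: (@nbhsx_ballx _ _ x del d0).
Unshelve. all: by end_near. Qed.

Lemma rcont_Re_integrable a b u : rcont a b u ->
  mu.-integrable `[a, b] (EFin \o (fun x => Re (u x))).
Proof.
move=> cu; apply: continuous_compact_integrable; first exact: segment_compact.
apply: within_continuous_eps => x xab e e0; have [del d0 hd] := cu _ xab _ e0.
exists del => // y yab /(hd y yab); apply: le_trans.
by rewrite -Re_opp -Re_add normRe_le.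
Qed.

Lemma rcont_Im_integrable a b u : rcont a b u ->
  mu.-integrable `[a, b] (EFin \o (fun x => Im (u x))).
Proof.
move=> cu; apply: continuous_compact_integrable; first exact: segment_compact.
apply: within_continuous_eps => x xab e e0; have [del d0 hd] := cu _ xab _ e0.
exists del => // y yab /(hd y yab); apply: le_trans.
by rewrite -Im_opp -Im_add normIm_le.
Qed.

Lemma eq_cint a b u v : (forall x, a <= x <= b -> u x = v x) -> cint a b u = cint a b v.
Proof.
move=> uv; congr (_ +i* _); apply: eq_Rintegral => x.
  by rewrite inE /= in_itv /= => /uv ->.
by rewrite inE /= in_itv /= => /uv ->.
Qed.

Lemma cintD a b u v : rcont a b u -> rcont a b v ->
  cint a b (fun x => u x + v x) = cint a b u + cint a b v.
Proof.
move=> cu cv; apply/eqP; rewrite eq_complex /=; apply/andP; split; apply/eqP.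
  rewrite -RintegralD //; try exact: rcont_Re_integrable.
  by apply: eq_Rintegral => x _; rewrite Re_add.
rewrite -RintegralD //; try exact: rcont_Im_integrable.
by apply: eq_Rintegral => x _; rewrite Im_add.
Qed.

Lemma cintZ a b u (z : R[i]) : rcont a b u ->
  cint a b (fun x => z * u x) = z * cint a b u.
Proof.
move=> cu; have iR := rcont_Re_integrable cu; have iI := rcont_Im_integrable cu.
case: z => p q; apply/eqP; rewrite eq_complex /=; apply/andP; split; apply/eqP.
  rewrite -!RintegralZl // -RintegralB //.
  - by apply: eq_Rintegral => x _; case: (u x).
  - exact: (integrableZl _ _ iR).
  - exact: (integrableZl _ _ iI).
rewrite -!RintegralZl // -RintegralD //.
- by apply: eq_Rintegral => x _; case: (u x).
- exact: (integrableZl _ _ iI).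
- exact: (integrableZl _ _ iR).
Qed.

Lemma cint_conj a b u : rcont a b u -> cint a b (fun x => (u x)^*) = (cint a b u)^*.
Proof.
move=> cu; congr (_ +i* _); first by apply: eq_Rintegral => x _; case: (u x).
rewrite -mulN1r -RintegralZl //; last exact: rcont_Im_integrable.
by apply: eq_Rintegral => x _; case: (u x) => ? ? /=; rewrite mulN1r.
Qed.

Lemma cint_split a b c u : a <= b -> b <= c -> rcont a c u ->
  cint a c u = cint a b u + cint b c u.
Proof.
move=> ab bc cu; apply/eqP; rewrite eq_complex /=.
have key (f : R -> R) : mu.-integrable `[a, c] (EFin \o f) ->
    \int[mu]_(x in `[a, c]) f x = \int[mu]_(x in `[a, b]) f x + \int[mu]_(x in `[b, c]) f x.
  move=> itf; have := Rintegral_itvB itf (x := b).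
  rewrite !bnd_simp => /(_ ab bc) h.
  rewrite -(@Rintegral_itv_obnd_cbnd _ b).
    by rewrite -h addrC subrK.
  apply: integrableS itf => //; apply: subset_itv; rewrite bnd_simp //.
by rewrite !key ?eqxx //; [exact: rcont_Im_integrable|exact: rcont_Re_integrable].
Qed.

Lemma cint_cst a b (z : R[i]) : a <= b -> cint a b (fun=> z) = (b - a)%:C * z.
Proof.
move=> ab; case: z => p q; rewrite /cint /= !Rintegral_cst //=.
rewrite lebesgue_measure_itv /= lte_fin.
case: ltgtP ab => // [ab _|-> _] /=.
  by apply/eqP; rewrite eq_complex /=; apply/andP; split; apply/eqP; ring.
by apply/eqP; rewrite eq_complex /=; apply/andP; split; apply/eqP; ring.
Qed.

Lemma rcont_cst a b (z : R[i]) : rcont a b (fun=> z).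
Proof. by move=> x _ e e0; exists 1 => // y _ _; rewrite subrr normc0 ltW. Qed.

Lemma rcontZ a b u (z : R[i]) : rcont a b u -> rcont a b (fun x => z * u x).
Proof.
move=> cu x xab e e0; have nz := normc_ge0 z.
have e'0 : 0 < e / (normc z + 1) by rewrite divr_gt0 //; lra.
have [del d0 hd] := cu _ xab _ e'0; exists del => // y yab /(hd _ yab) h.
rewrite -mulrBr normcM.
have h1 : normc z * normc (u y - u x) <= (normc z + 1) * normc (u y - u x).
  by apply: ler_wpM2r; [exact: normc_ge0|lra].
apply: le_trans h1 _; rewrite mulrC -ler_pdivlMr //; lra.
Qed.

(* The integral is rotated onto the positive real axis, where it is controlled
   by its real part. *)
Lemma normc_cint_le a b u v : rcont a b u -> rcont a b v ->
  (forall x, a <= x <= b -> normc (u x) <= Re (v x)) ->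
  normc (cint a b u) <= Re (cint a b v).
Proof.
move=> cu cv uv; have [e e1 he] := unit_rotation (cint a b u).
rewrite -[normc _]/(Re (normc _)%:C) -he -cintZ //.
apply: le_Rintegral => //; try exact: rcont_Re_integrable.
  by apply: rcont_Re_integrable; exact: rcontZ.
move=> x /=; rewrite in_itv /= => /uv; apply: le_trans.
by apply: le_trans (Re_le_normc _) _; rewrite normcM e1 mul1r.
Qed.

Lemma normc_cint_le_cst a b u (M : R) : a <= b -> rcont a b u ->
  (forall x, a <= x <= b -> normc (u x) <= M) -> normc (cint a b u) <= (b - a) * M.
Proof.
move=> ab cu uM; have := normc_cint_le cu (@rcont_cst a b M%:C) uM.
by rewrite cint_cst // Re_mulr_real.
Qed.

Lemma rcont_comp a b (h : R[i] -> R[i]) (g : R -> R[i]) (K : R) :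
  (forall x y, normc (g x - g y) <= K * `|x - y|) ->
  (forall x, a <= x <= b -> ccont h (g x)) -> rcont a b (fun x => h (g x)).
Proof.
move=> Lg ch x xab e e0; have [del d0 hd] := ch _ xab _ e0.
have K0 : 0 < `|K| + 1 by have := normr_ge0 K; lra.
exists (del / (`|K| + 1)); first by rewrite divr_gt0.
move=> y yab; rewrite ltr_pdivlMr // => h1; apply: hd.
apply: le_lt_trans (Lg _ _) _; apply: le_lt_trans h1.
rewrite mulrC; apply: ler_wpM2l => //; have := ler_norm K; lra.
Qed.

Lemma cint_derive a b u (Fr Fi : R -> R) : a <= b -> rcont a b u ->
  (forall x : R, is_derive x (1 : R) Fr (Re (u x))) -> (forall x : R, is_derive x (1 : R) Fi (Im (u x))) ->
  cint a b u = (Fr b - Fr a) +i* (Fi b - Fi a).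
Proof.
have key (f F : R -> R) : a < b -> {within `[a, b], continuous f} ->
    (forall x : R, is_derive x (1 : R) F (f x)) -> \int[mu]_(x in `[a, b]) f x = F b - F a.
  move=> ab cf dF; rewrite /Rintegral (continuous_FTC2 ab cf (F := F)) //.
    have cF x : {for x, continuous F}.
      by apply: differentiable_continuous; apply/derivable1_diffP; have [] := dF x.
    split=> [x _||]; first by have [] := dF x.
      by apply: cvg_at_right_filter; exact: cF.
    by apply: cvg_at_left_filter; exact: cF.
  by move=> x _; rewrite derive1E; have [] := dF x.
rewrite le_eqVlt => /orP[/eqP <- _ _ _|ab cu dR dI].
  by rewrite /cint set_itv1 !Rintegral_set1 !subrr.
rewrite /cint (key _ Fr) // ?(key _ Fi) //; apply: within_continuous_eps => x xab e e0.
  have [del d0 hd] := cu _ xab _ e0; exists del => // y yab /(hd y yab); apply: le_trans.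
  by rewrite -Im_opp -Im_add normIm_le.
have [del d0 hd] := cu _ xab _ e0; exists del => // y yab /(hd y yab); apply: le_trans.
by rewrite -Re_opp -Re_add normRe_le.
Qed.

End ComplexIntegral.

(** * The Cauchy formula *)

Section Bisection.
Variables (R : realType) (G : R -> R -> R -> R -> R) (A B C D : R).
Hypotheses (AB : A <= B) (CD : C <= D).
Hypothesis Gsub : forall a b c d, A <= a -> a <= b -> b <= B -> C <= c -> c <= d -> d <= D ->
  G a b c d <= G a ((a + b) / 2) c ((c + d) / 2) + G ((a + b) / 2) b c ((c + d) / 2)
             + G a ((a + b) / 2) ((c + d) / 2) d + G ((a + b) / 2) b ((c + d) / 2) d.
Hypothesis Gsmall : forall x y, A <= x <= B -> C <= y <= D -> forall eps : R, 0 < eps ->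
  exists2 del : R, 0 < del & forall a b c d, A <= a -> a <= x <= b -> b <= B ->
    C <= c -> c <= y <= d -> d <= D -> b - a < del -> d - c < del ->
    G a b c d <= eps * (b - a + (d - c)) ^+ 2.

Let L n := (B - A) / 2 ^+ n.
Let H n := (D - C) / 2 ^+ n.

(** Invariant of the n-th step: [p] is the lower left corner of a copy of the rectangle scaled by
    2^-n that still carries at least the fraction 4^-n of [G A B C D]. *)
Let V n (p : R * R) := [/\ A <= p.1, p.1 + L n <= B, C <= p.2, p.2 + H n <= D &
  G A B C D / 4 ^+ n <= G p.1 (p.1 + L n) p.2 (p.2 + H n)].

Let Sub n (p q : R * R) := [/\ V n.+1 q, p.1 <= q.1 <= p.1 + L n.+1 &
  p.2 <= q.2 <= p.2 + H n.+1].

Let LS n : L n = 2 * L n.+1.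
Proof. by rewrite /L exprS invfM; field; rewrite expf_neq0. Qed.

Let HS n : H n = 2 * H n.+1.
Proof. by rewrite /H exprS invfM; field; rewrite expf_neq0. Qed.

Let L0 n : 0 <= L n.
Proof. by rewrite divr_ge0 ?exprn_ge0 // subr_ge0. Qed.

Let H0 n : 0 <= H n.
Proof. by rewrite divr_ge0 ?exprn_ge0 // subr_ge0. Qed.

Let step n p : V n p -> exists q, Sub n p q.
Proof.
case: p => a c [/= h1 h2 h3 h4 h5].
have l0 := L0 n.+1; have k0 := H0 n.+1.
have ls := LS n; have hs := HS n.
have aL : a <= a + L n by rewrite lerDl.
have cH : c <= c + H n by rewrite lerDl.
have := Gsub h1 aL h2 h3 cH h4.
have -> : (a + (a + L n)) / 2 = a + L n.+1 by rewrite ls; field.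
have -> : (c + (c + H n)) / 2 = c + H n.+1 by rewrite hs; field.
move=> hG.
have e4 : G A B C D / 4 ^+ n = 4 * (G A B C D / 4 ^+ n.+1).
  by rewrite exprS invfM; field; rewrite expf_neq0.
have VS a' c' : A <= a' -> a' + L n.+1 <= B -> C <= c' -> c' + H n.+1 <= D ->
    G A B C D / 4 ^+ n.+1 <= G a' (a' + L n.+1) c' (c' + H n.+1) -> V n.+1 (a', c').
  by split.
have eL : a + L n = a + L n.+1 + L n.+1 by rewrite ls; ring.
have eH : c + H n = c + H n.+1 + H n.+1 by rewrite hs; ring.
rewrite e4 in h5; move: (_ / 4 ^+ n.+1) h5 VS => g h5 VS {e4 ls hs}.
rewrite /Sub; rewrite eL eH in hG h2 h4 h5; move: (L n.+1) (H n.+1) l0 k0 VS hG h2 h4 h5.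
move=> l k l0 k0 VS hG h2 h4 h5 {eL eH aL cH}.
(* The four quarters together carry at least [4 * g]; if the first three stay below [g], the fourth
   cannot. *)
have [g1|g1] := lerP g (G a (a + l) c (c + k)).
  by exists (a, c); split; [apply: VS; lra|rewrite /=; lra|rewrite /=; lra].
have [g2|g2] := lerP g (G (a + l) (a + l + l) c (c + k)).
  by exists (a + l, c); split; [apply: VS; lra|rewrite /=; lra|rewrite /=; lra].
have [g3|g3] := lerP g (G a (a + l) (c + k) (c + k + k)).
  by exists (a, c + k); split; [apply: VS; lra|rewrite /=; lra|rewrite /=; lra].
by exists (a + l, c + k); split; [apply: VS; lra|rewrite /=; lra|rewrite /=; lra].
Qed.

(** The default value [p] of [xget] is never taken, because [step] provides a good quarter at every
    stage. *)
Let P n := iteri n (fun k p => xget p [set q | Sub k p q]) (A, C).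

Let VP n : V n (P n).
Proof.
elim: n => [|n IH].
  rewrite /V /P /= /L /H !expr0 !divr1 !(addrC _ (_ - _)) !subrK; split => //.
have [q Sq] := step IH.
by rewrite /P /=; case: xgetP => [x _ []|/(_ q)] //.
Qed.

Let SP n : Sub n (P n) (P n.+1).
Proof.
have [q Sq] := step (VP n).
by rewrite {2}/P /=; case: xgetP => [x _ //|/(_ q)] //.
Qed.

Let sup_between (u : nat -> R) (l : nat -> R) : (forall n, 0 <= l n) ->
  (forall n, u n <= u n.+1) -> (forall n, u n.+1 + l n.+1 <= u n + l n) ->
  exists x, forall n, u n <= x <= u n + l n.
Proof.
move=> l0 ui bd.
have um n k : u n <= u (n + k)%N.
  by elim: k => [|k IH]; rewrite ?addn0 // addnS; exact: le_trans IH (ui _).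
have bm n k : u (n + k)%N + l (n + k)%N <= u n + l n.
  by elim: k => [|k IH]; rewrite ?addn0 // addnS; exact: le_trans (bd _) IH.
have ub n m : u m <= u n + l n.
  have [nm|/ltnW nm] := leqP n m.
    by have := bm n (m - n)%N; rewrite subnKC //; have := l0 m; lra.
  by have := um m (n - m)%N; rewrite subnKC //; have := l0 n; lra.
have hs : has_sup (range u).
  by split; [exists (u 0), 0|exists (u 0 + l 0) => _ [m _ <-]].
exists (sup (range u)) => n; apply/andP; split.
  by apply: ub_le_sup; [exact: (proj2 hs)|exists n].
by apply: ge_sup; [exact: (proj1 hs)|move=> _ [m _ <-]].
Qed.

Let half_pow_small (K del : R) : 0 <= K -> 0 < del -> exists n, K / 2 ^+ n < del.
Proof.
move=> K0 d0; exists (Num.truncn (K / del)).+1.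
rewrite ltr_pdivrMr ?exprn_gt0 // mulrC -ltr_pdivrMr //.
apply: lt_trans (truncnS_gt _) _.
by rewrite -natrX ltr_nat; exact: ltn_expl.
Qed.

(** At the common point of the nested rectangles, [Gsmall] bounds the n-th value by e (S / 2^n)^2,
    while the invariant keeps it above [G A B C D] / 4^n. The powers of 4 cancel, leaving
    [G A B C D] <= e S^2, which the choice of [e] excludes; the added 1 in its denominator covers S
    = 0. *)
Lemma bisection_le0 : G A B C D <= 0.
Proof.
rewrite leNgt; apply/negP => g0.
have [x hx] : exists x, forall n, (P n).1 <= x <= (P n).1 + L n.
  apply: sup_between => // n; have [_ /andP[? ?] _] := SP n => //.
  by rewrite [L n]LS; lra.
have [y hy] : exists y, forall n, (P n).2 <= y <= (P n).2 + H n.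
  apply: sup_between => // n; have [_ _ /andP[? ?]] := SP n => //.
  by rewrite [H n]HS; lra.
pose S := B - A + (D - C).
have S0 : 0 <= S by rewrite addr_ge0 // subr_ge0.
pose e := G A B C D / (S ^+ 2 + 1).
have s0 := sqr_ge0 S.
have e0 : 0 < e by rewrite divr_gt0 //; lra.
have xAB : A <= x <= B.
  have [v1 v2 _ _ _] := VP 0; have /andP[w1 w2] := hx 0.
  by apply/andP; split; lra.
have yCD : C <= y <= D.
  have [_ _ v1 v2 _] := VP 0; have /andP[w1 w2] := hy 0.
  by apply/andP; split; lra.
have [del d0 hd] := Gsmall xAB yCD e0.
have [n hn] := half_pow_small S0 d0.
have [v1 v2 v3 v4 v5] := VP n.
have p2 : 0 < 2 ^+ n :> R by rewrite exprn_gt0.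
have lS : L n + H n = S / 2 ^+ n by rewrite /L /H /S -mulrDl.
have l0 := L0 n; have k0 := H0 n.
have := hd _ _ _ _ v1 (hx n) v2 v3 (hy n) v4.
have eL : (P n).1 + L n - (P n).1 = L n by ring.
have eH : (P n).2 + H n - (P n).2 = H n by ring.
have ld : L n < del by lra.
have kd : H n < del by lra.
rewrite eL eH lS => /(_ ld kd) /(le_trans v5).
have -> : e * (S / 2 ^+ n) ^+ 2 = e * S ^+ 2 / 4 ^+ n.
  rewrite expr_div_n -exprM mulnC exprM mulrA; congr (_ / _ ^+ _); ring.
rewrite ler_pM2r ?invr_gt0 ?exprn_gt0 //.
have : e * (S ^+ 2 + 1) = G A B C D by rewrite /e divfK //; lra.
by nra.
Qed.

End Bisection.

(** * Averages over the unit circle *)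

Section Circle.
Variable R : realType.
Implicit Types (h k : R[i] -> R[i]) (z w : R[i]) (x y t : R).

Lemma normc_expi t : normc (expi t) = 1.
Proof. by rewrite /normc /= cos2Dsin2 sqrtr1. Qed.

Lemma expi0 : expi 0 = 1 :> R[i].
Proof. by rewrite /expi cos0 sin0. Qed.

Lemma expi_2pi : expi (pi *+ 2) = 1 :> R[i].
Proof. by rewrite /expi cos2pi sin2pi. Qed.

Lemma real_lipschitz1 (f f' : R -> R) : (forall x : R, is_derive x (1 : R) f (f' x)) ->
  (forall x, `|f' x| <= 1) -> forall x y, `|f x - f y| <= `|x - y|.
Proof.
move=> df f'1 x y; wlog xy : x y / y <= x.
  move=> H; have [yx|/ltW xy] := leP y x; first exact: (H _ _ yx).
  by rewrite distrC (distrC x); exact: H.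
move: xy; rewrite le_eqVlt => /orP[/eqP ->|yx]; first by rewrite !subrr.
have [|c _ ->] := MVT yx (fun c _ => df c).
  apply: derivable_within_continuous => c _; by have [] := df c.
by rewrite normrM ler_piMl.
Qed.

Lemma expi_lipschitz x y : normc (expi x - expi y) <= 2 * `|x - y|.
Proof.
have hc : `|cos x - cos y| <= `|x - y|.
  apply: (real_lipschitz1 (f' := fun x => - sin x)) => t.
  by rewrite normrN ler_norml sin_geN1 sin_le1.
have hs : `|sin x - sin y| <= `|x - y|.
  by apply: (real_lipschitz1 (f' := cos)) => t; rewrite ler_norml cos_geN1 cos_le1.
by apply: le_trans (normc_le_ReIm _) _; rewrite /= ; lra.
Qed.

Lemma rcont_expi a b h : (forall z, normc z = 1 -> ccont h z) ->
  rcont a b (fun t => h (expi t)).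
Proof.
move=> ch; apply: (rcont_comp expi_lipschitz) => x _.
by apply: ch; exact: normc_expi.
Qed.

Lemma cint_expi a b : a <= b -> cint a b (@expi R) = - 'i * (expi b - expi a).
Proof.
move=> ab; have ce : rcont a b (@expi R).
  by apply: (@rcont_comp _ _ _ id _ _ expi_lipschitz) => x _; exact: ccont_id.
have dc (x : R) : is_derive x (1 : R) (fun x => - cos x) (Im (expi x)).
  by rewrite -[Im _]opprK; exact: is_deriveN.
rewrite (cint_derive ab ce (@is_derive_sin R) dc).
by apply/eqP; rewrite eq_complex /=; apply/andP; split; apply/eqP; ring.
Qed.

(** This mean is the contour integral of h(w) dw / w over the unit circle divided by 2 pi i.
    Accordingly the Cauchy kernel dw / (w - z) appears below as the factor [w / (w - z)]. *)
Definition cavg h : R[i] := ((pi *+ 2)^-1)%:C * cint 0 (pi *+ 2) (fun t => h (expi t)).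

Definition circ_cont h := forall z, normc z = 1 -> ccont h z.

Let pi2_gt0 : 0 < pi *+ 2 :> R.
Proof. by rewrite pmulrn_lgt0 // pi_gt0. Qed.

Lemma eq_cavg h k : (forall z, normc z = 1 -> h z = k z) -> cavg h = cavg k.
Proof. by move=> hk; congr (_ * _); apply: eq_cint => x _; rewrite hk ?normc_expi. Qed.

Lemma cavgD h k : circ_cont h -> circ_cont k ->
  cavg (fun z => h z + k z) = cavg h + cavg k.
Proof. by move=> ch ck; rewrite /cavg cintD ?mulrDr //; exact: rcont_expi. Qed.

Lemma cavgZ c h : circ_cont h -> cavg (fun z => c * h z) = c * cavg h.
Proof. by move=> ch; rewrite /cavg cintZ; [rewrite mulrCA|exact: rcont_expi]. Qed.

Lemma cavgB h k : circ_cont h -> circ_cont k ->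
  cavg (fun z => h z - k z) = cavg h - cavg k.
Proof.
move=> ch ck; rewrite -(mulN1r (cavg k)) -cavgZ // -cavgD //.
  by apply: eq_cavg => z _; rewrite mulN1r.
by move=> z z1; apply: ccontM; [exact: ccont_cst|exact: ck].
Qed.

Lemma cavg_cst c : cavg (fun=> c) = c.
Proof.
rewrite /cavg cint_cst ?ltW // subr0 mulrA -rmorphM mulVf ?gt_eqF //.
by rewrite rmorph1 mul1r.
Qed.

Lemma cavg_conj h : circ_cont h -> cavg (fun z => (h z)^*) = (cavg h)^*.
Proof.
move=> ch; rewrite /cavg cint_conj ?rmorphM; last exact: rcont_expi.
by congr (_ * _); symmetry; exact: conjc_real.
Qed.

Lemma normc_cavg_le h k : circ_cont h -> circ_cont k ->
  (forall z, normc z = 1 -> normc (h z) <= Re (k z)) ->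
  normc (cavg h) <= Re (cavg k).
Proof.
move=> ch ck hk; rewrite /cavg Re_mulr_real normcM normc_real.
have p0 : 0 <= (pi *+ 2)^-1 :> R by rewrite invr_ge0 ltW.
rewrite ger0_norm // ler_wpM2l // normc_cint_le //; try exact: rcont_expi.
by move=> x _; apply: hk; exact: normc_expi.
Qed.

Lemma normc_cavg_le_cst h (M : R) : circ_cont h ->
  (forall z, normc z = 1 -> normc (h z) <= M) -> normc (cavg h) <= M.
Proof.
move=> ch hM; have := normc_cavg_le ch (fun z _ => ccont_cst M%:C z) hM.
by rewrite cavg_cst.
Qed.

End Circle.

(** * Contraction of the circle to an interior point *)

Section CauchyFormula.
Variables (R : realType) (h : R[i] -> R[i]) (z : R[i]).
Hypothesis z1 : normc z < 1.

Let u (s : R) (w : R[i]) := z + s%:C * (w - z).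

Let u_le1 s w : 0 <= s <= 1 -> normc w = 1 -> normc (u s w) <= 1.
Proof.
move=> /andP[s0 s1] w1; have -> : u s w = (1 - s)%:C * z + s%:C * w.
  by rewrite /u rmorphB rmorph1; ring.
apply: le_trans (le_normcD _ _) _; rewrite !normcM !normc_real w1.
have := z1; rewrite !ger0_norm ?subr_ge0 // => /ltW zl1.
by have := ler_wpM2l (_ : 0 <= 1 - s) zl1; rewrite subr_ge0 => /(_ s1); lra.
Qed.

Let wz0 w : normc w = 1 -> w - z != 0.
Proof. by move=> w1; rewrite subr_eq0; apply: contraTneq z1 => <-; rewrite w1 ltxx. Qed.

(* The integral of the pulled-back form -i k(u) du / (u - z) along the boundary of
   the rectangle [a, b] x [c, d] in the parameters (s, t) of u s (expi t). *)
Let J (k : R[i] -> R[i]) (a b c d : R) : R[i] :=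
  cint c d (fun t => (k (u b (expi t)) - k (u a (expi t))) * (expi t / (expi t - z)))
  + 'i * cint a b (fun s => (k (u s (expi d)) - k (u s (expi c))) / s%:C).

Let disc_cont (k : R[i] -> R[i]) := forall w, normc w <= 1 -> ccont k w.

Let ccont_ker w : normc w = 1 -> ccont (fun w => w / (w - z)) w.
Proof.
move=> w1; apply: ccontM; first exact: ccont_id.
apply: ccontV; last exact: wz0.
by apply: ccontB; [exact: ccont_id|exact: ccont_cst].
Qed.

Let ccont_u s w : ccont (u s) w.
Proof.
apply: ccontD; first exact: ccont_cst.
apply: ccontM; first exact: ccont_cst.
by apply: ccontB; [exact: ccont_id|exact: ccont_cst].
Qed.

Let rcont_theta2 k a b c d : disc_cont k -> 0 <= a <= 1 -> 0 <= b <= 1 ->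
  rcont c d (fun t => (k (u b (expi t)) - k (u a (expi t))) * (expi t / (expi t - z))).
Proof.
move=> ck a01 b01.
apply: (@rcont_expi _ _ _ (fun w => (k (u b w) - k (u a w)) * (w / (w - z)))) => w w1.
apply: ccontM; last exact: ccont_ker.
apply: ccontB.
  by apply: (@ccont_comp _ k (u b)); [exact: ccont_u|apply: ck; exact: u_le1].
by apply: (@ccont_comp _ k (u a)); [exact: ccont_u|apply: ck; exact: u_le1].
Qed.

Let rcont_s k a b v w : disc_cont k -> 0 < a -> b <= 1 -> normc w = 1 -> normc v = 1 ->
  rcont a b (fun s => (k (u s w) - k (u s v)) / s%:C).
Proof.
move=> ck a0 b1 w1 v1.
apply: (@rcont_comp _ a b (fun s => (k (z + s * (w - z)) - k (z + s * (v - z))) / s)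
   (real_complex R) 1).
  by move=> x y; rewrite -rmorphB normc_real mul1r.
move=> x /andP[ax xb]; have x01 : 0 <= x <= 1 by apply/andP; split; lra.
have cu t : normc t = 1 -> ccont (fun s => k (z + s * (t - z))) x%:C.
  move=> t1; apply: (@ccont_comp _ k (fun s => z + s * (t - z))).
    apply: ccontD; first exact: ccont_cst.
    by apply: ccontM; [exact: ccont_id|exact: ccont_cst].
  by apply: ck; exact: u_le1.
apply: ccontM; first by apply: ccontB; exact: cu.
apply: ccontV; first exact: ccont_id.
by rewrite -(rmorph0 (real_complex R)) (inj_eq (@complexI _)); lra.
Qed.

Let J_split_s k a m b c d : disc_cont k -> 0 < a -> a <= m -> m <= b -> b <= 1 ->
  J k a b c d = J k a m c d + J k m b c d.
Proof.
move=> ck a0 am mb b1; rewrite /J (@cint_split _ a m b) //; last first.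
  by apply: rcont_s => //; exact: normc_expi.
rewrite mulrDr addrACA; congr (_ + _); rewrite -cintD; last 2 first.
- by apply: rcont_theta2 => //; apply/andP; split; lra.
- by apply: rcont_theta2 => //; apply/andP; split; lra.
by apply: eq_cint => t _; ring.
Qed.

Let J_split_t k a b c m d : disc_cont k -> 0 < a -> a <= b -> b <= 1 -> c <= m -> m <= d ->
  J k a b c d = J k a b c m + J k a b m d.
Proof.
move=> ck a0 ab b1 cm md; rewrite /J (@cint_split _ c m d) //; last first.
  by apply: rcont_theta2 => //; apply/andP; split; lra.
rewrite addrACA -mulrDr; congr (_ + 'i * _); rewrite -cintD; last 2 first.
- by apply: rcont_s => //; exact: normc_expi.
- by apply: rcont_s => //; exact: normc_expi.
by apply: eq_cint => t _; ring.
Qed.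

(** The constant [p] drops out of the differences between opposite sides. For the linear part the
    factor u - z cancels the kernel, leaving the closed form q du, and the two pairs of sides
    compensate each other. *)
Let J_affine p q a b c d : 0 < a -> a <= b -> b <= 1 -> c <= d ->
  J (fun w => p + q * (w - z)) a b c d = 0.
Proof.
move=> a0 ab b1 cd; rewrite /J.
rewrite (@eq_cint _ c d _ (fun t => ((b - a)%:C * q) * expi t)); last first.
  move=> t _; rewrite /u rmorphB; field; apply: wz0; exact: normc_expi.
rewrite (@eq_cint _ a b _ (fun=> q * (expi d - expi c))); last first.
  move=> s /andP[as_ _]; rewrite /u; field.
  by rewrite -(rmorph0 (real_complex R)) (inj_eq (@complexI _)); lra.
rewrite cintZ ?cint_expi ?cint_cst //; first by ring.
by apply: (@rcont_comp _ _ _ id _ _ (@expi_lipschitz R)) => x _; exact: ccont_id.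
Qed.

Let J_sub k l a b c d : disc_cont k -> disc_cont l -> 0 < a -> a <= b -> b <= 1 ->
  J (fun w => k w - l w) a b c d = J k a b c d - J l a b c d.
Proof.
move=> ck cl a0 ab b1; rewrite /J opprD addrACA -mulrN -mulrDr.
have a01 : 0 <= a <= 1 by apply/andP; split; lra.
have b01 : 0 <= b <= 1 by apply/andP; split; lra.
have rs v := rcont_s v a0 b1 (normc_expi d) (normc_expi c).
have rt v (cv : disc_cont v) := @rcont_theta2 v a b c d cv a01 b01.
rewrite -![- cint _ _ _]mulN1r -(cintZ _ (rs _ cl)) -(cintZ _ (rt _ cl)).
rewrite -(cintD (rs _ ck) (rcontZ _ (rs _ cl))) -(cintD (rt _ ck) (rcontZ _ (rt _ cl))).
by congr (_ + 'i * _); apply: eq_cint => t _; ring.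
Qed.

Hypothesis dh : forall w, normc w <= 1 -> exists d, cderiv h w d.

Let ch : disc_cont h.
Proof. by move=> w /dh[d]; exact: cderiv_cont. Qed.

(* Affine functions do not contribute to J, so near a point only the
   differentiability remainder of h does. *)
Let J_small (a0 x y : R) : 0 < a0 -> a0 <= x <= 1 -> forall eps : R, 0 < eps ->
  exists2 del : R, 0 < del & forall a b c d, a0 <= a -> a <= x <= b -> b <= 1 ->
    c <= y <= d -> b - a < del -> d - c < del ->
    normc (J h a b c d) <= eps * (b - a + (d - c)) ^+ 2.
Proof.
move=> a00 /andP[ax x1] eps e0.
have x01 : 0 <= x <= 1 by apply/andP; split; lra.
pose w0 := u x (expi y).
have w01 : normc w0 <= 1 by apply: u_le1 => //; exact: normc_expi.
have [d0 hd0] := dh w01.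
(* The summands bound the two kernels: |w / (w - z)| on the circle and 1 / s on the radial sides.
   The second is the reason for staying at s >= a0 > 0. The 4 in [e'] comes from subtracting two
   remainders, each at most [e' * (2 * S)]. *)
pose K := 1 / (1 - normc z) + 1 / a0.
have K0 : 0 < K by rewrite addr_gt0 // divr_gt0 // subr_gt0.
pose e' := eps / (4 * K).
have e'0 : 0 < e' by rewrite divr_gt0 // mulr_gt0.
have [del del0 hdel] := hd0 _ e'0.
exists (del / 4); first by rewrite divr_gt0.
move=> a b c d aa /andP[ax' xb] b1 /andP[cy yd] bad cdd.
have ab : a <= b by lra.
have cd : c <= d by lra.
have pa : 0 < a by lra.
pose l := fun w => h w0 - d0 * (w0 - z) + d0 * (w - z).
have cl : disc_cont l.
  move=> w _; apply: ccontD; first exact: ccont_cst.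
  by apply: ccontM; [exact: ccont_cst|apply: ccontB; [exact: ccont_id|exact: ccont_cst]].
have -> : J h a b c d = J (fun w => h w - l w) a b c d.
  by rewrite J_sub // /l J_affine // subr0.
set S := b - a + (d - c).
have S0 : 0 <= S by rewrite /S; lra.
have near s t : a <= s <= b -> c <= t <= d -> normc (u s (expi t) - w0) <= 2 * S.
  move=> /andP[as_ sb] /andP[ct td].
  have -> : u s (expi t) - w0 = (s - x)%:C * (expi t - z) + x%:C * (expi t - expi y).
    by rewrite /w0 /u rmorphB; ring.
  apply: le_trans (le_normcD _ _) _; rewrite !normcM !normc_real.
  have zl1 := z1; have h1 := ler_normcB (expi t) z; rewrite normc_expi in h1.
  have h2 := expi_lipschitz t y.
  have h3 : `|s - x| <= b - a by rewrite ler_norml; apply/andP; split; lra.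
  have h4 : `|t - y| <= d - c by rewrite ler_norml; apply/andP; split; lra.
  have h5 : `|s - x| * normc (expi t - z) <= (b - a) * 2.
    by apply: ler_pM; rewrite ?normr_ge0 ?normc_ge0 //; lra.
  have h6 : `|x| * normc (expi t - expi y) <= 1 * (2 * (d - c)).
    apply: ler_pM; rewrite ?normr_ge0 ?normc_ge0 //; first by rewrite ger0_norm; lra.
    by apply: le_trans h2 _; lra.
  rewrite /S; lra.
have rem s t : a <= s <= b -> c <= t <= d ->
    normc (h (u s (expi t)) - l (u s (expi t))) <= e' * (2 * S).
  move=> sab tcd; have nst := near _ _ sab tcd.
  have := hdel (u s (expi t)); rewrite /l.
  have -> : h (u s (expi t)) - (h w0 - d0 * (w0 - z) + d0 * (u s (expi t) - z)) =
     h (u s (expi t)) - h w0 - d0 * (u s (expi t) - w0) by ring.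
  move=> H; apply: le_trans (H _) _; first by apply: le_lt_trans nst _; rewrite /S; lra.
  by apply: ler_wpM2l nst; exact: ltW.
have ckl : disc_cont (fun w => h w - l w) by move=> w w1; apply: ccontB; [exact: ch|exact: cl].
have rem2 s t s' t' : a <= s <= b -> c <= t <= d -> a <= s' <= b -> c <= t' <= d ->
    normc (h (u s (expi t)) - l (u s (expi t)) - (h (u s' (expi t')) - l (u s' (expi t'))))
     <= e' * (4 * S).
  move=> i1 i2 i3 i4; apply: le_trans (ler_normcB _ _) _.
  by have := rem _ _ i1 i2; have := rem _ _ i3 i4; lra.
have aab : a <= a <= b by rewrite lexx.
have bab : a <= b <= b by rewrite lexx ab.
have ccd : c <= c <= d by rewrite lexx.
have dcd : c <= d <= d by rewrite lexx cd.
have eS0 : 0 <= e' * (4 * S) by rewrite mulr_ge0 ?(ltW e'0) //; lra.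
apply: le_trans (le_normcD _ _) _.
have b1' : normc (cint c d (fun t => (h (u b (expi t)) - l (u b (expi t)) -
    (h (u a (expi t)) - l (u a (expi t)))) * (expi t / (expi t - z))))
    <= (d - c) * (e' * (4 * S) * (1 / (1 - normc z))).
  apply: normc_cint_le_cst => //.
    apply: (@rcont_theta2 (fun w => h w - l w)) => //; apply/andP; split; lra.
  move=> t tcd; rewrite normcM; apply: ler_pM; rewrite ?normc_ge0 //; first exact: rem2.
  rewrite normcM normcV normc_expi; apply: ler_pM => //; rewrite ?invr_ge0 ?normc_ge0 //.
  have := ler_dist_normc (expi t) z; rewrite normc_expi => hz; have zl1 := z1.
  by rewrite lef_pV2 ?posrE //; lra.
have b2' : normc ('i * cint a b (fun s => (h (u s (expi d)) - l (u s (expi d)) -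
    (h (u s (expi c)) - l (u s (expi c)))) / s%:C))
    <= (b - a) * (e' * (4 * S) * (1 / a0)).
  rewrite normcM (_ : normc 'i = 1) ?mul1r; last by rewrite /normc /= expr0n expr1n add0r sqrtr1.
  apply: normc_cint_le_cst => //.
    by apply: (@rcont_s (fun w => h w - l w)) => //; exact: normc_expi.
  move=> s sab; rewrite normcM; apply: ler_pM; rewrite ?normc_ge0 //; first exact: rem2.
  case/andP: sab => as_ sb.
  by rewrite normcV normc_real ger0_norm ?mul1r ?lef_pV2 ?posrE //; lra.
apply: le_trans (lerD b1' b2') _.
have -> : eps * S ^+ 2 = S * (e' * (4 * S) * K).
  by rewrite /e'; field; rewrite gt_eqF.
have p1 : 0 < 1 / (1 - normc z) by rewrite divr_gt0 // subr_gt0.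
have p2 : 0 < 1 / a0 by rewrite divr_gt0.
rewrite /K; move: p1 p2; set k1 := 1 / (1 - normc z); set k2 := 1 / a0 => p1 p2.
have q1 : (d - c) * (e' * (4 * S) * k1) <= S * (e' * (4 * S) * k1).
  by apply: ler_wpM2r; [rewrite mulr_ge0 // ltW|rewrite /S; lra].
have q2 : (b - a) * (e' * (4 * S) * k2) <= S * (e' * (4 * S) * k2).
  by apply: ler_wpM2r; [rewrite mulr_ge0 // ltW|rewrite /S; lra].
by rewrite [e' * _ * (_ + _)]mulrDr [S * (_ + _)]mulrDr; exact: lerD.
Qed.

(** The sides t = 0 and t = 2 pi of the parameter rectangle have the same image and cancel. What
    remains of [J = 0] is the equality of the means at the two ends s = 1 and s = a0 of the
    homotopy. *)
Lemma cauchy_circle_radius (a0 : R) : 0 < a0 <= 1 ->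
  cavg (fun w => h w * (w / (w - z))) = cavg (fun w => h (z + a0%:C * (w - z)) * (w / (w - z))).
Proof.
move=> /andP[a00 a01]; have a001 : 0 <= a0 <= 1 by rewrite ltW.
have one01 : 0 <= (1 : R) <= 1 by rewrite lexx ler01.
have p0 : 0 <= pi *+ 2 :> R by rewrite mulrn_wge0 // pi_ge0.
have J0 : J h a0 1 0 (pi *+ 2) = 0.
  apply/eqP; rewrite -normc_eq0 eq_le normc_ge0 andbT.
  apply: (@bisection_le0 _ (fun a b c d => normc (J h a b c d))) => //.
  - move=> a b c d aa ab b1 c0 cd d2.
    have am : a <= (a + b) / 2 by rewrite ler_pdivlMr //; lra.
    have mb : (a + b) / 2 <= b by rewrite ler_pdivrMr //; lra.
    have cm : c <= (c + d) / 2 by rewrite ler_pdivlMr //; lra.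
    have md : (c + d) / 2 <= d by rewrite ler_pdivrMr //; lra.
    have pa : 0 < a by lra.
    rewrite (@J_split_s h a ((a + b) / 2)) // (@J_split_t h a _ c ((c + d) / 2)) //; last by lra.
    rewrite (@J_split_t h _ b c ((c + d) / 2)) //; last by lra.
    rewrite addrACA; apply: le_trans (le_normcD _ _) _; rewrite -[leRHS]addrA.
    by apply: lerD; exact: le_normcD.
  - move=> x y xab ycd eps e0; have [del d0 hd] := J_small y a00 xab e0.
    by exists del => // a b c d ? ? ? _ ? _ ? ?; exact: hd.
move: J0; rewrite /J expi_2pi expi0.
rewrite (@eq_cint _ a0 1 _ (fun=> 0)); last by move=> s _; rewrite subrr mul0r.
rewrite cint_cst // !mulr0 addr0 => J0.
have /eqP := congr1 (fun x => ((pi *+ 2)^-1)%:C * x) J0; rewrite mulr0.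
have -> : (pi *+ 2)^-1%:C * cint 0 (pi *+ 2) (fun t => (h (u 1 (expi t)) - h (u a0 (expi t))) *
     (expi t / (expi t - z))) = cavg (fun w => h w * (w / (w - z)) -
       h (z + a0%:C * (w - z)) * (w / (w - z))).
  congr (_ * _); apply: eq_cint => t _; rewrite /u rmorph1 mul1r [z + (_ - z)]addrC subrK.
  by ring.
rewrite cavgB.
- by rewrite subr_eq0 => /eqP.
- by move=> w w1; apply: ccontM; [apply: ch; rewrite w1|exact: ccont_ker].
- move=> w w1; apply: ccontM; last exact: ccont_ker.
  by apply: (@ccont_comp _ h (u a0)); [exact: ccont_u|apply: ch; exact: u_le1].
Qed.

(** As a0 tends to 0, h(z + a0 (w - z)) tends to h(z) uniformly on the circle, by continuity at [z]
    alone. The remaining mean of the kernel is the winding number, evaluated separately. *)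
Lemma cauchy_formula_winding :
  cavg (fun w => h w * (w / (w - z))) = h z * cavg (fun w => w / (w - z)).
Proof.
apply/eqP; rewrite -subr_eq0 -normc_eq0 eq_le normc_ge0 andbT leNgt; apply/negP => n0.
set n := normc _ in n0.
have zl1 := z1.
pose K := 1 / (1 - normc z).
have K0 : 0 < K by rewrite divr_gt0 //; lra.
have e0 : 0 < n / (2 * K) by rewrite divr_gt0 // mulr_gt0.
have [del d0 hd] := ch (ltW z1) e0.
(* Since |w - z| <= 2 on the circle, the contracted point stays within del / 2 of [z]. *)
pose a0 := Num.min 1 (del / 4).
have a00 : 0 < a0 by rewrite lt_min ltr01 divr_gt0.
have a01 : a0 <= 1 by rewrite ge_min lexx.
have ad : a0 <= del / 4 by rewrite ge_min lexx orbT.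
have a001 : 0 <= a0 <= 1 by rewrite ltW.
have cu : circ_cont (fun w => h (z + a0%:C * (w - z)) * (w / (w - z))).
  move=> w w1; apply: ccontM; last exact: ccont_ker.
  by apply: (@ccont_comp _ h (u a0)); [exact: ccont_u|apply: ch; exact: u_le1].
have cz : circ_cont (fun w => h z * (w / (w - z))).
  by move=> w w1; apply: ccontM; [exact: ccont_cst|exact: ccont_ker].
have : n <= n / (2 * K) * K.
  rewrite {1}/n (@cauchy_circle_radius a0) ?a00 // -cavgZ; last exact: ccont_ker.
  rewrite -cavgB //; apply: normc_cavg_le_cst.
    by move=> w w1; apply: ccontB; [exact: cu|exact: cz].
  move=> w w1; rewrite -mulrBl normcM; apply: ler_pM; rewrite ?normc_ge0 //.
    apply: hd; rewrite addrAC subrr add0r normcM normc_real gtr0_norm //.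
    have := ler_normcB w z; rewrite w1 => hw.
    apply: (@le_lt_trans _ _ (a0 * 2)); first by rewrite ler_pM2l //; lra.
    by lra.
  rewrite normcM normcV w1 /K ler_pM2l //.
  have := ler_dist_normc w z; rewrite w1 => hz.
  by rewrite lef_pV2 ?posrE //; lra.
have -> : n / (2 * K) * K = n / 2 by field; rewrite gt_eqF.
by lra.
Qed.

End CauchyFormula.

(** * The winding number and Cauchy's formula *)

Section CauchyFormula2.
Variable R : realType.
Implicit Types (h : R[i] -> R[i]) (z w : R[i]).

Lemma circle_sub_neq0 z w : normc z < 1 -> normc w = 1 -> w - z != 0.
Proof. by move=> z1 w1; rewrite subr_eq0; apply: contraTneq z1 => <-; rewrite w1 ltxx. Qed.

(** At z = 0 the kernel is identically 1, so this case is available before the winding number is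
    known at other points, and it serves to compute that number. *)
Lemma mean_value h : (forall w, normc w <= 1 -> exists d, cderiv h w d) ->
  cavg h = h 0.
Proof.
move=> dh; have n0 : normc (0 : R[i]) < 1 by rewrite normc0.
have := cauchy_formula_winding n0 dh.
rewrite (@eq_cavg _ (fun w => h w * _) h); last first.
  move=> w w1; rewrite subr0 divff ?mulr1 // -normc_gt0 w1 //.
rewrite (@eq_cavg _ (fun w => w / _) (fun=> 1)); last first.
  move=> w w1; rewrite subr0 divff // -normc_gt0 w1 //.
by rewrite cavg_cst mulr1.
Qed.

(* On the circle conj(1/(w - z)) = w / (1 - conj(z) w) is holomorphic inside
   and vanishes at 0. *)
Lemma cavg_cauchy_kernel z : normc z < 1 -> cavg (fun w => w / (w - z)) = 1.
Proof.
move=> z1; have cV : circ_cont (fun w => (w - z)^-1).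
  move=> w w1; apply: ccontV; last exact: circle_sub_neq0.
  by apply: ccontB; [exact: ccont_id|exact: ccont_cst].
have k0 : cavg (fun w => (w - z)^-1) = 0.
  rewrite -[LHS]conjcK -cavg_conj //.
  rewrite (@eq_cavg _ _ (fun w => w / (1 - z^* * w))); last first.
    move=> w w1; have ww : w * w^* = 1 by rewrite mul_conjc w1 expr1n.
    have w0 : w != 0 by rewrite -normc_gt0 w1.
    have wz : w - z != 0 by exact: circle_sub_neq0.
    have cwz : w^* - z^* != 0 by rewrite -rmorphB conjc_eq0.
    rewrite conjc_inv rmorphB.
    have -> : 1 - z^* * w = w * (w^* - z^*) by rewrite mulrBr ww; ring.
    by field; rewrite cwz w0.
  rewrite mean_value ?mul0r ?conjc0 // => w w1.
  have nz : 1 - z^* * w != 0.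
    rewrite subr_eq0; apply/eqP => e; have := congr1 (@normc R) e.
    rewrite normc1 normcM normc_conj => e1; have := normc_ge0 z.
    have := ler_wpM2l (normc_ge0 z) w1; lra.
  eexists; apply: cderivM; first exact: cderiv_id.
  apply: cderivV => //; apply: cderivB; first exact: cderiv_cst.
  by apply: cderivZ; exact: cderiv_id.
rewrite (@eq_cavg _ _ (fun w => 1 + z * (w - z)^-1)); last first.
  by move=> w w1; field; exact: circle_sub_neq0.
rewrite cavgD ?cavgZ ?cavg_cst ?k0 ?mulr0 ?addr0 //.
  by move=> w _; exact: ccont_cst.
by move=> w w1; apply: ccontM; [exact: ccont_cst|exact: cV].
Qed.

Lemma cauchy_formula h z : normc z < 1 ->
  (forall w, normc w <= 1 -> exists d, cderiv h w d) ->
  h z = cavg (fun w => h w * (w / (w - z))).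
Proof. by move=> z1 dh; rewrite cauchy_formula_winding // cavg_cauchy_kernel // mulr1. Qed.

End CauchyFormula2.

(** * Taylor coefficients and the identity theorem *)

Section TaylorCoefficients.
Variable R : realType.
Implicit Types (h k : R[i] -> R[i]) (z w : R[i]).

Definition holo_cdisc h := forall w, normc w <= 1 -> exists d, cderiv h w d.

(** For [h] holomorphic on the closed disc this is the Taylor coefficient h^(n)(0) / n!. *)
Definition coef h n := cavg (fun w => h w * w^-1 ^+ n).

(* h z is the sum of coef h i * z ^+ i for i < n, plus z ^+ n * tail h n z. *)
Definition tail h n z := cavg (fun w => h w * w^-1 ^+ n * (w / (w - z))).

(** Serves twice: to get bounds on the circle from compactness of a parameter interval, and to name
    the angles theta_l in the equality case. *)
Lemma unit_circle_expi z : normc z = 1 -> exists2 t : R, - pi <= t <= pi & z = expi t.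
Proof.
move=> z1; have := sqr_normc_ReIm z; rewrite z1 expr1n.
case: z z1 => a b z1 /= ab.
have a1 : -1 <= a <= 1 by rewrite -ler_norml -z1 -[a]/(Re (a +i* b)) normRe_le.
have ca : cos (acos a) = a by rewrite acosK // in_itv.
have p0 := acos_ge0 a1; have p1 := acos_lepi a1.
have sa : sin (acos a) ^+ 2 = b ^+ 2.
  by rewrite sin2cos2 ca; lra.
have /orP[/eqP sb|/eqP sb] : (sin (acos a) == b) || (sin (acos a) == - b).
  by rewrite -eqf_sqr sa.
  exists (acos a); last by rewrite /expi ca sb.
  by apply/andP; split; lra.
exists (- acos a); last by rewrite /expi cosN ca sinN sb opprK.
by apply/andP; split; lra.
Qed.

Lemma circ_bounded h : circ_cont h ->
  exists2 M : R, 0 < M & forall z, normc z = 1 -> normc (h z) <= M.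
Proof.
move=> ch; have pp : - pi <= pi :> R by have := @pi_ge0 R; lra.
have [|t _ ht] := @EVT_max R (fun t => normc (h (expi t))) (- pi) pi pp.
  apply: within_continuous_eps => x xab e e0.
  have [del d0 hd] := rcont_expi ch xab e0; exists del => // y yab /(hd y yab).
  apply: le_trans; rewrite ler_norml ler_dist_normc andbT.
  by have := ler_dist_normc (h (expi x)) (h (expi y)); rewrite normcB; lra.
exists (normc (h (expi t)) + 1); first by have := normc_ge0 (h (expi t)); lra.
move=> z /unit_circle_expi[s sab ->].
by have := ht s; rewrite in_itv /= => /(_ sab); lra.
Qed.

Lemma ccontX h z n : ccont h z -> ccont (fun w => h w ^+ n) z.
Proof.
move=> ch; elim: n => [|n IH]; first by exact: ccont_cst.
apply: (@eq_ind _ _ (fun f => ccont f z) (ccontM ch IH)).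
by apply: funext => w; rewrite exprS.
Qed.

Lemma circ_contX h n : circ_cont h -> circ_cont (fun w => h w * w^-1 ^+ n).
Proof.
move=> ch w w1; apply: ccontM; first exact: ch.
apply: ccontX; apply: ccontV; first exact: ccont_id.
by rewrite -normc_gt0 w1.
Qed.

Lemma ccont_cauchy_ker z w : normc z < 1 -> normc w = 1 -> ccont (fun w => w / (w - z)) w.
Proof.
move=> z1 w1; apply: ccontM; first exact: ccont_id.
apply: ccontV; last exact: circle_sub_neq0.
by apply: ccontB; [exact: ccont_id|exact: ccont_cst].
Qed.

Lemma holo_cdisc_circ h : holo_cdisc h -> circ_cont h.
Proof. by move=> hh w w1; have [|d] := hh w; [rewrite w1|exact: cderiv_cont]. Qed.

Lemma tail0E h z : holo_cdisc h -> normc z < 1 -> h z = tail h 0 z.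
Proof.
move=> hh z1; rewrite {1}(cauchy_formula z1 hh); apply: eq_cavg => w w1.
by rewrite expr0 mulr1.
Qed.

(** One step of the geometric series: w / (w - z) = 1 + (z / w) (w / (w - z)). *)
Lemma tailS h z n : circ_cont h -> normc z < 1 -> tail h n z = coef h n + z * tail h n.+1 z.
Proof.
move=> ch z1; rewrite /tail /coef -cavgZ; last first.
  by move=> w w1; apply: ccontM; [exact: circ_contX|exact: ccont_cauchy_ker].
rewrite -cavgD; last 2 first.
- exact: circ_contX.
- move=> w w1; apply: ccontM; first exact: ccont_cst.
  by apply: ccontM; [exact: circ_contX|exact: ccont_cauchy_ker].
apply: eq_cavg => w w1; have w0 : w != 0 by rewrite -normc_gt0 w1.
have wz := circle_sub_neq0 z1 w1.
have e : w / (w - z) = 1 + z * (w^-1 * (w / (w - z))) by field; rewrite wz w0.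
by rewrite {1}e exprSr; ring.
Qed.

Lemma normc_unitV_X w n : normc w = 1 -> normc (w^-1 ^+ n) = 1.
Proof. by move=> w1; rewrite normcX normcV w1 invr1 expr1n. Qed.

Lemma normc_tail_le h z n (M : R) : circ_cont h -> normc z < 1 ->
  (forall w, normc w = 1 -> normc (h w) <= M) -> normc (tail h n z) <= M / (1 - normc z).
Proof.
move=> ch z1 hM; apply: normc_cavg_le_cst.
  by move=> w w1; apply: ccontM; [exact: circ_contX|exact: ccont_cauchy_ker].
move=> w w1; rewrite !normcM normcV normc_unitV_X // w1 mulr1 mul1r.
have := ler_dist_normc w z; rewrite w1 => hz.
by apply: ler_pM; rewrite ?invr_ge0 ?normc_ge0 ?hM // lef_pV2 ?posrE //; lra.
Qed.

Lemma normc_coef_le h n (M : R) : circ_cont h ->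
  (forall w, normc w = 1 -> normc (h w) <= M) -> normc (coef h n) <= M.
Proof.
move=> ch hM; apply: normc_cavg_le_cst; first exact: circ_contX.
by move=> w w1; rewrite normcM normc_unitV_X // mulr1 hM.
Qed.

Lemma normc_tail_le2 h z n (M : R) : circ_cont h -> normc z <= 1 / 2 ->
  (forall w, normc w = 1 -> normc (h w) <= M) -> normc (tail h n z) <= 2 * M.
Proof.
move=> ch z2 hM; have z1 : normc z < 1 by lra.
apply: le_trans (normc_tail_le n ch z1 hM) _.
have M0 : 0 <= M by apply: le_trans (hM 1 (normc1 _)); exact: normc_ge0.
rewrite ler_pdivrMr; last by lra.
nra.
Qed.

Lemma coef0E h : holo_cdisc h -> coef h 0 = h 0.
Proof.
move=> hh; have n0 : normc (0 : R[i]) < 1 by rewrite normc0.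
by rewrite [in RHS]tail0E // tailS ?mul0r ?addr0 //; exact: holo_cdisc_circ.
Qed.

Lemma taylor2 h z : holo_cdisc h -> normc z < 1 ->
  h z = h 0 + coef h 1 * z + z ^+ 2 * tail h 2 z.
Proof.
move=> hh z1; have ch := holo_cdisc_circ hh.
by rewrite {1}tail0E // tailS // tailS // coef0E //; ring.
Qed.

Lemma cderiv_coef1 h : holo_cdisc h -> cderiv h 0 (coef h 1).
Proof.
move=> hh; have ch := holo_cdisc_circ hh; have [M M0 hM] := circ_bounded ch.
move=> e e0; exists (Num.min (1 / 2) (e / (2 * M))).
  by rewrite lt_min !divr_gt0 // mulr_gt0.
move=> w; rewrite subr0 lt_min => /andP[w2 wM].
have w1 : normc w < 1 by lra.
rewrite (taylor2 hh w1) (_ : _ - _ - _ = w * tail h 2 w * w); last by ring.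
rewrite normcM ler_wpM2r ?normc_ge0 // normcM.
have t2 := normc_tail_le2 2 ch (ltW w2) hM.
rewrite ltr_pdivlMr ?mulr_gt0 // in wM; apply: le_trans (ltW wM).
by apply: ler_wpM2l t2; exact: normc_ge0.
Qed.

Lemma cauchy_estimate h d (M : R) : holo_cdisc h -> cderiv h 0 d ->
  (forall w, normc w = 1 -> normc (h w) <= M) -> normc d <= M.
Proof.
move=> hh hd hM; rewrite (cderiv_uniq hd (cderiv_coef1 hh)).
by apply: normc_coef_le => //; exact: holo_cdisc_circ.
Qed.

Lemma taylor2_estimate h d z (M : R) : holo_cdisc h -> cderiv h 0 d ->
  (forall w, normc w = 1 -> normc (h w) <= M) -> normc z <= 1 / 2 ->
  normc (h z - h 0 - d * z) <= 2 * M * normc z ^+ 2.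
Proof.
move=> hh hd hM z2; rewrite (cderiv_uniq hd (cderiv_coef1 hh)).
have z1 : normc z < 1 by lra.
rewrite {1}(taylor2 hh z1) (_ : _ - _ - _ = z ^+ 2 * tail h 2 z); last by ring.
rewrite normcM normcX mulrC ler_wpM2r ?exprn_ge0 ?normc_ge0 //.
by apply: normc_tail_le2 => //; exact: holo_cdisc_circ.
Qed.

Lemma cderiv_affine h a b z d : cderiv h (a + b * z) d ->
  cderiv (fun w => h (a + b * w)) z (d * b).
Proof.
move=> hd; apply: (@cderiv_comp _ h (fun w => a + b * w)) hd.
rewrite -[X in cderiv _ _ X]add0r; apply: cderivD; first exact: cderiv_cst.
by apply: cderiv_eq; [apply: cderivZ; exact: cderiv_id|rewrite mulr1].
Qed.

(** After subtraction of the quadratic Taylor polynomial the remainder is O(|w|^3). A Cauchy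
    estimate on the disc of radius |w| about [w] makes its derivative O(|w|^2), which is the
    differentiability of [dh] at 0. *)
Lemma cderiv_deriv0 h dh : holo_cdisc h ->
  (forall w, normc w < 1 -> cderiv h w (dh w)) -> cderiv dh 0 (2 * coef h 2).
Proof.
move=> hh hd; have ch := holo_cdisc_circ hh; have [M M0 hM] := circ_bounded ch.
have n0 : normc (0 : R[i]) < 1 by rewrite normc0.
have d0 : dh 0 = coef h 1 := cderiv_uniq (hd _ n0) (cderiv_coef1 hh).
pose G w := h w - (h 0 + coef h 1 * w + coef h 2 * w ^+ 2).
have GE w : normc w < 1 -> G w = w ^+ 3 * tail h 3 w.
  by move=> w1; rewrite /G {1}(taylor2 hh w1) tailS //; ring.
have dG w : normc w < 1 -> cderiv G w (dh w - (coef h 1 + 2 * coef h 2 * w)).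
  move=> w1; apply: cderivB; first exact: hd.
  apply: cderiv_eq; first apply: cderivD.
  - by apply: cderivD; [exact: cderiv_cst|apply: cderivZ; exact: cderiv_id].
  - apply: cderivZ; apply: (@eq_ind _ _ (fun f => cderiv f w _)
      (cderivM (cderiv_id w) (cderiv_id w))).
    by apply: funext => x; rewrite expr2.
  - by rewrite /=; ring.
have GM w : normc w <= 1 / 2 -> normc (G w) <= 2 * M * normc w ^+ 3.
  move=> w2; rewrite GE; last by lra.
  have t3 := normc_tail_le2 3 ch w2 hM.
  rewrite normcM normcX [normc w ^+ 3 * _]mulrC.
  by apply: ler_wpM2r t3; rewrite exprn_ge0 ?normc_ge0.
(* On that disc the argument has modulus at most 2|w| <= 1/2, so the remainder is at most 2 M
   (2|w|)^3 = 16 M |w|^3; dividing by the radius |w| gives the bound. *)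
have key w : normc w <= 1 / 4 ->
    normc (dh w - (coef h 1 + 2 * coef h 2 * w)) <= 16 * M * normc w ^+ 2.
  move=> w4; have [->|w0] := eqVneq w 0.
    by rewrite d0 mulr0 addr0 subrr normc0 expr0n mulr0.
  have nw : 0 < normc w by rewrite normc_gt0.
  have i1 x : normc x <= 1 -> normc (w + (normc w)%:C * x) <= 2 * normc w.
    move=> x1; apply: le_trans (le_normcD _ _) _; rewrite normcM normc_real gtr0_norm //.
    by have := ler_wpM2l (ltW nw) x1; lra.
  have hk : holo_cdisc (fun x => G (w + (normc w)%:C * x)).
    move=> x /i1 x1; eexists; apply: cderiv_affine; apply: dG; lra.
  have hk0 : cderiv (fun x => G (w + (normc w)%:C * x)) 0
      ((dh w - (coef h 1 + 2 * coef h 2 * w)) * (normc w)%:C).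
    by apply: cderiv_affine; rewrite mulr0 addr0; apply: dG; lra.
  have := cauchy_estimate (M := 16 * M * normc w ^+ 3) hk hk0 _.
  rewrite normcM normc_real gtr0_norm // [normc w ^+ 3]exprSr mulrA ler_pM2r //; apply.
  move=> x x1; have i2 : normc (w + (normc w)%:C * x) <= 2 * normc w by apply: i1; rewrite x1.
  apply: le_trans (GM _ _) _; first by lra.
  rewrite -[leRHS]mulrA -exprSr.
  have := @lerXn2r _ 3 (normc (w + (normc w)%:C * x)) (2 * normc w).
  rewrite !nnegrE normc_ge0 mulr_ge0 ?normc_ge0 // => /(_ isT isT i2).
  rewrite exprMn => i3; have := ler_wpM2l (ltW M0) i3; lra.
move=> e e0; exists (Num.min (1 / 4) (e / (16 * M))).
  by rewrite lt_min !divr_gt0 // mulr_gt0.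
move=> w; rewrite subr0 lt_min => /andP[w4 wM].
rewrite d0 (_ : _ - _ - _ = dh w - (coef h 1 + 2 * coef h 2 * w)); last by ring.
apply: le_trans (key _ (ltW w4)) _.
rewrite ltr_pdivlMr ?mulr_gt0 // in wM.
rewrite expr2 mulrA ler_wpM2r ?normc_ge0 //; lra.
Qed.

(** Transported from the origin: x |-> z + r x maps the closed unit disc into the open one, and the
    affine change of variable is undone afterwards. *)
Lemma deriv_holo h dh z : (forall w, normc w < 1 -> cderiv h w (dh w)) ->
  normc z < 1 -> exists e, cderiv dh z e.
Proof.
move=> hd z1; pose r := (1 - normc z) / 2.
have r0 : 0 < r by rewrite /r; lra.
have i1 x : normc x <= 1 -> normc (z + r%:C * x) < 1.
  move=> x1; apply: le_lt_trans (le_normcD _ _) _; rewrite normcM normc_real gtr0_norm //.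
  have := ler_wpM2l (ltW r0) x1; rewrite /r; lra.
have hk x : normc x <= 1 -> cderiv (fun x => h (z + r%:C * x)) x (dh (z + r%:C * x) * r%:C).
  by move=> /i1 x1; apply: cderiv_affine; exact: hd.
have hh : holo_cdisc (fun x => h (z + r%:C * x)) by move=> x /hk; eexists; eassumption.
have := cderiv_deriv0 hh (fun x x1 => hk x (ltW x1)).
set e := 2 * _ => he.
have rC0 : r%:C != 0 by rewrite -normc_gt0 normc_real gtr0_norm.
have he2 : cderiv (fun x => dh (z + r%:C * x) * r%:C) (- z / r%:C + r%:C^-1 * z) e.
  by rewrite mulNr mulrC addNr.
have := cderivZ (r%:C^-1) (@cderiv_affine _ (- z / r%:C) (r%:C^-1) z e he2).
set k := (fun w => _) => hk2; eexists.
rewrite (_ : dh = k); first exact: hk2.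
apply: funext => w; rewrite /k.
rewrite (_ : z + r%:C * _ = w); last by field.
by field.
Qed.

Lemma cderiv_scale h dh (r : R) : 0 < r <= 1 ->
  (forall w, normc w < 1 -> cderiv h w (dh w)) ->
  forall w, normc w < 1 -> cderiv (fun w => h (r%:C * w)) w (dh (r%:C * w) * r%:C).
Proof.
move=> /andP[r0 r1] hd w w1.
have := @cderiv_affine h 0 r%:C w (dh (r%:C * w)).
rewrite add0r => H; rewrite (_ : (fun w => _) = (fun w => h (0 + r%:C * w))).
  apply: H; apply: hd; rewrite normcM normc_real gtr0_norm //.
  by apply: le_lt_trans w1; rewrite ler_piMl ?normc_ge0.
by apply: funext => x; rewrite add0r.
Qed.

Lemma holo_cdisc_scale h dh (r : R) : 0 < r < 1 ->
  (forall w, normc w < 1 -> cderiv h w (dh w)) -> holo_cdisc (fun w => h (r%:C * w)).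
Proof.
move=> /andP[r0 r1] hd w w1; have := @cderiv_affine h 0 r%:C w (dh (r%:C * w)).
rewrite add0r => H; exists (dh (r%:C * w) * r%:C).
rewrite (_ : (fun w => _) = (fun w => h (0 + r%:C * w))).
  apply: H; apply: hd; rewrite normcM normc_real gtr0_norm //.
  by apply: le_lt_trans r1; rewrite ler_piMr // ltW.
by apply: funext => x; rewrite add0r.
Qed.

(* Integrate h(w)/w against the Fejer-type kernel 2 + u/w + conj(u) w, which is
   nonnegative on the unit circle. *)
Lemma normc_coef_fejer h (u : R[i]) : holo_cdisc h -> h 0 = 0 -> normc u = 1 ->
  (forall w, normc w = 1 -> normc (h w) <= 1) ->
  normc (2 * coef h 1 + u * coef h 2) <= 2.
Proof.
move=> hh h0 u1 h1; have ch := holo_cdisc_circ hh.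
have cV : circ_cont (fun w => w^-1).
  by move=> w w1; apply: ccontV; [exact: ccont_id|rewrite -normc_gt0 w1].
pose K w := 2 + u * w^-1 + u^* * w.
have cK : circ_cont K.
  move=> w w1; apply: ccontD; last by apply: ccontM; [exact: ccont_cst|exact: ccont_id].
  by apply: ccontD; [exact: ccont_cst|apply: ccontM; [exact: ccont_cst|exact: cV]].
have cid : circ_cont (fun w => w) by move=> w _; exact: ccont_id.
have aid : cavg (fun w => w) = 0 :> R[i].
  by apply: mean_value => w _; exists 1; exact: cderiv_id.
have wV w : normc w = 1 -> w^-1 = w^*.
  move=> w1; have w0 : w != 0 by rewrite -normc_gt0 w1.
  by apply: (mulfI w0); rewrite divff // mul_conjc w1 expr1n.
have aK : cavg K = 2.
  have k1 : circ_cont (fun=> 2 : R[i]) by move=> w _; exact: ccont_cst.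
  have k2 : circ_cont (fun w => u * w^-1).
    by move=> w w1; apply: ccontM; [exact: ccont_cst|exact: cV].
  have k3 : circ_cont (fun w => u^* * w).
    by move=> w w1; apply: ccontM; [exact: ccont_cst|exact: cid].
  have k4 : circ_cont (fun w => 2 + u * w^-1).
    by move=> w w1; apply: ccontD; [exact: k1|exact: k2].
  rewrite (cavgD k4 k3) (cavgD k1 k2) (cavgZ _ cV) (cavgZ _ cid) cavg_cst.
  by rewrite (eq_cavg wV) cavg_conj // aid conjc0 !mulr0 !addr0.
have -> : 2 * coef h 1 + u * coef h 2 = cavg (fun w => h w * w^-1 * K w).
  (* The third kernel term, conj(u) w, is paired with [coef h 0], which vanishes because h 0 = 0. *)
  have -> : 2 * coef h 1 + u * coef h 2 = 2 * coef h 1 + u * coef h 2 + u^* * coef h 0.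
    by rewrite coef0E // h0 mulr0 addr0.
  rewrite /coef -!cavgZ; try exact: circ_contX.
  have cM c n : circ_cont (fun w => c * (h w * w^-1 ^+ n)).
    by move=> w w1; apply: ccontM; [exact: ccont_cst|exact: circ_contX].
  rewrite -cavgD // -cavgD //; last first.
    by move=> w w1; apply: ccontD; exact: cM.
  apply: eq_cavg => w w1; have w0 : w != 0 by rewrite -normc_gt0 w1.
  by rewrite /K; field.
rewrite -[leRHS]/(Re (2 : R[i])).
have -> : (2 : R[i]) = cavg K by [].
apply: normc_cavg_le => //.
  by move=> w w1; apply: ccontM; [apply: ccontM; [exact: ch|exact: cV]|exact: cK].
move=> w w1.
have KE : K w = (2 + 2 * Re (u * w^-1))%:C.
  rewrite /K (_ : u^* * w = (u * w^-1)^*); last first.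
    by rewrite rmorphM; congr (_ * _); rewrite (wV _ w1); symmetry; exact: conjcK.
  rewrite -addrA addcJ rmorphD rmorphM; congr (_ + _ * _);
    by apply/eqP; rewrite eq_complex /= addr0 !eqxx.
have K0 : 0 <= 2 + 2 * Re (u * w^-1).
  have := Re_le_normc (- (u * w^-1)); rewrite normcN normcM normcV w1 u1 invr1 mulr1 Re_opp.
  lra.
rewrite KE !normcM normcV w1 invr1 mulr1 normc_real ger0_norm //.
by rewrite ler_piMl // h1.
Qed.

(** The coefficient formulas need the closed disc, but self-maps are given on the open one. They are
    therefore applied to h(r w), and [r] is taken close to 1 afterwards. *)
Lemma coef_disc_scale h dh e (r : R) : 0 < r < 1 ->
  (forall w, normc w < 1 -> cderiv h w (dh w)) -> cderiv dh 0 e ->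
  coef (fun w => h (r%:C * w)) 1 = r%:C * dh 0 /\
  2 * coef (fun w => h (r%:C * w)) 2 = r%:C ^+ 2 * e.
Proof.
move=> /[dup] r01 /andP[r0 r1] hd he.
have hh := holo_cdisc_scale r01 hd.
have hs : forall w, normc w < 1 -> cderiv (fun w => h (r%:C * w)) w (dh (r%:C * w) * r%:C).
  by apply: cderiv_scale; rewrite // r0 ltW.
have n0 : normc (0 : R[i]) < 1 by rewrite normc0.
split; first by have := cderiv_uniq (cderiv_coef1 hh) (hs 0 n0); rewrite mulr0 mulrC.
apply: cderiv_uniq (cderiv_deriv0 hh hs) _.
have := @cderiv_affine dh 0 r%:C 0 e; rewrite mulr0 addr0 => /(_ he)/(cderivZ r%:C).
rewrite (_ : r%:C * _ = r%:C ^+ 2 * e); last by ring.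
by congr (cderiv _ _ _); apply: funext => w; rewrite add0r mulrC.
Qed.

Lemma second_deriv_bound h dh e : (forall w, normc w < 1 -> cderiv h w (dh w)) ->
  (forall w, normc w < 1 -> normc (h w) <= 1) -> cderiv dh 0 e -> normc e <= 2.
Proof.
move=> hd h1 he; rewrite leNgt; apply/negP => e2.
have scal r : 0 < r < 1 -> r ^+ 2 * normc e <= 2.
  move=> r01; have /andP[r0 r1] := r01.
  have [_ c2] := coef_disc_scale r01 hd he.
  have := congr1 (@normc R) c2; rewrite (normcM 2) (normcM (_ ^+ 2)) normcX normc_real gtr0_norm // normc_2 => <-.
  rewrite ler_piMr //; apply: normc_coef_le.
    exact: holo_cdisc_circ (holo_cdisc_scale r01 hd).
  by move=> w w1; apply: h1; rewrite normcM normc_real gtr0_norm // w1 mulr1.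
(* With q = 2 / |e| < 1 the value r = (1 + q) / 2 satisfies r^2 > q, because r^2 - q = (1 - q)^2 /
   4. *)
pose r := (2 / normc e + 1) / 2.
have q : 2 / normc e < 1 by rewrite ltr_pdivrMr; lra.
have q0 : 0 < 2 / normc e by rewrite divr_gt0; lra.
have r01 : 0 < r < 1 by rewrite /r; apply/andP; split; lra.
have := scal _ r01; apply/negP; rewrite -ltNge -ltr_pdivrMr; last by lra.
rewrite /r; nra.
Qed.

(** Rotating by the [u] with u e = |e| turns the kernel bound for h(r w) into 2 r a + r^2 |e| / 2 <=
    2, and r tends to 1. What matters later is that the bound vanishes linearly at a = 1. *)
Lemma second_deriv_schwarz h dh e (a : R) :
  (forall w, normc w < 1 -> cderiv h w (dh w)) ->
  (forall w, normc w < 1 -> normc (h w) <= 1) -> h 0 = 0 ->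
  dh 0 = a%:C -> 0 <= a -> cderiv dh 0 e -> normc e <= 4 * (1 - a).
Proof.
move=> hd h1 h0 ha a0 he; rewrite leNgt; apply/negP => e4.
have scal r : 0 < r < 1 -> r ^+ 2 * normc e <= 4 * (1 - r * a).
  move=> r01; have /andP[r0 r1] := r01; have hh := holo_cdisc_scale r01 hd.
  have [c1 c2] := coef_disc_scale r01 hd he.
  have [u u1 ue] := unit_rotation e.
  have := @normc_coef_fejer _ u hh _ u1 _.
  rewrite mulr0 => /(_ h0) H.
  have {}H : normc (2 * coef (fun w => h (r%:C * w)) 1 + u * coef (fun w => h (r%:C * w)) 2) <= 2.
    apply: H => w w1; apply: h1; by rewrite normcM normc_real gtr0_norm // w1 mulr1.
  rewrite c1 ha in H.
  have c2' : coef (fun w => h (r%:C * w)) 2 = r%:C ^+ 2 * e / 2.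
    by rewrite -c2; field.
  rewrite c2' in H.
  have E : 2 * (r%:C * a%:C) + u * (r%:C ^+ 2 * e / 2) = (2 * (r * a) + r ^+ 2 * normc e / 2)%:C.
    transitivity (2 * (r%:C * a%:C) + r%:C ^+ 2 * (u * e) / 2); first by ring.
    rewrite ue; apply/eqP; rewrite eq_complex /= !expr2 /=.
    by apply/andP; split; apply/eqP; field; repeat split; nra.
  have ne := normc_ge0 e; have r2 := sqr_ge0 r.
  have ra : 0 <= r * a by rewrite mulr_ge0 // ltW.
  have rn : 0 <= r ^+ 2 * normc e by rewrite mulr_ge0.
  rewrite E normc_real ger0_norm in H; lra.
have ne := normc_ge0 e.
(* Replacing r = 1 by 1 - d lowers the excess |e| - 4 (1 - a) by at most d (2|e| + 4a); this [d]
   makes the loss at most half the excess. *)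
pose d := (normc e - 4 * (1 - a)) / (4 * (normc e + 4 * a)).
have D0 : 0 < 4 * (normc e + 4 * a).
  by rewrite mulr_gt0 //; lra.
have d0 : 0 < d by rewrite divr_gt0 //; lra.
have dE : d * (4 * (normc e + 4 * a)) = normc e - 4 * (1 - a) by rewrite /d divfK // gt_eqF.
have d1 : d < 1 by rewrite ltr_pdivrMr //; lra.
have r01 : 0 < 1 - d < 1 by apply/andP; split; lra.
have := scal _ r01; apply/negP; rewrite -ltNge.
have : 0 <= d ^+ 2 * normc e by rewrite mulr_ge0 // sqr_ge0.
nra.
Qed.

(** If the first n coefficients vanish, a zero at t e gives [coef k n] = - t e [tail], which is
    O(t), so the next coefficient vanishes too. Then k(w) = w^n [tail k n w] for all n, with tails
    bounded independently of n. *)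
Lemma identity_theorem h dh (e : R[i]) (rho : R) :
  (forall w, normc w < 1 -> cderiv h w (dh w)) -> normc e = 1 -> 0 < rho ->
  (forall t : R, 0 < t <= rho -> h (t%:C * e) = 0) ->
  forall z, normc z < 1 -> h z = 0.
Proof.
move=> hd e1 rho0 hz z z1.
pose r := (1 + normc z) / 2.
have nz := normc_ge0 z.
have r0 : 0 < r by rewrite /r; lra.
have r1 : r < 1 by rewrite /r; lra.
have rz : normc z < r by rewrite /r; lra.
have r01 : 0 < r < 1 by rewrite r0.
pose k w := h (r%:C * w).
have hk : holo_cdisc k := holo_cdisc_scale r01 hd.
have ck := holo_cdisc_circ hk; have [M M0 hM] := circ_bounded ck.
have kz t : 0 < t <= rho -> k (t%:C * e) = 0.
  move=> /andP[t0 tr]; rewrite /k mulrA -rmorphM; apply: hz.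
  rewrite mulr_gt0 //=; apply: le_trans tr; rewrite ler_piMl // ltW //.
have coef_n0 n : (forall w, normc w < 1 -> k w = w ^+ n * tail k n w) -> coef k n = 0.
  move=> A; apply/eqP; rewrite -normc_eq0 eq_le normc_ge0 andbT leNgt; apply/negP => c0.
  (* The third bound makes the tail term at most 2 M t <= |[coef k n]| / 2. *)
  pose t := Num.min (Num.min rho (1 / 2)) (normc (coef k n) / (4 * M)).
  have t0 : 0 < t by rewrite !lt_min rho0 !divr_gt0 // mulr_gt0.
  have tr : t <= rho by rewrite !ge_min lexx.
  have t2 : t <= 1 / 2 by rewrite !ge_min lexx orbT.
  have tM : t <= normc (coef k n) / (4 * M) by rewrite !ge_min lexx !orbT.
  have te : normc (t%:C * e) = t by rewrite normcM normc_real gtr0_norm // e1 mulr1.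
  have te1 : normc (t%:C * e) < 1 by rewrite te; lra.
  have te0 : t%:C * e != 0 by rewrite -normc_gt0 te.
  have /esym/eqP := A _ te1; rewrite kz ?t0 // mulf_eq0 expf_eq0 (negPf te0) andbF /=.
  rewrite tailS // addr_eq0 => /eqP /(congr1 (@normc R)).
  rewrite normcN (normcM (t%:C * e)) te => cE.
  have := normc_tail_le2 n.+1 ck (_ : normc (t%:C * e) <= 1 / 2) hM.
  rewrite te => /(_ t2) tl; rewrite ler_pdivlMr ?mulr_gt0 // in tM.
  have := ler_wpM2l (ltW t0) tl; lra.
have kE n w : normc w < 1 -> k w = w ^+ n * tail k n w.
  elim: n w => [|n IH] w w1; first by rewrite expr0 mul1r; exact: tail0E.
  by rewrite IH // tailS // (coef_n0 n IH) add0r exprSr mulrA.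
pose z' := (r^-1)%:C * z.
have z'E : h z = k z'.
  by rewrite /k /z' mulrA -rmorphM divff ?rmorph1 ?mul1r // gt_eqF.
have z'1 : normc z' < 1.
  by rewrite normcM normc_real gtr0_norm ?invr_gt0 // mulrC ltr_pdivrMr // mul1r.
apply/eqP; rewrite z'E -normc_eq0 eq_le normc_ge0 andbT leNgt; apply/negP => c0.
have nz' := normc_ge0 z'.
pose B := M / (1 - normc z').
have B0 : 0 < B by rewrite divr_gt0 // subr_gt0.
have : (GRing.exp (normc z')) @ \oo --> (0 : R) by apply: cvg_expr; rewrite ger0_norm.
move=> /cvgrPdist_lt /(_ (normc (k z') / B)) H.
have [|N _ HN] := H; first by rewrite divr_gt0.
have := HN N (leqnn N); rewrite /= sub0r normrN ger0_norm ?exprn_ge0 //.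
rewrite ltr_pdivlMr // ltNge => /negP; apply.
rewrite (kE N) // normcM normcX ler_wpM2l ?exprn_ge0 //.
exact: normc_tail_le.
Qed.

End TaylorCoefficients.
(** * Several variables *)

Section Bridge.
Variables (R : realType) (m : nat).
Implicit Types (z v w : 'rV[R[i]]_m).

Lemma normc_le_gauge v l : normc (v 0 l) <= gauge_polydisc v.
Proof. by rewrite /gauge_polydisc; apply: (le_bigmax _ (fun l => normc (v 0 l))). Qed.

Lemma gauge_ge0 v : 0 <= gauge_polydisc v.
Proof. exact: bigmax_ge_id. Qed.

Lemma gauge_le v (c : R) : 0 <= c -> (forall l, normc (v 0 l) <= c) -> gauge_polydisc v <= c.
Proof. by move=> c0 H; apply/bigmax_leP; split. Qed.

Lemma gauge_lt v (c : R) : 0 < c -> (forall l, normc (v 0 l) < c) -> gauge_polydisc v < c.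
Proof. by move=> c0 H; apply/bigmax_ltP; split. Qed.

Lemma polydisc_gauge z : polydisc z <-> gauge_polydisc z < 1.
Proof.
split=> [H|H l]; first exact: gauge_lt.
exact: le_lt_trans (normc_le_gauge z l) H.
Qed.

Lemma normrc_normc (c : R[i]) : `|c| = (normc c)%:C.
Proof. by rewrite normc_def; case: c. Qed.

(** The norm of a complex matrix takes values in R[i], so balls have complex radii; this identity
    brings them back to real radii. *)
Lemma mx_norm_gauge v : mx_norm v = (gauge_polydisc v)%:C.
Proof.
have h0 : 0 <= mx_norm v by rewrite mx_normE.
apply/eqP; rewrite eq_le; apply/andP; split.
  have [->|/mx_norm_neq0 [[i l] ->]] := eqVneq (mx_norm v) 0.
    by rewrite lecR gauge_ge0.
  by rewrite normrc_normc lecR /= ord1 normc_le_gauge.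
have : mx_norm v = (Re (mx_norm v))%:C by rewrite RRe_real // ger0_real.
move=> e; rewrite e lecR; apply: gauge_le; first by move: h0; rewrite e lecR.
move=> l; rewrite -lecR -e -normrc_normc mx_normE.
rewrite -[leLHS]nngE num_le.
exact: (le_bigmax _ (fun i : 'I_1 * 'I_m => `|v i.1 i.2|%:nng) (0, l)).
Qed.

(** Complex differentiability of a scalar function with gradient [a], in the sup norm and with real
    epsilons; [differentiable_mdiff] extracts it from [differentiable]. *)
Definition mdiff (phi : 'rV[R[i]]_m -> R[i]) z (a : 'I_m -> R[i]) :=
  forall eps : R, 0 < eps -> exists2 del : R, 0 < del &
  forall w, gauge_polydisc (w - z) < del ->
    normc (phi w - phi z - \sum_l (w - z) 0 l * a l) <= eps * gauge_polydisc (w - z).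

Lemma differentiable_mdiff (f : 'rV[R[i]]_m -> 'rV[R[i]]_m) z j : differentiable f z ->
  mdiff (fun w => f w 0 j) z (fun l => 'J f z l j).
Proof.
move=> /diff_locallyP[_ H] eps e0.
have /eqaddoP := H.
move=> /(_ eps%:C); rewrite ltcR => /(_ e0).
move=> /nbhs_ballP[d /= d0 Hd].
have dr : d = (Re d)%:C by rewrite RRe_real // gtr0_real.
exists (Re d); first by move: d0; rewrite dr ltcR.
move=> w wz.
have := Hd (w - z).
rewrite mx_norm_ball /= /ball_ /= sub0r normrN -/(mx_norm _) mx_norm_gauge dr ltcR => /(_ wz).
rewrite -/(mx_norm _) mx_norm_gauge -rmorphM lecR; apply: le_trans.
apply: le_trans (normc_le_gauge _ j).
rewrite !mxE /= subrK opprD addrA;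
suff -> : \sum_l (w - z) 0 l * ('J f z) l j = 'd f z (w - z) 0 j by [].
by rewrite /jacobian -(mul_rV_lin1 ('d f z)) [RHS]mxE.
Qed.

End Bridge.

(** * Chain rule along holomorphic curves *)

Section MultivariateDerivative.
Variables (R : realType) (m : nat).
Implicit Types (z v w : 'rV[R[i]]_m) (phi : 'rV[R[i]]_m -> R[i]) (a : 'I_m -> R[i]).

Lemma gaugeD v w : gauge_polydisc (v + w) <= gauge_polydisc v + gauge_polydisc w.
Proof.
apply: gauge_le => [|l]; first by rewrite addr_ge0 ?gauge_ge0.
by rewrite mxE; apply: le_trans (le_normcD _ _) _; apply: lerD; exact: normc_le_gauge.
Qed.

Lemma gaugeZ c v : gauge_polydisc (c *: v) <= normc c * gauge_polydisc v.
Proof.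
apply: gauge_le => [|l]; first by rewrite mulr_ge0 ?gauge_ge0 ?normc_ge0.
by rewrite mxE normcM ler_wpM2l ?normc_ge0 ?normc_le_gauge.
Qed.

Lemma gauge_delta l : gauge_polydisc (delta_mx 0 l : 'rV[R[i]]_m) <= 1.
Proof.
apply: gauge_le => [|k] //; rewrite mxE eqxx /=.
by case: (k == l); rewrite ?normc1 ?normc0.
Qed.

Lemma gauge_eq0 v : gauge_polydisc v = 0 -> v = 0.
Proof.
move=> v0; apply/rowP => l; rewrite mxE; apply: eq0_normc.
by apply/eqP; rewrite eq_le normc_ge0 -v0 normc_le_gauge.
Qed.

Lemma normc_sum_le (I : finType) (F : I -> R[i]) :
  normc (\sum_i F i) <= \sum_i normc (F i).
Proof.
elim/big_ind2 : _ => [|x a y b h1 h2|//]; first by rewrite normc0.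
by apply: le_trans (le_normcD _ _) _; exact: lerD.
Qed.

Lemma finite_radius (P : 'I_m -> R -> Prop) :
  (forall l, exists2 d : R, 0 < d & P l d) ->
  (forall l d d', d' <= d -> P l d -> P l d') ->
  exists2 d : R, 0 < d & forall l, P l d.
Proof.
move=> H mono.
have {H} [d Hd] : {d : 'I_m -> R & forall l, 0 < d l /\ P l (d l)}.
  by apply: (@choice _ _ (fun l d => 0 < d /\ P l d)) => l; have [d ? ?] := H l; exists d.
exists (\big[Num.min/1]_l d l).
  by apply/bigmin_gtP; split=> // l _; have [] := Hd l.
move=> l; have [_] := Hd l; apply: mono; exact: bigmin_le_cond.
Qed.

Lemma mdiff_bounded_increment phi z a : mdiff phi z a ->
  exists2 del : R, 0 < del & forall w, gauge_polydisc (w - z) < del ->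
    normc (phi w - phi z) <= (1 + \sum_l normc (a l)) * gauge_polydisc (w - z).
Proof.
move=> /(_ 1 ltr01)[del d0 hd]; exists del => // w /hd h1.
have h2 : normc (\sum_l (w - z) 0 l * a l) <= (\sum_l normc (a l)) * gauge_polydisc (w - z).
  apply: le_trans (normc_sum_le _) _; rewrite mulr_suml; apply: ler_sum => l _.
  by rewrite normcM mulrC ler_wpM2l ?normc_ge0 ?normc_le_gauge.
have := le_normcD (phi w - phi z - \sum_l (w - z) 0 l * a l) (\sum_l (w - z) 0 l * a l).
by rewrite subrK mulrDl; lra.
Qed.

Definition mcont phi z := forall eps : R, 0 < eps -> exists2 del : R, 0 < del &
  forall w, gauge_polydisc (w - z) < del -> normc (phi w - phi z) <= eps.

Lemma mdiff_mcont phi z a : mdiff phi z a -> mcont phi z.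
Proof.
move=> /mdiff_bounded_increment[d d0 hd] e e0.
pose K := 1 + \sum_l normc (a l).
have K0 : 0 < K by rewrite ltr_pwDl // sumr_ge0 // => l _; exact: normc_ge0.
exists (Num.min d (e / K)); first by rewrite lt_min d0 divr_gt0.
move=> w; rewrite lt_min ltr_pdivlMr // mulrC => /andP[/hd h1 h2].
exact: le_trans h1 (ltW h2).
Qed.

Lemma curve_increment (X : R[i] -> 'rV[R[i]]_m) (t : R[i]) (X' : 'I_m -> R[i]) (eps : R) :
  0 < eps -> (forall l, cderiv (fun s => X s 0 l) t (X' l)) ->
  exists2 del : R, 0 < del & forall s, normc (s - t) < del ->
    (forall l, normc (X s 0 l - X t 0 l - X' l * (s - t)) <= eps * normc (s - t)) /\
    gauge_polydisc (X s - X t) <= (eps + \sum_l normc (X' l)) * normc (s - t).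
Proof.
move=> e0 dX.
have [||d d0 hd] := @finite_radius (fun l d => forall s, normc (s - t) < d ->
    normc (X s 0 l - X t 0 l - X' l * (s - t)) <= eps * normc (s - t)).
- by move=> l; exact: dX.
- by move=> l d d' dd' H s sd; apply: H; exact: lt_le_trans dd'.
exists d => // s sd; split=> [l|]; first exact: hd.
apply: gauge_le => [|l].
  rewrite mulr_ge0 ?normc_ge0 // addr_ge0 ?(ltW e0) // sumr_ge0 // => l _.
  exact: normc_ge0.
rewrite !mxE mulrDl.
have := le_normcD (X s 0 l - X t 0 l - X' l * (s - t)) (X' l * (s - t)).
rewrite subrK => h; apply: le_trans h _; apply: lerD; first exact: hd.
rewrite normcM ler_wpM2r ?normc_ge0 // (bigD1 l) //= lerDl sumr_ge0 // => k _.
exact: normc_ge0.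
Qed.

Lemma chain_rule phi (X : R[i] -> 'rV[R[i]]_m) (t : R[i]) a (X' : 'I_m -> R[i]) :
  (forall l, cderiv (fun s => X s 0 l) t (X' l)) -> mdiff phi (X t) a ->
  cderiv (fun s => phi (X s)) t (\sum_l X' l * a l).
Proof.
move=> dX dphi e e0.
pose A := \sum_l normc (a l); pose B := \sum_l normc (X' l).
have A0 : 0 <= A by rewrite sumr_ge0 // => l _; exact: normc_ge0.
have B0 : 0 <= B by rewrite sumr_ge0 // => l _; exact: normc_ge0.
(* Two errors of e / 2 each: [e1 * A] from the remainder of the curve, [e2 * (e1 + B)] from the
   remainder of [phi] along it. *)
pose e1 := e / (2 * (1 + A)); pose e2 := e / (2 * (e1 + B)).
have e10 : 0 < e1 by rewrite divr_gt0 // mulr_gt0 //; lra.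
have e20 : 0 < e2 by rewrite divr_gt0 // mulr_gt0 //; lra.
have [d1 d10 h1] := curve_increment e10 dX.
have [d2 d20 h2] := dphi _ e20.
exists (Num.min d1 (d2 / (e1 + B))); first by rewrite lt_min d10 divr_gt0 //; lra.
move=> s; rewrite lt_min ltr_pdivlMr; last by lra.
move=> /andP[/h1[h3 h4] h5].
have h6 : gauge_polydisc (X s - X t) < d2 by apply: le_lt_trans h4 _; rewrite mulrC.
have := h2 _ h6; set N := gauge_polydisc _ in h4 *; set q := normc (s - t) in h3 h4 *.
move=> h7.
have ES : \sum_l (X s - X t) 0 l * a l = (\sum_l X' l * a l) * (s - t) +
   \sum_l (X s 0 l - X t 0 l - X' l * (s - t)) * a l.
  by rewrite mulr_suml -big_split; apply: eq_bigr => l _; rewrite !mxE /=; ring.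
rewrite (_ : _ - _ - _ = (phi (X s) - phi (X t) - \sum_l (X s - X t) 0 l * a l) +
   \sum_l (X s 0 l - X t 0 l - X' l * (s - t)) * a l); last by rewrite ES; ring.
apply: le_trans (le_normcD _ _) _.
have q0 : 0 <= q by exact: normc_ge0.
have h8 : normc (\sum_l (X s 0 l - X t 0 l - X' l * (s - t)) * a l) <= e1 * q * A.
  apply: le_trans (normc_sum_le _) _; rewrite mulr_sumr; apply: ler_sum => l _.
  by rewrite normcM ler_wpM2r ?normc_ge0.
have h9 : e2 * N <= e / 2 * q.
  apply: (@le_trans _ _ (e2 * ((e1 + B) * q))); first by rewrite ler_wpM2l // ltW.
  rewrite mulrA ler_wpM2r // /e2 (_ : _ * _ = e / 2) //.
  by field; rewrite gt_eqF //; lra.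
have h10 : e1 * q * A <= e / 2 * q.
  rewrite mulrAC ler_wpM2r // /e1.
  rewrite (_ : _ * A = e / 2 * (A / (1 + A))); last by field; rewrite gt_eqF //; lra.
  by rewrite ler_piMr ?ler_pdivrMr; lra.
lra.
Qed.

Lemma cderiv_line phi z v t a : mdiff phi (z + t *: v) a ->
  cderiv (fun s => phi (z + s *: v)) t (\sum_l v 0 l * a l).
Proof.
move=> dphi; apply: (@chain_rule phi (fun s => z + s *: v)) => // l.
suff: cderiv (fun s => z 0 l + s * v 0 l) t (v 0 l).
  by congr (cderiv _ _ _); apply: funext => s; rewrite !mxE.
apply: cderiv_eq; first apply: cderivD; first exact: cderiv_cst.
  by apply: cderivM; [exact: cderiv_id|exact: cderiv_cst].
by rewrite /= mulr0 addr0 add0r mul1r.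
Qed.

End MultivariateDerivative.

(** * Cauchy estimates on a ball, and regularity of the gradient *)

Section LocalEstimates.
Variables (R : realType) (m : nat) (phi : 'rV[R[i]]_m -> R[i])
  (a : 'rV[R[i]]_m -> 'I_m -> R[i]) (z : 'rV[R[i]]_m) (rho M : R).
Implicit Types (v w h : 'rV[R[i]]_m).
Hypotheses (rho0 : 0 < rho) (M0 : 0 < M).
Hypothesis dphi : forall w, gauge_polydisc (w - z) <= rho -> mdiff phi w (a w).
Hypothesis bphi : forall w, gauge_polydisc (w - z) <= rho -> normc (phi w) <= M.

Let in_ball w h (t : R[i]) (r : R) : 0 <= r -> gauge_polydisc (w - z) <= rho / 2 ->
  gauge_polydisc h <= 1 -> normc t <= 1 -> r <= rho / 2 ->
  gauge_polydisc (w + (r%:C * t) *: h - z) <= rho.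
Proof.
move=> r0 wz h1 t1 rr; rewrite addrAC.
apply: le_trans (gaugeD _ _) _.
have := gaugeZ (r%:C * t) h; rewrite normcM normc_real ger0_norm // => i1.
have nt := normc_ge0 t; have i2 : r * normc t <= r by rewrite ler_piMr.
have i3 : r * normc t * gauge_polydisc h <= r * normc t.
  by rewrite ler_piMr // mulr_ge0.
lra.
Qed.

Let line_cderiv w h (r : R) (t : R[i]) : 0 <= r -> gauge_polydisc (w - z) <= rho / 2 ->
  gauge_polydisc h <= 1 -> normc t <= 1 -> r <= rho / 2 ->
  cderiv (fun t => phi (w + (r%:C * t) *: h)) t
    ((\sum_l h 0 l * a (w + (r%:C * t) *: h) l) * r%:C).
Proof.
move=> r0 wz h1 t1 rr.
have H : cderiv (fun t => phi (w + t *: h)) (0 + r%:C * t)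
    (\sum_l h 0 l * a (w + (r%:C * t) *: h) l).
  by rewrite (add0r (r%:C * t)); apply: cderiv_line; apply: dphi; exact: in_ball.
have := @cderiv_affine _ (fun t => phi (w + t *: h)) 0 r%:C t _ H.
rewrite (_ : (fun s => phi (w + (0 + r%:C * s) *: h)) = (fun s => phi (w + (r%:C * s) *: h))) //.
by apply: funext => s; rewrite (add0r (r%:C * s)).
Qed.

Let line_holo w h (r : R) : 0 <= r -> gauge_polydisc (w - z) <= rho / 2 ->
  gauge_polydisc h <= 1 -> r <= rho / 2 ->
  holo_cdisc (fun t => phi (w + (r%:C * t) *: h)).
Proof. by move=> r0 wz h1 rr t t1; eexists; exact: line_cderiv. Qed.

Let line_cderiv0 w h (r : R) : 0 <= r -> gauge_polydisc (w - z) <= rho / 2 ->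
  gauge_polydisc h <= 1 -> r <= rho / 2 ->
  cderiv (fun t => phi (w + (r%:C * t) *: h)) 0 ((\sum_l h 0 l * a w l) * r%:C).
Proof.
move=> r0 wz h1 rr; have := @line_cderiv w h r 0 r0 wz h1; rewrite normc0 mulr0 scale0r addr0.
by apply.
Qed.

Let line_bound w h (r : R) (t : R[i]) : 0 <= r -> gauge_polydisc (w - z) <= rho / 2 ->
  gauge_polydisc h <= 1 -> r <= rho / 2 -> normc t = 1 ->
  normc (phi (w + (r%:C * t) *: h)) <= M.
Proof. by move=> r0 wz h1 rr t1; apply: bphi; apply: in_ball => //; rewrite t1. Qed.

Let rho2 : 0 <= rho / 2.
Proof. by rewrite divr_ge0 // ltW. Qed.

Lemma local_gradient_bound w h : gauge_polydisc (w - z) <= rho / 2 ->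
  normc (\sum_l h 0 l * a w l) <= 2 * M / rho * gauge_polydisc h.
Proof.
move=> wz; have [h0|h0] := eqVneq (gauge_polydisc h) 0.
  rewrite (gauge_eq0 h0) big1 ?normc0; last by move=> l _; rewrite mxE mul0r.
  by rewrite mulr_ge0 ?gauge_ge0 // divr_ge0 ?mulr_ge0 // ltW.
have hp : 0 < gauge_polydisc h by rewrite lt_def h0 gauge_ge0.
pose h' := (gauge_polydisc h)^-1%:C *: h.
have h'1 : gauge_polydisc h' <= 1.
  apply: le_trans (gaugeZ _ _) _.
  by rewrite normc_real gtr0_norm ?invr_gt0 // mulVf.
have := cauchy_estimate (line_holo rho2 wz h'1 (lexx _)) (line_cderiv0 rho2 wz h'1 (lexx _))
  (fun t => line_bound rho2 wz h'1 (lexx _)).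
have -> : \sum_l h' 0 l * a w l = (gauge_polydisc h)^-1%:C * \sum_l h 0 l * a w l.
  by rewrite mulr_sumr; apply: eq_bigr => l _; rewrite mxE mulrA.
rewrite !normcM !normc_real !gtr0_norm ?invr_gt0 ?divr_gt0 //.
set x := normc _ => H.
have e : x = (gauge_polydisc h)^-1 * x * (rho / 2) * (2 / rho * gauge_polydisc h).
  by field; rewrite h0 gt_eqF.
rewrite e (_ : 2 * M / rho * _ = M * (2 / rho * gauge_polydisc h)); last by ring.
by apply: ler_wpM2r H; rewrite mulr_ge0 ?gauge_ge0 // divr_ge0 // ltW.
Qed.

(** This is 2 M (2 / rho)^2, from [taylor2_estimate] on a complex line parametrised with radius rho
    / 2. *)
Let K := 8 * M / rho ^+ 2.

Lemma local_taylor2 w h : gauge_polydisc (w - z) <= rho / 2 -> gauge_polydisc h <= rho / 4 ->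
  normc (phi (w + h) - phi w - \sum_l h 0 l * a w l) <= K * gauge_polydisc h ^+ 2.
Proof.
move=> wz h4; have [h0|h0] := eqVneq (gauge_polydisc h) 0.
  rewrite (gauge_eq0 h0) big1; last by move=> l _; rewrite mxE mul0r.
  by rewrite addr0 !subrr normc0 mulr_ge0 ?sqr_ge0 // divr_ge0 ?sqr_ge0 // mulr_ge0 // ltW.
have hp : 0 < gauge_polydisc h by rewrite lt_def h0 gauge_ge0.
pose h' := (gauge_polydisc h)^-1%:C *: h.
have h'1 : gauge_polydisc h' <= 1.
  apply: le_trans (gaugeZ _ _) _.
  by rewrite normc_real gtr0_norm ?invr_gt0 // mulVf.
pose t := (gauge_polydisc h * (2 / rho))%:C.
have tp : 0 < gauge_polydisc h * (2 / rho) by rewrite mulr_gt0 // divr_gt0.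
have t2 : normc t <= 1 / 2.
  rewrite normc_real gtr0_norm // mulrA ler_pdivrMr //; lra.
have th : ((rho / 2)%:C * t) *: h' = h.
  rewrite /h' scalerA -!rmorphM (_ : _ * _ * _ = 1) ?rmorph1 ?scale1r //.
  by field; rewrite h0 gt_eqF.
have th2 : (\sum_l h' 0 l * a w l) * (rho / 2)%:C * t = \sum_l h 0 l * a w l.
  have thl l : (rho / 2)%:C * t * h' 0 l = h 0 l by rewrite -[in RHS]th [RHS]mxE.
  by rewrite -mulrA mulr_suml; apply: eq_bigr => l _; rewrite -thl; ring.
have := taylor2_estimate (line_holo rho2 wz h'1 (lexx _)) (line_cderiv0 rho2 wz h'1 (lexx _))
  (fun t => line_bound rho2 wz h'1 (lexx _)) t2.
rewrite mulr0 scale0r addr0 th th2 normc_real gtr0_norm // => H; apply: le_trans H _.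
rewrite le_eqVlt; apply/orP; left; apply/eqP; rewrite /K; field.
by rewrite gt_eqF.
Qed.

Let K0 : 0 < K.
Proof. by rewrite divr_gt0 ?mulr_gt0 ?exprn_gt0. Qed.

Lemma local_lipschitz w h : gauge_polydisc (w - z) <= rho / 2 -> gauge_polydisc h <= rho / 4 ->
  normc (phi (w + h) - phi w) <= (2 * M / rho + K * (rho / 4)) * gauge_polydisc h.
Proof.
move=> wz h4; have h1 := local_taylor2 wz h4; have h2 := local_gradient_bound h wz.
have := le_normcD (phi (w + h) - phi w - \sum_l h 0 l * a w l) (\sum_l h 0 l * a w l).
rewrite subrK mulrDl => h3.
have hp := gauge_ge0 h.
have : K * gauge_polydisc h ^+ 2 <= K * (rho / 4) * gauge_polydisc h.
  by rewrite expr2 mulrA ler_wpM2r // ler_wpM2l // ltW.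
lra.
Qed.

Let L := 2 * M / rho + K * (rho / 4).

Let L0 : 0 < L.
Proof.
by rewrite addr_gt0 //; [rewrite divr_gt0 ?mulr_gt0|rewrite mulr_gt0 ?K0 ?divr_gt0].
Qed.

Let r := rho / 4.
Let r0 : 0 < r.
Proof. by rewrite divr_gt0. Qed.

Let rh : r <= rho / 2.
Proof. by have := rho0; rewrite /r; lra. Qed.

(** With the partial derivative written as a circle mean of [phi] itself, estimates on [phi] that
    are uniform over the circle pass to the gradient: [local_lipschitz] gives continuity,
    [local_taylor2] differentiability. *)
Lemma gradient_cauchy w l : gauge_polydisc (w - z) <= rho / 2 ->
  r%:C * a w l = cavg (fun t => phi (w + (r%:C * t) *: delta_mx 0 l) * t^-1).
Proof.
move=> wz.
have hh := line_holo (ltW r0) wz (gauge_delta R l) rh.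
have := cderiv_uniq (line_cderiv0 (ltW r0) wz (gauge_delta R l) rh) (cderiv_coef1 hh).
rewrite (bigD1 l) //= mxE !eqxx mul1r big1 ?addr0; last first.
  by move=> k kl; rewrite mxE (negPf kl) andbF mul0r.
rewrite mulrC => ->; apply: eq_cavg => t _ //.
Qed.

Let circ_phi w l : gauge_polydisc (w - z) <= rho / 2 ->
  circ_cont (fun t => phi (w + (r%:C * t) *: delta_mx 0 l) * t^-1).
Proof.
move=> wz t t1.
have /holo_cdisc_circ ch := line_holo (ltW r0) wz (gauge_delta R l) rh.
apply: ccontM; first exact: ch.
by apply: ccontV; [exact: ccont_id|rewrite -normc_gt0 t1].
Qed.

Let shift_ball w l (t : R[i]) : gauge_polydisc (w - z) <= rho / 4 -> normc t = 1 ->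
  gauge_polydisc (w + (r%:C * t) *: delta_mx 0 l - z) <= rho / 2.
Proof.
move=> wz t1; rewrite addrAC; apply: le_trans (gaugeD _ _) _.
have := gaugeZ (r%:C * t) (delta_mx 0 l); rewrite normcM normc_real gtr0_norm // t1 mulr1.
have := ler_wpM2l (ltW r0) (@gauge_delta R m l); rewrite mulr1 /r; lra.
Qed.

Lemma gradient_mcont w l : gauge_polydisc (w - z) <= rho / 4 -> mcont (fun w => a w l) w.
Proof.
move=> wz e e0; exists (Num.min (rho / 4) (e * r / L)).
  by rewrite lt_min !divr_gt0 // mulr_gt0.
move=> w'; rewrite lt_min [X in _ && X]ltr_pdivlMr // => /andP[i1 i2].
have rp := rho0; have wz2 : gauge_polydisc (w - z) <= rho / 2 by lra.
have wz2' : gauge_polydisc (w' - z) <= rho / 2.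
  have -> : w' - z = (w' - w) + (w - z) by rewrite addrA subrK.
  by apply: le_trans (gaugeD _ _) _; lra.
rewrite -(ler_pM2l r0) -[X in X * normc _](gtr0_norm r0) -normc_real -normcM mulrBr.
rewrite !gradient_cauchy // -cavgB; try exact: circ_phi.
apply: normc_cavg_le_cst.
  by move=> t t1; apply: ccontB; exact: circ_phi.
move=> t t1; rewrite -mulrBl normcM normcV t1 invr1 mulr1.
have -> : w' + (r%:C * t) *: delta_mx 0 l = w + (r%:C * t) *: delta_mx 0 l + (w' - w).
  by rewrite [RHS]addrAC [w + _]addrC subrK.
apply: le_trans (local_lipschitz (shift_ball l wz t1) (ltW i1)) _.
rewrite -/L mulrC [r * e]mulrC; exact: ltW.
Qed.

(** The mean in [gradient_cauchy] is differentiated under the integral sign, the quadratic remainder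
    having the same constant [K] all around the circle. Continuity of the new integrand comes from
    [gradient_mcont]. *)
Lemma gradient_mdiff l : mdiff (fun w => a w l) z
  (fun j => r%:C^-1 * cavg (fun t => a (z + (r%:C * t) *: delta_mx 0 l) j * t^-1)).
Proof.
have rp := rho0.
have zz : gauge_polydisc (z - z) <= rho / 4.
  by apply: gauge_le => [|k]; rewrite ?divr_ge0 ?(ltW rho0) // subrr mxE normc0 divr_ge0 // ltW.
have zz2 : gauge_polydisc (z - z) <= rho / 2 by lra.
have rC : r%:C != 0 by rewrite -normc_gt0 normc_real gtr0_norm.
have cV : circ_cont (fun t : R[i] => t^-1).
  by move=> t t1; apply: ccontV; [exact: ccont_id|rewrite -normc_gt0 t1].
have ca j : circ_cont (fun t => a (z + (r%:C * t) *: delta_mx 0 l) j * t^-1).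
  move=> t t1; apply: ccontM; last exact: cV.
  have sb : gauge_polydisc (z + (r%:C * t) *: delta_mx 0 l - z) <= rho / 4.
    rewrite addrAC subrr add0r; apply: le_trans (gaugeZ _ _) _.
    rewrite normcM normc_real gtr0_norm // t1 mulr1.
    by have := ler_wpM2l (ltW r0) (@gauge_delta R m l); rewrite mulr1.
  move=> e e0; have [d d0 hd] := gradient_mcont j sb e0.
  exists (d / r); first by rewrite divr_gt0.
  move=> s; rewrite ltr_pdivlMr // => sd; apply: hd.
  have -> : z + (r%:C * s) *: delta_mx 0 l - (z + (r%:C * t) *: delta_mx 0 l) =
      (r%:C * (s - t)) *: delta_mx 0 l :> 'rV[R[i]]_m.
    by rewrite opprD addrACA subrr add0r -scalerBl mulrBr.
  apply: le_lt_trans (gaugeZ _ _) _; apply: le_lt_trans sd.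
  rewrite normcM normc_real gtr0_norm // [r * _]mulrC.
  by apply: ler_piMr (gauge_delta R l); rewrite mulr_ge0 ?normc_ge0 // ltW.
have cs v : circ_cont (fun t => (\sum_j v 0 j * a (z + (r%:C * t) *: delta_mx 0 l) j) * t^-1) /\
    cavg (fun t => (\sum_j v 0 j * a (z + (r%:C * t) *: delta_mx 0 l) j) * t^-1) =
    \sum_j v 0 j * cavg (fun t => a (z + (r%:C * t) *: delta_mx 0 l) j * t^-1).
  have -> : (fun t => (\sum_j v 0 j * a (z + (r%:C * t) *: delta_mx 0 l) j) * t^-1) =
     (fun t => \sum_j v 0 j * (a (z + (r%:C * t) *: delta_mx 0 l) j * t^-1)).
    by apply: funext => t; rewrite mulr_suml; apply: eq_bigr => j _; rewrite mulrA.
  elim: (index_enum 'I_m) => [|j s [IH1 IH2]].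
    rewrite big_nil; split.
      by move=> t _; under eq_fun do rewrite big_nil; exact: ccont_cst.
    by under eq_fun do rewrite big_nil; rewrite cavg_cst.
  have cj : circ_cont (fun t => v 0 j * (a (z + (r%:C * t) *: delta_mx 0 l) j * t^-1)).
    by move=> t t1; apply: ccontM; [exact: ccont_cst|exact: ca].
  under eq_fun do rewrite big_cons; rewrite big_cons; split.
    by move=> t t1; apply: ccontD; [exact: cj|exact: IH1].
  by rewrite cavgD // IH2 cavgZ.
move=> e e0; exists (Num.min (rho / 4) (e * r / K)).
  by rewrite lt_min !divr_gt0 // mulr_gt0.
move=> w; rewrite lt_min [X in _ && X]ltr_pdivlMr // => /andP[i1 i2].
have wz2 : gauge_polydisc (w - z) <= rho / 2 by lra.
rewrite -(ler_pM2l r0) -[X in X * normc _](gtr0_norm r0) -normc_real -normcM.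
have [cs1 cs2] := cs (w - z).
have -> : r%:C * (a w l - a z l - \sum_j (w - z) 0 j * (r%:C^-1 *
     cavg (fun t => a (z + (r%:C * t) *: delta_mx 0 l) j * t^-1))) =
   cavg (fun t => phi (w + (r%:C * t) *: delta_mx 0 l) * t^-1 -
     phi (z + (r%:C * t) *: delta_mx 0 l) * t^-1 -
     (\sum_j (w - z) 0 j * a (z + (r%:C * t) *: delta_mx 0 l) j) * t^-1).
  have cw := circ_phi l wz2; have cz := circ_phi l zz2.
  rewrite (@cavgB _ (fun t => phi (w + (r%:C * t) *: delta_mx 0 l) * t^-1 -
     phi (z + (r%:C * t) *: delta_mx 0 l) * t^-1) _ _ cs1); last first.
    by move=> t t1; apply: ccontB; [exact: cw|exact: cz].
  rewrite (cavgB cw cz) cs2 -!gradient_cauchy // 2!mulrBr; congr (_ - _).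
  by rewrite mulr_sumr; apply: eq_bigr => j _; field.
apply: normc_cavg_le_cst.
  move=> t t1; apply: ccontB; last exact: cs1.
  by apply: ccontB; exact: circ_phi.
move=> t t1; rewrite -!mulrBl normcM normcV t1 invr1 mulr1.
have -> : w + (r%:C * t) *: delta_mx 0 l = z + (r%:C * t) *: delta_mx 0 l + (w - z).
  by rewrite [RHS]addrAC [z + _]addrC subrK.
apply: le_trans (local_taylor2 (shift_ball l zz t1) (ltW i1)) _.
rewrite expr2 mulrA [r * _]mulrA ler_wpM2r ?gauge_ge0 //.
by rewrite mulrC [r * e]mulrC; exact: ltW.
Qed.

(** The difference of [phi] along two parallel lines at distance t is bounded by [L * t]; its
    first-order Taylor expansion at parameter t / r has an error quadratic in t / r, hence cubic in
    t altogether. *)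
Lemma local_second_difference l j (t : R) : 0 < t -> t <= rho / 8 ->
  normc (phi (z + t%:C *: delta_mx 0 l + t%:C *: delta_mx 0 j) - phi (z + t%:C *: delta_mx 0 l)
    - phi (z + t%:C *: delta_mx 0 j) + phi z
    - t%:C * (a (z + t%:C *: delta_mx 0 j) l - a z l)) <= 2 * L / r ^+ 2 * t ^+ 3.
Proof.
move=> t0 t8; have rp := rho0.
have zz2 : gauge_polydisc (z - z) <= rho / 2.
  by apply: gauge_le => [|k]; rewrite ?divr_ge0 ?(ltW rho0) // subrr mxE normc0 divr_ge0 // ltW.
have zz4 : gauge_polydisc (z - z) <= rho / 4.
  by apply: gauge_le => [|k]; rewrite ?divr_ge0 ?(ltW rho0) // subrr mxE normc0 divr_ge0 // ltW.
have gt k : gauge_polydisc (t%:C *: delta_mx 0 k : 'rV[R[i]]_m) <= t.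
  apply: le_trans (gaugeZ _ _) _; rewrite normc_real gtr0_norm //.
  by rewrite ler_piMr ?(ltW t0) // gauge_delta.
have tj4 : gauge_polydisc (t%:C *: delta_mx 0 j : 'rV[R[i]]_m) <= rho / 4.
  by apply: le_trans (gt j) _; lra.
have zj : gauge_polydisc (z + t%:C *: delta_mx 0 j - z) <= rho / 2.
  by rewrite addrAC subrr add0r; apply: le_trans tj4 _; lra.
pose k s := phi (z + t%:C *: delta_mx 0 j + (r%:C * s) *: delta_mx 0 l) -
  phi (z + (r%:C * s) *: delta_mx 0 l).
have gl := gauge_delta R l.
have hk : holo_cdisc k.
  move=> s s1; eexists; apply: cderivB.
    exact: (line_cderiv (ltW r0) zj gl s1 rh).
  exact: (line_cderiv (ltW r0) zz2 gl s1 rh).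
have hk0 := cderivB (line_cderiv0 (ltW r0) zj gl rh) (line_cderiv0 (ltW r0) zz2 gl rh).
have sum_delta (b : 'I_m -> R[i]) : \sum_k (delta_mx 0 l : 'rV[R[i]]_m) 0 k * b k = b l.
  rewrite (bigD1 l) //= mxE !eqxx mul1r big1 ?addr0 // => i il.
  by rewrite mxE (negPf il) andbF mul0r.
rewrite !sum_delta -mulrBl in hk0.
have bk s : normc s = 1 -> normc (k s) <= L * t.
  move=> s1; rewrite /k addrAC.
  apply: le_trans (local_lipschitz (shift_ball l zz4 s1) tj4) _.
  by rewrite -/L; apply: ler_wpM2l; [exact: ltW|exact: gt].
have s2 : normc (t / r)%:C <= 1 / 2.
  rewrite normc_real gtr0_norm ?divr_gt0 // ler_pdivrMr // /r; lra.
have rs : r%:C * (t / r)%:C = t%:C by rewrite -rmorphM mulrCA divff ?mulr1 // gt_eqF.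
have := taylor2_estimate hk hk0 bk s2.
rewrite /k rs mulr0 scale0r !addr0 -[_ * r%:C * _]mulrA rs normc_real gtr0_norm ?divr_gt0 //.
have -> : 2 * (L * t) * (t / r) ^+ 2 = 2 * L / r ^+ 2 * t ^+ 3 by field; rewrite gt_eqF.
move=> H; apply: le_trans H; rewrite le_eqVlt; apply/orP; left; apply/eqP; congr normc.
by rewrite [z + t%:C *: _ + t%:C *: delta_mx 0 j]addrAC; ring.
Qed.

(** The second difference of [phi] is symmetric in the two directions, and both t^2 [bl j] and t^2
    [bj l] approximate it up to (n / 4) t^2, where n = |[bl j - bj l]|. This leaves n <= n / 2. *)
Lemma local_symmetry l j (bl bj : 'I_m -> R[i]) :
  mdiff (fun w => a w l) z bl -> mdiff (fun w => a w j) z bj -> bl j = bj l.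
Proof.
move=> hl hj; apply/eqP; rewrite -subr_eq0 -normc_eq0 eq_le normc_ge0 andbT leNgt.
apply/negP => n0; set n := normc _ in n0; have rp := rho0.
pose C := 2 * L / r ^+ 2.
have C0 : 0 < C by rewrite divr_gt0 ?mulr_gt0 ?exprn_gt0.
have e0 : 0 < n / 8 by rewrite divr_gt0.
have [d1 d10 h1] := hl _ e0; have [d2 d20 h2] := hj _ e0.
pose t := Num.min (Num.min (rho / 8) (n / (8 * C))) (Num.min (d1 / 2) (d2 / 2)).
have t0 : 0 < t by rewrite !lt_min !divr_gt0 // mulr_gt0.
have t8 : t <= rho / 8 by rewrite !ge_min lexx.
have tC : t <= n / (8 * C) by rewrite !ge_min lexx !orbT.
have td1 : t < d1 by apply: (@le_lt_trans _ _ (d1 / 2)); [rewrite !ge_min lexx !orbT|lra].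
have td2 : t < d2 by apply: (@le_lt_trans _ _ (d2 / 2)); [rewrite !ge_min lexx !orbT|lra].
have gt k : gauge_polydisc (t%:C *: delta_mx 0 k : 'rV[R[i]]_m) <= t.
  apply: le_trans (gaugeZ _ _) _; rewrite normc_real gtr0_norm //.
  by rewrite ler_piMr ?(ltW t0) // gauge_delta.
have sum_delta (b : 'I_m -> R[i]) k :
    \sum_i (t%:C *: delta_mx 0 k : 'rV[R[i]]_m) 0 i * b i = t%:C * b k.
  rewrite (bigD1 k) //= !mxE !eqxx mulr1 big1 ?addr0 // => i il.
  by rewrite !mxE (negPf il) andbF mulr0 mul0r.
have A l' j' b (d : R) : (forall w, gauge_polydisc (w - z) < d ->
     normc (a w l' - a z l' - \sum_i (w - z) 0 i * b i) <= n / 8 * gauge_polydisc (w - z)) ->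
   t < d ->
   normc (phi (z + t%:C *: delta_mx 0 l' + t%:C *: delta_mx 0 j')
    - phi (z + t%:C *: delta_mx 0 l')
    - phi (z + t%:C *: delta_mx 0 j') + phi z - t%:C ^+ 2 * b j') <= n / 4 * t ^+ 2.
  move=> H td; have S := local_second_difference l' j' t0 t8.
  have := H (z + t%:C *: delta_mx 0 j'); rewrite addrAC subrr add0r sum_delta.
  move=> /(_ (le_lt_trans (gt _) td)) D.
  set X := phi _ - _ - _ + _ in S *; set Y := a _ l' - a z l' in S D *.
  have -> : X - t%:C ^+ 2 * b j' = (X - t%:C * Y) + t%:C * (Y - t%:C * b j') by ring.
  apply: le_trans (le_normcD _ _) _; rewrite normcM normc_real gtr0_norm //.
  have D2 : normc (Y - t%:C * b j') <= n / 8 * t.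
    by apply: le_trans D _; apply: ler_wpM2l (gt _); exact: ltW.
  have D3 := ler_wpM2l (ltW t0) D2.
  have S2 : C * t ^+ 3 <= n / 8 * t ^+ 2.
    rewrite exprS mulrA ler_wpM2r ?sqr_ge0 //.
    have tC' : t * (8 * C) <= n by rewrite -ler_pdivlMr // mulr_gt0 // ltr0n.
    by lra.
  rewrite -/C in S; have E : t * (n / 8 * t) = n / 8 * t ^+ 2 by ring.
  lra.
have A1 := A _ j _ _ h1 td1; have A2 := A _ l _ _ h2 td2.
set X1 := _ - _ - _ + _ in A1; set X2 := _ - _ - _ + _ in A2.
have X12 : X1 = X2.
  by rewrite /X1 /X2 [z + t%:C *: _ + t%:C *: delta_mx 0 l]addrAC; ring.
have := ler_normcB (X2 - t%:C ^+ 2 * bj l) (X1 - t%:C ^+ 2 * bl j).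
have -> : X2 - t%:C ^+ 2 * bj l - (X1 - t%:C ^+ 2 * bl j) = t%:C ^+ 2 * (bl j - bj l).
  by rewrite X12; ring.
rewrite (normcM (_ ^+ 2)) normcX normc_real gtr0_norm // -/n => H.
have t2 : 0 < t ^+ 2 by rewrite exprn_gt0.
have : t ^+ 2 * n <= t ^+ 2 * (n / 2) by lra.
by rewrite ler_pM2l //; lra.
Qed.

End LocalEstimates.

(** * Holomorphic functions on the polydisc and their Hessians *)

Section HolomorphicGradient.
Variables (R : realType) (m : nat).
Implicit Types (z v w : 'rV[R[i]]_m).

Definition mholo (phi : 'rV[R[i]]_m -> R[i]) (a : 'rV[R[i]]_m -> 'I_m -> R[i]) :=
  forall z, polydisc z -> mdiff phi z (a z).

Lemma mholo_locally_bounded phi a z : mholo phi a -> polydisc z -> exists rho M : R,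
  [/\ 0 < rho, 0 < M & forall w, gauge_polydisc (w - z) <= rho ->
     polydisc w /\ normc (phi w) <= M].
Proof.
move=> hphi zP; have [d d0 hd] := mdiff_mcont (hphi _ zP) ltr01.
have z1 : gauge_polydisc z < 1 by apply/polydisc_gauge.
exists (Num.min (d / 2) ((1 - gauge_polydisc z) / 2)), (normc (phi z) + 1); split.
- by rewrite lt_min !divr_gt0 // subr_gt0.
- by have := normc_ge0 (phi z); lra.
move=> w; rewrite le_min => /andP[h1 h2]; split.
  apply/polydisc_gauge; have := gaugeD (w - z) z; rewrite subrK; lra.
have := hd w; have := ler_dist_normc (phi w) (phi z) => h3 h4.
by have : normc (phi w - phi z) <= 1; [apply: h4; lra|lra].
Qed.

(** The local results apply because differentiability bounds [phi] near each point. Choice needs a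
    total family, so points outside the polydisc receive the zero gradient. *)
Lemma mholo_gradient phi a : mholo phi a ->
  exists b : 'rV[R[i]]_m -> 'I_m -> 'I_m -> R[i],
    (forall l, mholo (fun w => a w l) (fun w => b w l)) /\
    (forall z l j, polydisc z -> b z l j = b z j l).
Proof.
move=> hphi.
have H z l : exists b : 'I_m -> R[i], polydisc z -> mdiff (fun w => a w l) z b.
  have [zP|zP] := pselect (polydisc z); last by exists (fun=> 0) => /zP.
  have [rho [M [rho0 M0 hb]]] := mholo_locally_bounded hphi zP.
  eexists => _; apply: (@gradient_mdiff _ _ phi a z rho M) => // w wz.
    by apply: hphi; have [] := hb w wz.
  by have [] := hb w wz.
pose b z := projT1 (choice (H z)).
have hb z l : polydisc z -> mdiff (fun w => a w l) z (b z l) := projT2 (choice (H z)) l.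
exists b; split => [l z zP|z l j zP]; first exact: hb.
have [rho [M [rho0 M0 hbd]]] := mholo_locally_bounded hphi zP.
apply: (@local_symmetry _ _ phi a z rho M) => //; try exact: hb.
  by move=> w wz; apply: hphi; have [] := hbd w wz.
by move=> w wz; have [] := hbd w wz.
Qed.

End HolomorphicGradient.

(** * The midpoint curve of a convex mapping *)

Section Moebius.
Variable R : realType.
Implicit Types (p w x : R[i]).

Definition moebius p w := (w + p) / (1 + p^* * w).

Lemma conjc_bar_neq0 p w : normc p < 1 -> normc w <= 1 -> 1 + p^* * w != 0.
Proof.
move=> p1 w1; rewrite addrC -[1]opprK subr_eq0; apply/eqP => /(congr1 (@normc R)).
rewrite normcN normc1 normcM normc_conj => e.
have := ler_wpM2l (normc_ge0 p) w1; lra.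
Qed.

Lemma moebius0 p : moebius p 0 = p.
Proof. by rewrite /moebius mulr0 addr0 add0r divr1. Qed.

Lemma moebiusNK p : moebius (- p) p = 0.
Proof. by rewrite /moebius subrr mul0r. Qed.

Lemma normc_moebius_lt1 p w : normc p < 1 -> normc w < 1 -> normc (moebius p w) < 1.
Proof.
move=> p1 w1; have nz := conjc_bar_neq0 p1 (ltW w1).
rewrite normcM normcV ltr_pdivrMr ?normc_gt0 // mul1r.
rewrite -(@ltr_pXn2r _ 2) ?nnegrE ?normc_ge0 // -subr_gt0.
have -> : normc (1 + p^* * w) ^+ 2 - normc (w + p) ^+ 2 =
    (1 - normc p ^+ 2) * (1 - normc w ^+ 2).
  rewrite !sqr_normc_ReIm; case: p {p1 nz} => a b; case: w {w1} => c d /=; ring.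
by rewrite mulr_gt0 // subr_gt0 expr_lt1 ?normc_ge0.
Qed.

Lemma one_sub_normc2 p : (1 - normc p ^+ 2)%:C = 1 - p * p^*.
Proof. by rewrite mul_conjc rmorphB rmorph1. Qed.

Lemma cderiv_moebius p w : normc p < 1 -> normc w <= 1 ->
  cderiv (moebius p) w ((1 - normc p ^+ 2)%:C / (1 + p^* * w) ^+ 2).
Proof.
move=> p1 w1; have nz := conjc_bar_neq0 p1 w1.
have d1 : cderiv (fun w => w + p) w (1 + 0).
  by apply: cderivD; [exact: cderiv_id|exact: cderiv_cst].
have d2 : cderiv (fun w => 1 + p^* * w) w (0 + p^* * 1).
  by apply: cderivD; [exact: cderiv_cst|apply: cderivZ; exact: cderiv_id].
apply: cderiv_eq (cderivM d1 (cderivV d2 nz)) _.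
by rewrite one_sub_normc2; field.
Qed.

Lemma cderiv_dmoebius p w : normc p < 1 -> normc w <= 1 ->
  cderiv (fun w => (1 - normc p ^+ 2)%:C / (1 + p^* * w) ^+ 2) w
    (- (2 * p^* * (1 - normc p ^+ 2)%:C) / (1 + p^* * w) ^+ 3).
Proof.
move=> p1 w1; have nz := conjc_bar_neq0 p1 w1.
have d2 : cderiv (fun w => 1 + p^* * w) w (0 + p^* * 1).
  by apply: cderivD; [exact: cderiv_cst|apply: cderivZ; exact: cderiv_id].
have d3 := cderivM d2 d2.
have nz2 : (1 + p^* * w) * (1 + p^* * w) != 0 by rewrite mulf_neq0.
have := cderivZ (1 - normc p ^+ 2)%:C (cderivV d3 nz2).
rewrite (_ : (fun w => _) = (fun w => (1 - normc p ^+ 2)%:C / (1 + p^* * w) ^+ 2)).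
  by move=> H; apply: cderiv_eq H _; field.
by apply: funext => s; rewrite expr2.
Qed.

End Moebius.

(** * Second derivative of a function along a curve *)

Section CurveSecondDerivative.
Variables (R : realType) (m : nat).
Variables (phi : 'rV[R[i]]_m -> R[i]) (a : 'rV[R[i]]_m -> 'I_m -> R[i])
  (b : 'rV[R[i]]_m -> 'I_m -> 'I_m -> R[i]).
Hypotheses (hphi : mholo phi a) (ha : forall l, mholo (fun w => a w l) (fun w => b w l)).
Variables (X : R[i] -> 'rV[R[i]]_m) (dX : R[i] -> 'I_m -> R[i]) (d2X : 'I_m -> R[i]).
Hypothesis XP : forall t, normc t < 1 -> polydisc (X t).
Hypothesis hX : forall t l, normc t < 1 -> cderiv (fun s => X s 0 l) t (dX t l).
Hypothesis hdX : forall l, cderiv (fun s => dX s l) 0 (d2X l).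

Lemma curve_deriv t : normc t < 1 ->
  cderiv (fun s => phi (X s)) t (\sum_l dX t l * a (X t) l).
Proof. by move=> t1; apply: chain_rule => [l|]; [exact: hX|apply: hphi; exact: XP]. Qed.

Lemma cderiv_sum (I : finType) (F : I -> R[i] -> R[i]) (dF : I -> R[i]) t :
  (forall i, cderiv (F i) t (dF i)) -> cderiv (fun s => \sum_i F i s) t (\sum_i dF i).
Proof.
move=> H; elim: (index_enum I) => [|i s IH].
  by rewrite big_nil; under eq_fun do rewrite big_nil; exact: cderiv_cst.
by rewrite big_cons; under eq_fun do rewrite big_cons; exact: cderivD.
Qed.

Lemma curve_second_deriv :
  cderiv (fun s => \sum_l dX s l * a (X s) l) 0
    (\sum_l d2X l * a (X 0) l + \sum_l \sum_k dX 0 l * dX 0 k * b (X 0) l k).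
Proof.
have n0 : normc (0 : R[i]) < 1 by rewrite normc0.
rewrite -big_split /=; apply: cderiv_sum => l.
apply: cderiv_eq; first apply: cderivM; first exact: hdX.
  apply: (@chain_rule _ _ (fun w => a w l) X 0 (b (X 0) l) (dX 0)); last by apply: ha; exact: XP.
  by move=> k; apply: hX.
by congr (_ + _); rewrite mulr_sumr; apply: eq_bigr => k _; rewrite mulrA.
Qed.

End CurveSecondDerivative.

(** * Midpoint curves and the Hessian at a point p *)

Section MidpointConvexity.
Variables (R : realType) (m : nat).
Variables (f g : 'rV[R[i]]_m -> 'rV[R[i]]_m) (A G : 'rV[R[i]]_m -> 'I_m -> 'I_m -> R[i])
  (b : 'rV[R[i]]_m -> 'I_m -> 'I_m -> 'I_m -> R[i]).
Hypothesis hf : forall i, mholo (fun w => f w 0 i) (fun w l => A w l i).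
Hypothesis hg : forall z, polydisc z -> forall j,
  mdiff (fun w => g w 0 j) (f z) (fun i => G (f z) i j).
Hypothesis gf : forall z, polydisc z -> g (f z) = z.
Hypothesis mid : forall z w, polydisc z -> polydisc w ->
  exists2 u, polydisc u & f u = 2^-1 *: (f z + f w).
Hypothesis hb : forall i l, mholo (fun w => A w l i) (fun w => b w i l).
Hypothesis bC : forall w i l k, polydisc w -> b w i l k = b w i k l.

Lemma jacobian_left_inverse z l j : polydisc z ->
  \sum_i A z l i * G (f z) i j = (l == j)%:R.
Proof.
move=> zP; have z1 : gauge_polydisc z < 1 by apply/polydisc_gauge.
pose e := delta_mx 0 l : 'rV[R[i]]_m.
have dc i : cderiv (fun s => f (z + s *: e) 0 i) 0 (A z l i).
  have := @cderiv_line _ _ (fun w => f w 0 i) z e 0 (fun l => A z l i).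
  rewrite scale0r addr0 => /(_ (hf i zP)) H; apply: cderiv_eq H _.
  rewrite (bigD1 l) //= mxE !eqxx mul1r big1 ?addr0 // => k kl.
  by rewrite mxE (negPf kl) andbF mul0r.
have := @chain_rule _ _ (fun w => g w 0 j) (fun s => f (z + s *: e)) 0 (fun i => G (f z) i j) _ dc.
rewrite scale0r addr0 => /(_ (hg zP j)) H.
have H2 : cderiv (fun s => z 0 j + s * e 0 j) 0 (0 + (1 * e 0 j + 0 * 0)).
  apply: cderivD; first exact: cderiv_cst.
  by apply: cderivM; [exact: cderiv_id|exact: cderiv_cst].
have d0 : 0 < 1 - gauge_polydisc z by rewrite subr_gt0.
have -> : (l == j)%:R = 0 + (1 * e 0 j + 0 * 0) :> R[i].
  by rewrite mul0r addr0 add0r mul1r mxE eqxx eq_sym.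
apply: cderiv_uniq H (cderiv_near d0 _ H2) => s; rewrite subr0 => s1.
rewrite gf ?mxE //; apply/polydisc_gauge; apply: le_lt_trans (gaugeD _ _) _.
have := gaugeZ s e; have := ler_wpM2l (normc_ge0 s) (gauge_delta R l); rewrite mulr1; lra.
Qed.

Lemma jacobian_right_inverse z i k : polydisc z ->
  \sum_j G (f z) i j * A z j k = (i == k)%:R.
Proof.
move=> zP; pose MA := \matrix_(l, i) A z l i; pose MG := \matrix_(i, j) G (f z) i j.
have : MA *m MG = 1%:M.
  apply/matrixP => l j; rewrite !mxE -(@jacobian_left_inverse z l j zP).
  by apply: eq_bigr => i' _; rewrite !mxE.
move=> /mulmx1C /matrixP /(_ i k); rewrite !mxE => <-.
by apply: eq_bigr => j _; rewrite !mxE.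
Qed.

Variable p : 'rV[R[i]]_m.
Hypothesis pP : polydisc p.

(** This is the derivative at 0 of the disc automorphism sending 0 to [p 0 l], hence the factor on
    initial velocities in [dX0]. *)
Let q l : R[i] := (1 - normc (p 0 l) ^+ 2)%:C.

Let q0 l : q l != 0.
Proof.
have := pP l; rewrite -normc_gt0 normc_real normr_gt0 subr_eq0 => pl.
by rewrite eq_sym lt_eqF // expr_lt1 ?normc_ge0.
Qed.

(* The Hessian of f at p in the frame of the columns of the Jacobian of f at p. *)
Definition hess j l k : R[i] := \sum_i b p i l k * G (f p) i j.

Let X (x : 'I_m -> R[i]) (t : R[i]) : 'rV[R[i]]_m := \row_l moebius (p 0 l) (x l * t).

Let dX (x : 'I_m -> R[i]) (t : R[i]) (l : 'I_m) : R[i] :=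
  q l / (1 + (p 0 l)^* * (x l * t)) ^+ 2 * x l.

Let d2X (x : 'I_m -> R[i]) (l : 'I_m) : R[i] := - (2 * (p 0 l)^* * q l) * x l ^+ 2.

Let closed (x : 'I_m -> R[i]) := forall l, normc (x l) <= 1.

Let xt_lt1 x t l : closed x -> normc t < 1 -> normc (x l * t) < 1.
Proof.
move=> cx t1; rewrite normcM; apply: le_lt_trans t1.
by rewrite ler_piMl ?normc_ge0.
Qed.

Let XP x t : closed x -> normc t < 1 -> polydisc (X x t).
Proof. by move=> cx t1 l; rewrite mxE; apply: normc_moebius_lt1; [exact: pP|exact: xt_lt1]. Qed.

Let hX x t l : closed x -> normc t < 1 -> cderiv (fun s => X x s 0 l) t (dX x t l).
Proof.
move=> cx t1; have H := cderiv_moebius (pP l) (ltW (xt_lt1 l cx t1)).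
have := @cderiv_affine _ (moebius (p 0 l)) 0 (x l) t; rewrite add0r => /(_ _ H).
rewrite (_ : (fun w => _) = (fun s => X x s 0 l)) //.
by apply: funext => s; rewrite mxE add0r.
Qed.

Let hdX x l : closed x -> cderiv (fun s => dX x s l) 0 (d2X x l).
Proof.
move=> cx; have n0 : normc (0 : R[i]) < 1 by rewrite normc0.
have H := cderiv_dmoebius (pP l) (ltW (xt_lt1 l cx n0)).
have := @cderiv_affine _ (fun w => (1 - normc (p 0 l) ^+ 2)%:C / (1 + (p 0 l)^* * w) ^+ 2) 0 (x l) 0.
rewrite add0r => /(_ _ H) /(cderivZ (x l)).
rewrite (_ : (fun w => _) = (fun s => dX x s l)).
  by move=> H2; apply: cderiv_eq H2 _; rewrite /d2X /q !mulr0 addr0 expr1n; field.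
by apply: funext => s; rewrite add0r mulrC.
Qed.

Let X0 x : X x 0 = p.
Proof. by apply/rowP => l; rewrite mxE mulr0 moebius0. Qed.

Let dX0 x l : dX x 0 l = q l * x l.
Proof. by rewrite /dX !mulr0 addr0 expr1n divr1. Qed.

Let W x y t : 'rV[R[i]]_m := g (2^-1 *: (f (X x t) + f (X y t))).

Let WP x y t : closed x -> closed y -> normc t < 1 ->
  polydisc (W x y t) /\ f (W x y t) = 2^-1 *: (f (X x t) + f (X y t)).
Proof.
move=> cx cy t1; have [u uP fu] := mid (XP cx t1) (XP cy t1).
by rewrite /W -fu gf.
Qed.

Let W0 x y : closed x -> closed y -> W x y 0 = p.
Proof.
move=> cx cy; have d : f p + f p = (2 : R[i]) *: f p by rewrite scaler_nat mulr2n.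
by rewrite /W !X0 d scalerA mulVf ?scale1r ?gf // pnatr_eq0.
Qed.

Let dW x y t j : R[i] := \sum_i (2^-1 * (\sum_l dX x t l * A (X x t) l i +
  \sum_l dX y t l * A (X y t) l i)) * G (f (W x y t)) i j.

Let hW x y t j : closed x -> closed y -> normc t < 1 ->
  cderiv (fun s => W x y s 0 j) t (dW x y t j).
Proof.
move=> cx cy t1; have [wP fw] := WP cx cy t1.
apply: (@chain_rule _ _ (fun w => g w 0 j) (fun s => 2^-1 *: (f (X x s) + f (X y s)))).
  move=> i; rewrite (_ : (fun s => _) = (fun s => 2^-1 * (f (X x s) 0 i + f (X y s) 0 i))).
    apply: cderivZ; apply: cderivD.
      exact: (curve_deriv (hf i) (fun t t1 => XP cx t1) (fun t l t1 => hX l cx t1)).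
    exact: (curve_deriv (hf i) (fun t t1 => XP cy t1) (fun t l t1 => hX l cy t1)).
  by apply: funext => s; rewrite !mxE.
by rewrite -fw; exact: hg.
Qed.

Let dW0 x y j : closed x -> closed y -> dW x y 0 j = q j * ((x j + y j) / 2).
Proof.
move=> cx cy; rewrite /dW W0 // !X0.
rewrite (eq_bigr (fun i => \sum_l q l * ((x l + y l) / 2) * (A p l i * G (f p) i j))).
  rewrite exchange_big /= (bigD1 j) //= -mulr_sumr jacobian_left_inverse // eqxx mulr1.
  rewrite big1 ?addr0 // => l lj.
  by rewrite -mulr_sumr jacobian_left_inverse // (negPf lj) mulr0.
move=> i _; rewrite -big_split /= mulr_sumr mulr_suml; apply: eq_bigr => l _.
by rewrite !dX0; field.
Qed.

(* The j-th coordinate of the midpoint curve W, followed by moebius (- p j), is a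
   self-map of the disc fixing 0, and e is its second derivative at 0. *)
Lemma midpoint_hessian x y j : closed x -> closed y ->
  exists e : R[i], [/\ \sum_l \sum_k (q l * ((x l - y l) / 2)) * (q k * ((x k - y k) / 2)) * hess j l k
      = q j * (e + 2 * (p 0 j)^* * ((x j - y j) / 2) ^+ 2),
    normc e <= 2 &
    forall c : R, 0 <= c -> (x j + y j) / 2 = c%:C -> normc e <= 4 * (1 - c)].
Proof.
move=> cx cy; have n0 : normc (0 : R[i]) < 1 by rewrite normc0.
have nN : normc (- p 0 j) < 1 by rewrite normcN; exact: pP.
have Wj t : normc t < 1 -> normc (W x y t 0 j) < 1 by move=> t1; have [] := WP cx cy t1.
have [w2 hw2] : exists w2 : 'I_m -> R[i], forall j, cderiv (fun s => dW x y s j) 0 (w2 j).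
  have H j' : exists w, cderiv (fun s => dW x y s j') 0 w.
    by apply: (@deriv_holo _ (fun s => W x y s 0 j')) => // t t1; exact: hW.
  by exists (projT1 (choice H)) => j'; exact: (projT2 (choice H)).
have hWP t (t1 : normc t < 1) : polydisc (W x y t) by have [] := WP cx cy t1.
(* The relation f(W) = (f(X) + f(Y)) / 2 is differentiated twice at t = 0, in the component i.
   Contracting with the inverse Jacobian then isolates W_j''. *)
have E i : \sum_l w2 l * A p l i + \sum_l \sum_k dW x y 0 l * dW x y 0 k * b p i l k =
  2^-1 * ((\sum_l d2X x l * A p l i + \sum_l \sum_k dX x 0 l * dX x 0 k * b p i l k) +
          (\sum_l d2X y l * A p l i + \sum_l \sum_k dX y 0 l * dX y 0 k * b p i l k)).
  have h1 := @curve_second_deriv _ _ _ _ (hb i) _ _ _ hWP (fun t l t1 => hW l cx cy t1) hw2.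
  have h2 := @curve_second_deriv _ _ _ _ (hb i) _ _ _ (fun t t1 => XP cx t1)
    (fun t l t1 => hX l cx t1) (fun l => hdX l cx).
  have h3 := @curve_second_deriv _ _ _ _ (hb i) _ _ _ (fun t t1 => XP cy t1)
    (fun t l t1 => hX l cy t1) (fun l => hdX l cy).
  rewrite (W0 cx cy) in h1; rewrite !X0 in h2 h3.
  have h4 := cderivZ 2^-1 (cderivD h2 h3).
  apply: cderiv_uniq h1 (cderiv_near ltr01 _ h4) => s; rewrite subr0 => s1.
  have k1 := curve_deriv (hf i) hWP (fun t l t1 => hW l cx cy t1) s1.
  have k2 := curve_deriv (hf i) (fun t t1 => XP cx t1) (fun t l t1 => hX l cx t1) s1.
  have k3 := curve_deriv (hf i) (fun t t1 => XP cy t1) (fun t l t1 => hX l cy t1) s1.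
  have k4 := cderivZ 2^-1 (cderivD k2 k3).
  have d1 : 0 < 1 - normc s by rewrite subr_gt0.
  apply: cderiv_uniq (cderiv_near d1 _ k4) k1 => t ts.
  have t1 : normc t < 1 by have := le_normcD (t - s) s; rewrite subrK; lra.
  by have [_ ->] := WP cx cy t1; rewrite !mxE.
pose D l := q l * ((x l - y l) / 2).
pose S l := q l * ((x l + y l) / 2).
have cA (u : 'I_m -> R[i]) : \sum_i (\sum_l u l * A p l i) * G (f p) i j = u j.
  rewrite (eq_bigr (fun i => \sum_l u l * (A p l i * G (f p) i j))); last first.
    by move=> i _; rewrite mulr_suml; apply: eq_bigr => l _; rewrite mulrA.
  rewrite exchange_big /= (bigD1 j) //= -mulr_sumr jacobian_left_inverse // eqxx mulr1.
  rewrite big1 ?addr0 // => l lj.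
  by rewrite -mulr_sumr jacobian_left_inverse // (negPf lj) mulr0.
pose H u := \sum_l \sum_k u l * u k * hess j l k.
have cB (u : 'I_m -> R[i]) :
    \sum_i (\sum_l \sum_k u l * u k * b p i l k) * G (f p) i j = H u.
  rewrite (eq_bigr (fun i => \sum_l \sum_k u l * u k * (b p i l k * G (f p) i j))).
    rewrite exchange_big; apply: eq_bigr => l _; rewrite exchange_big; apply: eq_bigr => k _.
    by rewrite -mulr_sumr.
  move=> i _; rewrite mulr_suml; apply: eq_bigr => l _; rewrite mulr_suml.
  by apply: eq_bigr => k _; rewrite mulrA.
have HS : H (dW x y 0) = H S.
  by apply: eq_bigr => l _; apply: eq_bigr => k _; rewrite !dW0.
(* Parallelogram law: the initial velocities of X and Y are S + D and S - D, that of W is S.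
   Removing the term H S of W leaves the Hessian on the half-difference alone. *)
have par : H S + H D = 2^-1 * (H (dX x 0) + H (dX y 0)).
  rewrite -!big_split mulr_sumr /=; apply: eq_bigr => l _.
  rewrite -!big_split mulr_sumr /=; apply: eq_bigr => k _.
  by rewrite /S /D !dX0; field.
have E2 : w2 j = 2^-1 * (d2X x j + d2X y j) + H D.
  have : \sum_i (\sum_l w2 l * A p l i + \sum_l \sum_k dW x y 0 l * dW x y 0 k * b p i l k)
       * G (f p) i j = w2 j + H S.
    rewrite -HS -[in RHS](cA w2) -(cB (dW x y 0)) -big_split /=.
    by apply: eq_bigr => i _; rewrite mulrDl.
  under eq_bigr do rewrite E.
  have -> : \sum_i 2^-1 * ((\sum_l d2X x l * A p l i + \sum_l \sum_k dX x 0 l * dX x 0 k * b p i l k) +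
          (\sum_l d2X y l * A p l i + \sum_l \sum_k dX y 0 l * dX y 0 k * b p i l k)) * G (f p) i j
     = 2^-1 * (d2X x j + H (dX x 0) + (d2X y j + H (dX y 0))).
    rewrite -(cA (d2X x)) -(cA (d2X y)) -!cB -!big_split mulr_sumr /=.
    by apply: eq_bigr => i _; rewrite -mulrA !mulrDl.
  move=> e; apply: (addIr (H S)); rewrite -e.
  transitivity (2^-1 * (d2X x j + d2X y j) + (H S + H D)); first by rewrite par; ring.
  by ring.
pose p' := (p 0 j)^*.
pose F t := moebius (- p 0 j) (W x y t 0 j).
pose ker w : R[i] := (1 - normc (- p 0 j) ^+ 2)%:C / (1 + (- p 0 j)^* * w) ^+ 2.
pose dF t := ker (W x y t 0 j) * dW x y t j.
have hF t : normc t < 1 -> cderiv F t (dF t).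
  by move=> t1; exact: (cderiv_comp (hW j cx cy t1) (cderiv_moebius nN (ltW (Wj _ t1)))).
have W0j : W x y 0 0 j = p 0 j by rewrite W0.
have qE : q j = 1 - p 0 j * p' by exact: one_sub_normc2.
have nq : (1 - normc (- p 0 j) ^+ 2)%:C = q j by rewrite normcN.
have den : 1 + (- p 0 j)^* * p 0 j = q j.
  by rewrite rmorphN mulNr qE mulrC.
pose c1 := (x j + y j) / 2.
have dF0 : dF 0 = c1.
  rewrite /dF /ker W0j den nq dW0 // -/c1; move: (q j) (q0 j) => Q Q0; field; exact: Q0.
(* This is m''(p_j) W_j'^2 + m'(p_j) W_j'' for the automorphism m sending p_j to 0, where m'(p_j) =
   1 / q_j, m''(p_j) = 2 p' / q_j^2 and W_j' = q_j c1. *)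
pose e := 2 * p' * c1 ^+ 2 + w2 j / q j.
have hdF : cderiv dF 0 e.
  have k1 := cderiv_comp (hW j cx cy n0) (cderiv_dmoebius nN (ltW (Wj _ n0))).
  apply: cderiv_eq (cderivM k1 (hw2 j)) _.
  rewrite W0j den nq dW0 // -/c1 /e rmorphN -/p'; move: (q j) (q0 j) => Q Q0; field; exact: Q0.
have F1 t : normc t < 1 -> normc (F t) <= 1.
  by move=> t1; apply: ltW; apply: normc_moebius_lt1 => //; exact: Wj.
exists e; split.
- have -> : \sum_l \sum_k q l * ((x l - y l) / 2) * (q k * ((x k - y k) / 2)) * hess j l k = H D by [].
  have -> : H D = w2 j - 2^-1 * (d2X x j + d2X y j) by rewrite E2; ring.
  by rewrite /e /d2X -/p' /c1; move: (q j) (q0 j) => Q Q0; field; exact: Q0.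
- exact: second_deriv_bound hF F1 hdF.
- move=> c c0 ce; apply: (second_deriv_schwarz hF F1 _ _ c0 hdF).
    by rewrite /F W0j moebiusNK.
  by rewrite dF0.
Qed.

End MidpointConvexity.

(** * Hessian entries from well-chosen pairs x, y *)

Section HessianStructure.
Variables (R : realType) (m : nat) (q : 'I_m -> R[i]) (P : R[i])
  (B : 'I_m -> 'I_m -> R[i]) (j : 'I_m).
Hypothesis q0 : forall l, q l != 0.
Hypothesis BC : forall l k, B l k = B k l.
Hypothesis H : forall x y : 'I_m -> R[i],
  (forall l, normc (x l) <= 1) -> (forall l, normc (y l) <= 1) ->
  exists e : R[i], [/\
    \sum_l \sum_k (q l * ((x l - y l) / 2)) * (q k * ((x k - y k) / 2)) * B l k
      = q j * (e + 2 * P * ((x j - y j) / 2) ^+ 2),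
    normc e <= 2 &
    forall c : R, 0 <= c -> (x j + y j) / 2 = c%:C -> normc e <= 4 * (1 - c)].

Let Q (d : 'I_m -> R[i]) := \sum_l \sum_k (q l * d l) * (q k * d k) * B l k.

(** Taking x = c + d and y = c - d separates two roles: the direction [d] enters the quadratic form,
    the j-th coordinate of the centre [c] controls the size of [e]. *)
Let HQ (c d : 'I_m -> R[i]) : (forall l, normc (c l + d l) <= 1) ->
  (forall l, normc (c l - d l) <= 1) ->
  exists e : R[i], [/\ Q d = q j * (e + 2 * P * d j ^+ 2), normc e <= 2 &
    forall a : R, 0 <= a -> c j = a%:C -> normc e <= 4 * (1 - a)].
Proof.
move=> h1 h2; have [e [e1 e2 e3]] := H h1 h2; exists e.
have dE l : (c l + d l - (c l - d l)) / 2 = d l by field.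
have cE : (c j + d j + (c j - d j)) / 2 = c j by field.
rewrite cE in e3; rewrite dE in e1; split=> //; rewrite -e1.
by apply: eq_bigr => l _; apply: eq_bigr => k _; rewrite !dE.
Qed.

Let supp2 (l k : 'I_m) (al ga : R[i]) (i : 'I_m) :=
  if i == l then al else if i == k then ga else 0.

Let sum_supp2 l k al ga (F : 'I_m -> R[i]) : l != k ->
  \sum_i (q i * supp2 l k al ga i) * F i = q l * al * F l + q k * ga * F k.
Proof.
move=> lk; rewrite (bigD1 l) //= (bigD1 k) 1?eq_sym //= /supp2 !eqxx.
rewrite [k == l]eq_sym (negPf lk) big1 ?addr0 // => i /andP[il ik].
by rewrite (negPf il) (negPf ik) mulr0 mul0r.
Qed.

Let Q_supp2 l k al ga : l != k ->
  Q (supp2 l k al ga) = (q l * al) ^+ 2 * B l l + 2 * (q l * al) * (q k * ga) * B l k +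
    (q k * ga) ^+ 2 * B k k.
Proof.
move=> lk; rewrite /Q.
rewrite (eq_bigr (fun i => (q i * supp2 l k al ga i) *
   \sum_i' (q i' * supp2 l k al ga i') * B i i')); last first.
  by move=> i _; rewrite mulr_sumr; apply: eq_bigr => i' _; rewrite -mulrA.
by rewrite sum_supp2 // !sum_supp2 // (BC k l); ring.
Qed.

(** The constraint is coordinatewise, so c_j = 1 is compatible with arbitrary entries of modulus at
    most 1 in the other slots of d. Then |e| <= 4 (1 - 1) = 0, and d_j = 0 removes the term with
    [P]. *)
Let off_zero l k : l != j -> k != j -> l != k -> forall al ga : R[i],
  normc al <= 1 -> normc ga <= 1 -> Q (supp2 l k al ga) = 0.
Proof.
move=> lj kj lk al ga al1 ga1.
pose c i : R[i] := (i == j)%:R.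
have nb i s : s = 1 \/ s = -1 -> normc (c i + s * supp2 l k al ga i) <= 1.
  move=> s1; have ns : normc s = 1 by case: s1 => ->; rewrite ?normcN normc1.
  rewrite /c /supp2; case: (eqVneq i j) => [->|ij].
    by rewrite eq_sym (negPf lj) eq_sym (negPf kj) mulr0 addr0 normc1.
  rewrite add0r normcM ns mul1r.
  by case: ifP => // _; case: ifP => // _; rewrite normc0.
have [||e [e1 _ e3]] := @HQ c (supp2 l k al ga).
- by move=> i; have := nb i 1; rewrite mul1r; apply; left.
- by move=> i; have := nb i (-1); rewrite mulN1r; apply; right.
have /e3 : c j = (1 : R)%:C by rewrite /c eqxx rmorph1.
rewrite subrr mulr0 => /(_ ler01) en.
have e0 : e = 0 by apply/eqP; rewrite -normc_eq0 eq_le en normc_ge0.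
by rewrite e1 e0 /supp2 eq_sym (negPf lj) eq_sym (negPf kj); ring.
Qed.

Let off_diag l : l != j -> B l l = 0.
Proof.
move=> lj; pose c i : R[i] := (i == j)%:R.
pose d i : R[i] := (i == l)%:R.
have nb i s : s = 1 \/ s = -1 -> normc (c i + s * d i) <= 1.
  move=> s1; have ns : normc s = 1 by case: s1 => ->; rewrite ?normcN normc1.
  rewrite /c /d; case: (eqVneq i j) => [->|ij].
    by rewrite eq_sym (negPf lj) mulr0 addr0 normc1.
  rewrite add0r normcM ns mul1r.
  by case: (i == l); rewrite ?normc1 ?normc0.
have [||e [e1 _ e3]] := @HQ c d.
- by move=> i; have := nb i 1; rewrite mul1r; apply; left.
- by move=> i; have := nb i (-1); rewrite mulN1r; apply; right.
have /e3 : c j = (1 : R)%:C by rewrite /c eqxx rmorph1.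
rewrite subrr mulr0 => /(_ ler01) en.
have e0 : e = 0 by apply/eqP; rewrite -normc_eq0 eq_le en normc_ge0.
have dj : d j = 0 by rewrite /d eq_sym (negPf lj).
have : Q d = 0 by rewrite e1 e0 dj; ring.
have -> : d = supp2 l j 1 0.
  by apply: funext => i; rewrite /d /supp2; case: (i == l) => //; case: (i == j).
rewrite Q_supp2 // !mulr0 expr0n mul0r mul0r !addr0 mulr1 => /eqP.
by rewrite mulf_eq0 expf_eq0 (negPf (q0 l)) andbF => /eqP.
Qed.

Let off_off l k : l != j -> k != j -> B l k = 0.
Proof.
move=> lj kj; have [->|lk] := eqVneq l k; first exact: off_diag.
have n1 : normc (1 : R[i]) <= 1 by rewrite normc1.
have := off_zero lj kj lk n1 n1; rewrite Q_supp2 // !off_diag // !mulr0 add0r addr0 !mulr1.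
move=> /eqP; rewrite !mulf_eq0 (negPf (q0 l)) (negPf (q0 k)) pnatr_eq0 /= => /eqP //.
Qed.

(** Here d_j must be nonzero. With c_j = a real and d_j = i s, orthogonality gives |a + i s|^2 = |a
    - i s|^2 = a^2 + s^2 = 1, so 1 - a <= s^2 and e = O(s^2). The mixed entry is multiplied by s,
    every other term by s^2. *)
Let mixed l : l != j -> B j l = 0.
Proof.
move=> lj; apply/eqP; rewrite -normc_eq0 eq_le normc_ge0 andbT leNgt; apply/negP => b0.
(* The comparison of terms reads s n <= K s^2; with s <= n / (2 K) this is contradictory. In [K],
   the 4 stems from |e| <= 4 s^2. *)
pose K := normc (q j ^+ 2 * B j j) + normc (q j) * (4 + 2 * normc P).
have nP := normc_ge0 P; have nqB := normc_ge0 (q j ^+ 2 * B j j).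
have nq l' : 0 < normc (q l') by rewrite normc_gt0.
have K0 : 0 < K by rewrite /K ltr_wpDl // mulr_gt0 //; lra.
pose n := 2 * normc (q j) * normc (q l) * normc (B j l).
have n0 : 0 < n by rewrite !mulr_gt0.
pose s := Num.min 1 (n / (2 * K)).
have s0 : 0 < s by rewrite lt_min ltr01 divr_gt0 // mulr_gt0.
have s1 : s <= 1 by rewrite ge_min lexx.
have sK : s * (2 * K) <= n by rewrite -ler_pdivlMr ?mulr_gt0 // ge_min lexx orbT.
pose a := Num.sqrt (1 - s ^+ 2).
have s21 : s ^+ 2 <= 1 by rewrite expr_le1 // ltW.
have a0 : 0 <= a by exact: sqrtr_ge0.
have a2 : a ^+ 2 = 1 - s ^+ 2 by rewrite sqr_sqrtr // subr_ge0.
have a1 : 1 - a <= s ^+ 2.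
  have a_le1 : a <= 1 by rewrite -(@ler_pXn2r _ 2) ?nnegrE // expr1n a2; have := sqr_ge0 s; lra.
  by nra.
pose c i : R[i] := if i == j then a%:C else 0.
pose d := supp2 j l ('i * s%:C) 1.
have na t : t = 1 \/ t = -1 -> normc (a%:C + t * ('i * s%:C)) <= 1.
  move=> t1; rewrite -(@ler_pXn2r _ 2) ?nnegrE ?normc_ge0 // expr1n sqr_normc_ReIm.
  by case: t1 => -> /=; rewrite !(mul0r, mul1r, mulr0, subr0, addr0, add0r, oppr0, mulN1r, sub0r, sqrrN) a2; lra.
have nb i t : t = 1 \/ t = -1 -> normc (c i + t * d i) <= 1.
  move=> t1; have ns : normc t = 1 by case: t1 => ->; rewrite ?normcN normc1.
  rewrite /c /d /supp2; case: (eqVneq i j) => [_|ij]; first exact: na.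
  by rewrite add0r normcM ns mul1r; case: (i == l); rewrite ?normc1 ?normc0.
have [||e [e1 _ e3]] := @HQ c d.
- by move=> i; have := nb i 1; rewrite mul1r; apply; left.
- by move=> i; have := nb i (-1); rewrite mulN1r; apply; right.
have {}e3 : normc e <= 4 * (1 - a) by apply: e3 => //; rewrite /c eqxx.
have dj : d j = 'i * s%:C by rewrite /d /supp2 eqxx.
have i2 : 'i * 'i = -1 :> R[i] by rewrite -expr2 sqr_i.
move: e1; rewrite dj /d Q_supp2 1?eq_sym // (off_diag lj) mulr0 addr0 mulr1 => e1.
have e4 : 2 * (q j * ('i * s%:C)) * q l * B j l =
   s%:C ^+ 2 * (q j ^+ 2 * B j j) + q j * (e - 2 * P * s%:C ^+ 2).
  have -> : 2 * (q j * ('i * s%:C)) * q l * B j l = q j * (e + 2 * P * ('i * s%:C) ^+ 2) -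
     (q j * ('i * s%:C)) ^+ 2 * B j j by rewrite -e1; ring.
  have -> : ('i * s%:C) ^+ 2 = - s%:C ^+ 2 by rewrite exprMn expr2 i2 mulN1r.
  by rewrite exprMn (_ : ('i * s%:C) ^+ 2 = - s%:C ^+ 2) ?exprMn ?expr2 ?i2 ?mulN1r //; ring.
have ns : normc s%:C = s by rewrite normc_real gtr0_norm.
have ni : normc ('i : R[i]) = 1 by rewrite /normc /= expr0n expr1n add0r sqrtr1.
have := le_normcD (s%:C ^+ 2 * (q j ^+ 2 * B j j)) (q j * (e - 2 * P * s%:C ^+ 2)).
rewrite -e4.
have -> : normc (2 * (q j * ('i * s%:C)) * q l * B j l) = s * n.
  by rewrite !normcM ni ns normc_2 mul1r /n; ring.
rewrite (normcM (s%:C ^+ 2)) (normcX s%:C) ns (normcM (q j) (_ - _)).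
have h1 : normc (e - 2 * P * s%:C ^+ 2) <= s ^+ 2 * (4 + 2 * normc P).
  apply: le_trans (ler_normcB _ _) _.
  by rewrite (normcM (2 * P)) (normcM 2) normcX ns normc_2; lra.
have h2 := ler_wpM2l (ltW (nq j)) h1 => h3.
have : s * n <= s ^+ 2 * K by rewrite /K mulrDr; lra.
by rewrite expr2 -mulrA ler_pM2l //; lra.
Qed.

Lemma hessian_off_diagonal l k : l != k \/ l != j -> B l k = 0.
Proof.
have [->|lj] := eqVneq l j; last first.
  have [->|kj] := eqVneq k j; first by rewrite BC mixed.
  by rewrite off_off.
case=> //; by rewrite eq_sym => /mixed.
Qed.

(** Centre 0 and direction the j-th basis vector; the bound |e| <= 2 is read off after division by
    [q j]. *)
Lemma hessian_diagonal : normc (q j * B j j - 2 * P) <= 2.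
Proof.
pose d i : R[i] := (i == j)%:R.
have [||e [e1 e2 _]] := @HQ (fun=> 0) d.
- by move=> i; rewrite add0r /d; case: (i == j); rewrite ?normc1 ?normc0.
- by move=> i; rewrite sub0r normcN /d; case: (i == j); rewrite ?normc1 ?normc0.
have QE : Q d = q j ^+ 2 * B j j.
  rewrite /Q (bigD1 j) //= (bigD1 j) //= !big1 ?addr0.
  - by rewrite /d eqxx !mulr1.
  - by move=> l lj; rewrite big1 // => k _; rewrite /d (negPf lj) mulr0 !mul0r.
  - by move=> k kj; rewrite /d (negPf kj) !mulr0 mul0r.
have : q j * B j j = e + 2 * P.
  by apply: (mulfI (q0 j)); rewrite mulrA -expr2 -QE e1 /d eqxx expr1n mulr1.
by move=> ->; rewrite addrK.
Qed.

End HessianStructure.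

(** * The differential equation along rays *)

Section RealDerivative.
Variable R : realType.

Lemma is_derive_eps (f : R -> R) (t d : R) :
  (forall eps : R, 0 < eps -> exists2 del : R, 0 < del & forall s, `|s - t| < del ->
    `|f s - f t - d * (s - t)| <= eps * `|s - t|) -> is_derive t (1 : R) f d.
Proof.
move=> H; have cv : (fun h => h^-1 *: (f (h *: (1 : R) + t) - f t)) @ 0^' --> d.
  apply/cvgrPdist_le => /= e e0; have [del d0 hd] := H _ e0.
  apply/nbhs_ballP; exists del => //= h; rewrite /ball /= sub0r normrN => hdel h0.
  have := hd (h + t); rewrite addrK => /(_ hdel) h1.
  rewrite /GRing.scale /= mulr1 distrC.
  have -> : h^-1 * (f (h + t) - f t) - d = (f (h + t) - f t - d * h) / h by field.
  by rewrite normrM normfV ler_pdivrMr ?normr_gt0.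
apply: DeriveDef; first by apply/cvg_ex; exists d.
by rewrite /derive; apply: cvg_lim.
Qed.

Lemma is_derive_Re (h : R[i] -> R[i]) (t : R) (d : R[i]) : cderiv h t%:C d ->
  is_derive t (1 : R) (fun s => Re (h s%:C)) (Re d).
Proof.
move=> hd; apply: is_derive_eps => e e0; have [del d0 H] := hd _ e0.
exists del => // s st; have := H s%:C; rewrite -rmorphB normc_real => /(_ st).
apply: le_trans; rewrite -!Re_opp mulrC -Re_mulr_real -Re_opp -!Re_add mulrC.
exact: normRe_le.
Qed.

Lemma is_derive_Im (h : R[i] -> R[i]) (t : R) (d : R[i]) : cderiv h t%:C d ->
  is_derive t (1 : R) (fun s => Im (h s%:C)) (Im d).
Proof.
move=> hd; apply: is_derive_eps => e e0; have [del d0 H] := hd _ e0.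
exists del => // s st; have := H s%:C; rewrite -rmorphB normc_real => /(_ st).
apply: le_trans; have -> : Im d * (s - t) = Im (d * (s - t)%:C).
  by case: d {hd H} => x y /=; rewrite mulr0 add0r.
by rewrite -!Im_opp -!Im_add; exact: normIm_le.
Qed.

Lemma MVT_closed (f df : R -> R) (a b : R) : a < b ->
  (forall t, a <= t <= b -> is_derive t (1 : R) f (df t)) ->
  exists2 c, a < c < b & f b - f a = df c * (b - a).
Proof.
move=> ab dF; have [||c] := MVT ab (f := f) (df := df).
- by move=> x; rewrite in_itv /= => /andP[/ltW ax /ltW xb]; apply: dF; rewrite ax.
- apply: derivable_within_continuous => u; rewrite in_itv /= => xab.
  by have [] := dF _ xab.
by rewrite in_itv /= => cab ->; exists c.
Qed.

(** The mean value theorem is applied to the real and imaginary parts separately, each with its own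
    intermediate point. The derivative need only vanish in the interior. *)
Lemma cderiv_zero_cst (h d : R[i] -> R[i]) :
  (forall t : R, 0 <= t <= 1 -> cderiv h t%:C (d t%:C)) ->
  (forall t : R, 0 < t < 1 -> d t%:C = 0) -> h 1 = h 0.
Proof.
move=> hd d0.
have [c c01 hc] := MVT_closed ltr01 (fun t t01 => is_derive_Re (hd t t01)).
have [c' c01' hc'] := MVT_closed ltr01 (fun t t01 => is_derive_Im (hd t t01)).
move: hc hc'; rewrite (d0 _ c01) (d0 _ c01') /= !mul0r.
rewrite rmorph1 rmorph0 => /eqP; rewrite subr_eq0 => /eqP h1 /eqP; rewrite subr_eq0 => /eqP h2.
by apply/eqP; rewrite eq_complex h1 h2 !eqxx.
Qed.

End RealDerivative.

(** * Distortion for c' = kap c along a ray *)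

Section RayEquation.
Variables (R : realType) (c kap : R[i] -> R[i]).
Hypothesis dc : forall z, normc z < 1 -> cderiv c z (kap z * c z).
Hypothesis hkap : forall z, normc z < 1 ->
  normc ((1 - normc z ^+ 2)%:C * kap z - 2 * z^*) <= 2.
Variable x : R[i].
Hypothesis x1 : normc x < 1.
Variable sg : R.
Hypothesis sg1 : sg = 1 \/ sg = -1.

Let r := normc x.
Let lam (t : R) := x * kap (t%:C * x).

Let tx1 t : 0 <= t <= 1 -> normc (t%:C * x) < 1.
Proof.
move=> /andP[t0 t1]; rewrite normcM normc_real ger0_norm //.
by apply: le_lt_trans x1; rewrite ler_piMl ?normc_ge0.
Qed.

Let den_gt0 t : 0 <= t <= 1 -> 0 < 1 - sg * (t * r).
Proof.
move=> t01; have := tx1 t01; have /andP[t0 t1] := t01.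
rewrite normcM normc_real ger0_norm // -/r => tr.
have tr0 : 0 <= t * r by rewrite mulr_ge0 // normc_ge0.
by case: sg1 => ->; lra.
Qed.

Lemma ray_rate_close t : 0 <= t <= 1 ->
  normc ((1 - (t * r) ^+ 2)%:C * lam t - (2 * (t * r ^+ 2))%:C) <= 2 * r.
Proof.
move=> t01; have := hkap (tx1 t01); have /andP[t0 t1] := t01.
rewrite normcM normc_real ger0_norm // -/r => H.
have -> : (1 - (t * r) ^+ 2)%:C * lam t - (2 * (t * r ^+ 2))%:C =
   x * ((1 - (t * r) ^+ 2)%:C * kap (t%:C * x) - 2 * (t%:C * x)^*).
  have -> : (2 * (t * r ^+ 2))%:C = 2 * (t%:C * (x * x^*)).
    rewrite mul_conjc -/r; apply/eqP; rewrite eq_complex /=.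
    by apply/andP; split; apply/eqP; ring.
  transitivity (x * ((1 - (t * r) ^+ 2)%:C * kap (t%:C * x) - 2 * (t%:C * x^*))).
    by rewrite /lam; ring.
  congr (x * (_ - 2 * _)); rewrite rmorphM; congr (_ * _).
  by symmetry; exact: conjc_real.
by rewrite normcM -/r mulrC ler_wpM2r ?normc_ge0.
Qed.

(** By [ray_rate_close], [lam t] lies in a disc with real centre 2 t r^2 / (1 - t^2 r^2) and radius
    2 r / (1 - t^2 r^2). Its extreme real parts 2r / (1 - t r) and -2r / (1 + t r) are the
    logarithmic derivatives of (1 - t r)^-2 and (1 + t r)^-2. *)
Lemma ray_rate_le t : 0 <= t <= 1 -> sg * Re (lam t) * (1 - sg * (t * r)) <= 2 * r.
Proof.
move=> t01; have D := den_gt0 t01; have := ray_rate_close t01.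
have ss : sg * sg = 1 by case: sg1 => ->; ring.
have DD : 0 < 1 + sg * (t * r).
  have := tx1 t01; have /andP[t0 t1] := t01.
  rewrite normcM normc_real ger0_norm // -/r => tr.
  have tr0 : 0 <= t * r by rewrite mulr_ge0 // normc_ge0.
  by case: sg1 => ->; lra.
set X := _ - _ => H.
have : sg * Re X <= 2 * r.
  apply: le_trans H; apply: le_trans (normRe_le _); apply: le_trans (ler_norm _) _.
  by rewrite normrM; case: sg1 => ->; rewrite ?normrN normr1 mul1r.
rewrite /X Re_add Re_opp Re_mulr_real /= => K.
rewrite -(ler_pM2r DD).
have -> : sg * Re (lam t) * (1 - sg * (t * r)) * (1 + sg * (t * r)) =
   sg * ((1 - (t * r) ^+ 2) * Re (lam t) - 2 * (t * r ^+ 2)) + 2 * r * (sg * (t * r)).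
  have -> : sg * Re (lam t) * (1 - sg * (t * r)) * (1 + sg * (t * r)) =
    sg * ((1 - (sg * sg) * (t * r) ^+ 2) * Re (lam t)) by ring.
  by rewrite ss; ring.
by lra.
Qed.

Lemma cderiv_ray (t : R) : 0 <= t <= 1 ->
  cderiv (fun s => c (s * x)) t%:C (lam t * c (t%:C * x)).
Proof.
move=> t01; have H := @cderiv_affine _ c 0 x t%:C.
have := dc (tx1 t01); rewrite [t%:C * x]mulrC => Hd.
have := H (kap (x * t%:C) * c (x * t%:C)); rewrite add0r => /(_ Hd).
rewrite (_ : (fun w => _) = (fun s => c (s * x))).
  by move=> K; apply: cderiv_eq K _; rewrite /lam [t%:C * x]mulrC; ring.
by apply: funext => s; rewrite add0r mulrC.
Qed.

(** Square of the ratio of |c| to the comparison function (1 - sg t r)^-2; [sg = 1] serves the upper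
    bound and [sg = -1] the lower one. Squaring keeps it differentiable where [c] vanishes. *)
Let G t := normc (c (t%:C * x)) ^+ 2 * (1 - sg * (t * r)) ^+ 4.

Let dG t := 2 * normc (c (t%:C * x)) ^+ 2 * (1 - sg * (t * r)) ^+ 3 *
  (Re (lam t) * (1 - sg * (t * r)) - 2 * (sg * r)).

Lemma is_derive_ray (t : R) : 0 <= t <= 1 -> is_derive t (1 : R) G (dG t).
Proof.
move=> t01; have dr := is_derive_Re (cderiv_ray t01).
have di := is_derive_Im (cderiv_ray t01).
rewrite /G (_ : (fun s => _) = (fun s : R => ((Re (c (s%:C * x))) ^+ 2 +
   (Im (c (s%:C * x))) ^+ 2) * (1 - (sg * r) * s) ^+ 4)); last first.
  by apply: funext => s; rewrite sqr_normc_ReIm; congr (_ * (_ - _) ^+ _); ring.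
have dl : is_derive t (1 : R) (fun s : R => 1 - (sg * r) * s) (- (sg * r)).
  apply: is_derive_eq; rewrite /GRing.scale /=; ring.
rewrite (_ : (fun s => _) = (fun s : R => (Re (c (s%:C * x)) * Re (c (s%:C * x)) +
   Im (c (s%:C * x)) * Im (c (s%:C * x))) *
   ((1 - (sg * r) * s) * (1 - (sg * r) * s) * ((1 - (sg * r) * s) * (1 - (sg * r) * s))))); last first.
  by apply: funext => s; ring.
have dl2 := is_deriveM dl dl.
set F := (fun s => _).
suff [v [H <-]] : exists v, is_derive t (1 : R) F v /\ v = dG t by [].
eexists; split.
  exact: (is_deriveM (is_deriveD (is_deriveM dr dr) (is_deriveM di di)) (is_deriveM dl2 dl2)).
rewrite /dG sqr_normc_ReIm /GRing.scale ?fctE /=.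
move: (c (t%:C * x)) (lam t) => [wr wi] [lr li] /=; ring.
Qed.

Lemma ray_monotone t s : 0 <= t -> t <= s -> s <= 1 -> sg * G s <= sg * G t.
Proof.
move=> t0; rewrite le_eqVlt => /orP[/eqP ->//|ts] s1.
have [|u /andP[tu us] hu] := @MVT_closed _ G dG _ _ ts.
  by move=> u /andP[tu us]; apply: is_derive_ray; apply/andP; split; lra.
rewrite -subr_ge0 -mulrBr -opprB hu mulrN oppr_ge0.
have u01 : 0 <= u <= 1 by apply/andP; split; lra.
have D := den_gt0 u01; have := ray_rate_le u01 => K.
have ss : sg * sg = 1 by case: sg1 => ->; ring.
have -> : sg * (dG u * (s - t)) = 2 * normc (c (u%:C * x)) ^+ 2 * (1 - sg * (u * r)) ^+ 3 *
   (sg * Re (lam u) * (1 - sg * (u * r)) - 2 * r) * (s - t).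
  have -> : 2 * r = sg * sg * (2 * r) by rewrite ss mul1r.
  by rewrite /dG; ring.
rewrite mulr_le0_ge0 //; last by lra.
rewrite mulr_ge0_le0 //; last by lra.
apply: mulr_ge0; first by apply: mulr_ge0 => //; exact: sqr_ge0.
by rewrite exprn_ge0 // ltW.
Qed.

(** Uniqueness for the linear equation: [G] is nonnegative, nonincreasing and starts at 0. It is
    meant for the off-diagonal entries of the Jacobian. *)
Lemma ray_zero : c 0 = 0 -> sg = 1 -> c x = 0.
Proof.
move=> c0 s1; have := ray_monotone (lexx 0) ler01 (lexx 1).
have l01 : 0 <= (1 : R) <= 1 by rewrite ler01 lexx.
have := den_gt0 l01; rewrite /G rmorph1 rmorph0 mul0r c0 normc0 expr0n mul0r s1 !mul1r.
move=> D H; apply: eq0_normc; apply/eqP; rewrite -sqrf_eq0.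
have D4 : 0 < (1 - r) ^+ 4 by rewrite exprn_gt0.
rewrite eq_le sqr_ge0 andbT -(ler_pM2r D4) mul0r //.
Qed.

Lemma distortion : c 0 = 1 -> sg * (normc (c x) ^+ 2 * (1 - sg * r) ^+ 4) <= sg.
Proof.
move=> c0; have := ray_monotone (lexx 0) ler01 (lexx 1).
by rewrite /G rmorph1 rmorph0 !mul0r !mul1r c0 normc1 !expr1n mulr0 subr0 expr1n !mulr1.
Qed.

Hypothesis x0 : x != 0.
Hypothesis c0 : c 0 = 1.

(* Equality in the distortion bound forces the rate Re(lam) to be extremal on the
   whole ray, hence lam itself. *)
Lemma distortion_eq_ray : normc (c x) ^+ 2 * (1 - sg * r) ^+ 4 = 1 ->
  forall t, 0 < t < 1 -> lam t = (2 * (sg * r) / (1 - sg * (t * r)))%:C.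
Proof.
move=> e1; have G1 : G 1 = 1 by rewrite /G rmorph1 !mul1r.
have G0 : G 0 = 1 by rewrite /G rmorph0 !mul0r mulr0 subr0 expr1n mulr1 c0 normc1 expr1n.
have ss : sg * sg = 1 by case: sg1 => ->; ring.
have Gt t : 0 <= t <= 1 -> G t = 1.
  move=> /andP[t0 t1]; have := ray_monotone (lexx 0) t0 t1; have := ray_monotone t0 t1 (lexx 1).
  by rewrite G1 G0; case: sg1 => ->; lra.
move=> t /andP[t0 t1]; have t01 : 0 <= t <= 1 by rewrite !ltW.
have D := den_gt0 t01.
have dG0 : dG t = 0.
  have d2 : is_derive t (1 : R) G 0.
    apply: is_derive_eps => e e0; exists (Num.min t (1 - t)); first by rewrite lt_min t0; lra.
    move=> s; rewrite lt_min !ltr_norml => /andP[/andP[s1 s2] /andP[s3 s4]].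
    rewrite !Gt ?t01 //; last by apply/andP; split; lra.
    by rewrite subrr sub0r mul0r oppr0 normr0 mulr_ge0 // ltW.
  by have [_ <-] := is_derive_ray t01; have [_ ->] := d2.
have nc : normc (c (t%:C * x)) != 0.
  apply/eqP => n0; have := Gt t t01; rewrite /G n0 expr0n mul0r => /eqP.
  by rewrite eq_sym oner_eq0.
have re : Re (lam t) * (1 - sg * (t * r)) = 2 * (sg * r).
  have nz : 2 * normc (c (t%:C * x)) ^+ 2 * (1 - sg * (t * r)) ^+ 3 != 0.
    apply: mulf_neq0; last by rewrite expf_neq0 // gt_eqF.
    by apply: mulf_neq0; [rewrite pnatr_eq0|rewrite expf_neq0].
  by apply/eqP; rewrite -subr_eq0 -(mulrI_eq0 _ (mulfI nz)) -/(dG t) dG0.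
(* The point X lies in the disc of radius 2r about 0 and already has real part 2r or -2r, so it has
   no room for an imaginary part. *)
have im : Im (lam t) = 0.
  have := ray_rate_close t01; set X := _ - _ => HX.
  have r0 := normc_ge0 x; rewrite -/r in r0.
  have reX : Re X = 2 * (sg * r).
    rewrite /X Re_add Re_opp Re_mulr_real /=.
    have -> : (1 - (t * r) ^+ 2) * Re (lam t) =
       (1 + sg * (t * r)) * (Re (lam t) * (1 - sg * (t * r))).
      have -> : (1 + sg * (t * r)) * (Re (lam t) * (1 - sg * (t * r))) =
         (1 - (sg * sg) * (t * r) ^+ 2) * Re (lam t) by ring.
      by rewrite ss mul1r.
    have -> : (1 + sg * (t * r)) * (Re (lam t) * (1 - sg * (t * r))) - 2 * (t * r ^+ 2) =
         Re (lam t) * (1 - sg * (t * r)) + sg * (t * r) * (Re (lam t) * (1 - sg * (t * r)))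
           - 2 * (t * r ^+ 2) by ring.
    rewrite re; have -> : sg * (t * r) * (2 * (sg * r)) = (sg * sg) * (2 * (t * r ^+ 2)) by ring.
    by rewrite ss; ring.
  have : normc X ^+ 2 <= (2 * r) ^+ 2 by rewrite lerXn2r ?nnegrE ?normc_ge0 // mulr_ge0.
  rewrite sqr_normc_ReIm reX.
  have -> : (2 * (sg * r)) ^+ 2 = (sg * sg) * (2 * r) ^+ 2 by ring.
  rewrite ss mul1r gerDl => im0.
  have /eqP : Im X == 0 by rewrite -sqrf_eq0 eq_le im0 sqr_ge0.
  rewrite /X Im_add Im_opp /= oppr0 addr0.
  have -> : Im ((1 - (t * r) ^+ 2)%:C * lam t) = (1 - (t * r) ^+ 2) * Im (lam t).
    by case: (lam t) => ? ? /=; rewrite mul0r addr0.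
  move/eqP; rewrite mulf_eq0 => /orP[|/eqP //].
  have := tx1 t01; rewrite normcM normc_real ger0_norm ?(ltW t0) // -/r => tr1.
  by rewrite subr_eq0 eq_sym lt_eqF // expr_lt1 // mulr_ge0 // ltW.
rewrite -re mulfK ?gt_eqF //.
by apply/eqP; rewrite eq_complex /= im !eqxx.
Qed.

(** On the ray, [c] has the logarithmic derivative of (1 - e w)^-2, so c(w) (1 - e w)^2 keeps its
    initial value 1; the identity theorem carries this from the segment to the disc. *)
Lemma distortion_eq : normc (c x) ^+ 2 * (1 - sg * r) ^+ 4 = 1 ->
  exists2 e : R[i], normc e = 1 & forall z, normc z < 1 -> c z * (1 - e * z) ^+ 2 = 1.
Proof.
move=> /distortion_eq_ray hl.
have r0 : 0 < r by rewrite normc_gt0.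
have rC : r%:C != 0 by rewrite -normc_gt0 normc_real gtr0_norm.
(* Chosen so that e w = sg t r at w = t x: on the ray, 1 - e w is then the real denominator found in
   [distortion_eq_ray]. *)
pose e := sg%:C * x^* / r%:C.
have nsg : normc sg%:C = 1.
  by rewrite normc_real; case: sg1 => ->; rewrite ?normrN normr1.
have e1 : normc e = 1.
  by rewrite /e !normcM normcV nsg normc_conj normc_real gtr0_norm // mul1r divff // gt_eqF.
have ex : e * x = (sg * r)%:C.
  rewrite /e mulrAC -(mulrA _ _ x) [x^* * x]mulrC mul_conjc -/r expr2 !rmorphM.
  by rewrite mulrA mulfK.
exists e => // z z1.
pose E w := c w * (1 - e * w) ^+ 2.
have dE w d : cderiv c w d ->
    cderiv E w (d * (1 - e * w) ^+ 2 + c w * (2 * (1 - e * w) * - e)).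
  move=> hd; have h1 : cderiv (fun w => 1 - e * w) w (0 - e * 1).
    by apply: cderivB; [exact: cderiv_cst|apply: cderivZ; exact: cderiv_id].
  have h2 := cderivM h1 h1.
  rewrite (_ : E = fun w => c w * ((1 - e * w) * (1 - e * w))); last first.
    by apply: funext => s; rewrite /E expr2.
  by apply: cderiv_eq (cderivM hd h2) _; ring.
have E0 : E 0 = 1 by rewrite /E mulr0 subr0 expr1n mulr1.
have Et (tau : R) : 0 < tau <= 1 -> E (tau%:C * x) = 1.
  move=> /andP[tau0 tau1].
  have hd (t : R) : 0 <= t <= 1 ->
      cderiv (fun s => E (s * (tau%:C * x))) t%:C
       ((kap (t%:C * (tau%:C * x)) * c (t%:C * (tau%:C * x)) * (1 - e * (t%:C * (tau%:C * x))) ^+ 2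
         + c (t%:C * (tau%:C * x)) * (2 * (1 - e * (t%:C * (tau%:C * x))) * - e)) * (tau%:C * x)).
    move=> /andP[t0 t1].
    have w1 : normc (t%:C * (tau%:C * x)) < 1.
      rewrite mulrA -rmorphM; apply: tx1; rewrite mulr_ge0 ?(ltW tau0) //=.
      by rewrite mulr_ile1 // ltW.
    have := @cderiv_affine _ E 0 (tau%:C * x) t%:C _.
    rewrite add0r [_ * t%:C]mulrC => /(_ _ (dE _ _ (dc w1))).
    by congr (cderiv _ _ _); apply: funext => s; rewrite add0r mulrC.
  have := @cderiv_zero_cst _ _ (fun s => ((kap (s * (tau%:C * x)) * c (s * (tau%:C * x)) *
     (1 - e * (s * (tau%:C * x))) ^+ 2
         + c (s * (tau%:C * x)) * (2 * (1 - e * (s * (tau%:C * x))) * - e)) * (tau%:C * x))) hd.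
  rewrite mul1r mul0r E0; apply => t /andP[t0 t1].
  have tt : 0 < t * tau < 1.
    by rewrite mulr_gt0 //= ; apply: lt_le_trans tau1; rewrite -[ltRHS]mul1r ltr_pM2r.
  have wE : t%:C * (tau%:C * x) = (t * tau)%:C * x by rewrite rmorphM mulrA.
  have := hl _ tt; rewrite /= !wE; set w := (t * tau)%:C * x => hw.
  have ew : e * w = (sg * (t * tau * r))%:C.
    by rewrite /w mulrCA ex -rmorphM; congr (real_complex _ _); ring.
  have tt01 : 0 <= t * tau <= 1 by have /andP[? ?] := tt; rewrite !ltW.
  have D := den_gt0 tt01.
  have DC : (1 - sg * (t * tau * r))%:C != 0 by rewrite -normc_gt0 normc_real gtr0_norm.
  have ew1 : 1 - e * w = (1 - sg * (t * tau * r))%:C by rewrite ew rmorphB rmorph1.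
  have key : lam (t * tau) * (1 - e * w) = 2 * (e * x).
    rewrite hw ew1 ex -rmorphM divfK ?gt_eqF //.
    by rewrite rmorphM rmorph_nat.
  rewrite /lam -/w in key.
  have -> : (kap w * c w * (1 - e * w) ^+ 2 + c w * (2 * (1 - e * w) * - e)) * (tau%:C * x) =
      tau%:C * c w * (1 - e * w) * (x * kap w * (1 - e * w) - 2 * (e * x)) by ring.
  by rewrite key subrr mulr0.
pose k w := E w - 1.
have xr1 : normc (x / r%:C) = 1.
  by rewrite normcM normcV normc_real gtr0_norm // divff // gt_eqF.
have := @identity_theorem _ k (fun w => kap w * c w * (1 - e * w) ^+ 2 +
   c w * (2 * (1 - e * w) * - e) - 0) (x / r%:C) r _ xr1 r0 _ z z1.
move=> H; apply/eqP; rewrite -subr_eq0; apply/eqP; apply: H.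
  by move=> w w1; apply: cderivB; [apply: dE; exact: dc|exact: cderiv_cst].
move=> t /andP[t0 tr]; rewrite /k.
have -> : t%:C * (x / r%:C) = (t / r)%:C * x by rewrite rmorphM fmorphV; ring.
rewrite Et ?subrr // divr_gt0 //=; by rewrite ler_pdivrMr // mul1r.
Qed.

End RayEquation.

(** * Decoupling of the variables *)

Section Decoupling.
Variables (R : realType) (m : nat).
Variables (f g : 'rV[R[i]]_m -> 'rV[R[i]]_m) (A G : 'rV[R[i]]_m -> 'I_m -> 'I_m -> R[i])
  (b : 'rV[R[i]]_m -> 'I_m -> 'I_m -> 'I_m -> R[i]).
Hypothesis hf : forall i, mholo (fun w => f w 0 i) (fun w l => A w l i).
Hypothesis hg : forall z, polydisc z -> forall j,
  mdiff (fun w => g w 0 j) (f z) (fun i => G (f z) i j).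
Hypothesis gf : forall z, polydisc z -> g (f z) = z.
Hypothesis mid : forall z w, polydisc z -> polydisc w ->
  exists2 u, polydisc u & f u = 2^-1 *: (f z + f w).
Hypothesis hb : forall i l, mholo (fun w => A w l i) (fun w => b w i l).
Hypothesis bC : forall w i l k, polydisc w -> b w i l k = b w i k l.
Hypothesis f0 : f 0 = 0.
Hypothesis A0 : forall l i, A 0 l i = (l == i)%:R.

Let B w j l k := hess f G b w j l k.

Let hessian_hyp w j : polydisc w ->
  (forall l k, l != k \/ l != j -> B w j l k = 0) /\
  normc ((1 - normc (w 0 j) ^+ 2)%:C * B w j j j - 2 * (w 0 j)^*) <= 2.
Proof.
move=> wP; have q0 l : (1 - normc (w 0 l) ^+ 2)%:C != 0.
  rewrite -normc_gt0 normc_real normr_gt0 subr_eq0 eq_sym lt_eqF //.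
  by rewrite expr_lt1 ?normc_ge0 //; exact: wP.
have BC l k : B w j l k = B w j k l.
  by apply: eq_bigr => i _; rewrite bC.
have H x y cx cy := @midpoint_hessian _ _ f g A G b hf hg gf mid hb w wP x y j cx cy.
split; first exact: (hessian_off_diagonal q0 BC H).
exact: (hessian_diagonal q0 H).
Qed.

(** Undoes the change of frame made in [hess], so that zeros of [B] become statements about the
    second partials of f itself. *)
Let b_expand w i l k : polydisc w -> b w i l k = \sum_j B w j l k * A w j i.
Proof.
move=> wP; rewrite (eq_bigr (fun j => \sum_i' b w i' l k * (G (f w) i' j * A w j i))).
  rewrite exchange_big /= (bigD1 i) //= -mulr_sumr.
  rewrite (jacobian_right_inverse hf hg gf) // eqxx mulr1 big1 ?addr0 // => i' ii.
  by rewrite -mulr_sumr (jacobian_right_inverse hf hg gf) // (negPf ii) mulr0.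
by move=> j _; rewrite mulr_suml; apply: eq_bigr => i' _; rewrite mulrA.
Qed.

Lemma mixed_partials_zero w i l k : polydisc w -> l != k -> b w i l k = 0.
Proof.
move=> wP lk; rewrite b_expand // big1 // => j _.
by have [H _] := hessian_hyp j wP; rewrite H; [rewrite mul0r|left].
Qed.

(** The rate [B w l l l] does not depend on the component [i], so all entries of a row of the
    Jacobian solve the same linear equation. *)
Lemma pure_partials w i l : polydisc w -> b w i l l = B w l l l * A w l i.
Proof.
move=> wP; rewrite b_expand // (bigD1 l) //= big1 ?addr0 // => j jl.
by have [H _] := hessian_hyp j wP; rewrite H; [rewrite mul0r|right; rewrite eq_sym].
Qed.

(** The leading [0 +] keeps the shape z + s v required by [cderiv_line]. *)
Let emb (l : 'I_m) (x : R[i]) : 'rV[R[i]]_m := 0 + x *: delta_mx 0 l.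

Let emb_polydisc l x : normc x < 1 -> polydisc (emb l x).
Proof.
move=> x1 k; rewrite !mxE add0r eqxx /=; case: (k == l); rewrite ?mulr1 //.
by rewrite mulr0 normc0.
Qed.

Let embE l x : emb l x 0 l = x.
Proof. by rewrite !mxE !eqxx add0r mulr1. Qed.

Let emb0 l : emb l 0 = 0.
Proof. by rewrite /emb scale0r addr0. Qed.

Lemma mholo_line_cst phi a z v : @mholo R m phi a -> polydisc z -> polydisc (z + v) ->
  (forall w, polydisc w -> \sum_l v 0 l * a w l = 0) -> phi (z + v) = phi z.
Proof.
move=> hphi zP zvP v0.
have tP (t : R) : 0 <= t <= 1 -> polydisc (z + t%:C *: v).
  move=> /andP[t0 t1] l; have -> : (z + t%:C *: v) 0 l = (1 - t)%:C * z 0 l + t%:C * (z + v) 0 l.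
    by rewrite !mxE rmorphB rmorph1; ring.
  apply: le_lt_trans (le_normcD _ _) _; rewrite !normcM !normc_real.
  rewrite !ger0_norm ?subr_ge0 //.
  have := zP l; have := zvP l; move: (normc _) (normc _) => a1 a2 h1 h2.
  by have := t0; rewrite le_eqVlt => /orP[/eqP <-|tp]; nra.
have := @cderiv_zero_cst _ (fun s => phi (z + s *: v)) (fun=> 0).
rewrite scale1r scale0r addr0; apply => // t t01.
apply: cderiv_eq; first by apply: cderiv_line; apply: hphi; exact: tP.
by apply: v0; exact: tP.
Qed.

(** The segment from the l-th axis to [w] has direction with zero l-th coordinate, and along the
    other coordinates the derivative of [A w l i] is a mixed partial. *)
Lemma jacobian_decoupled w l i : polydisc w -> A w l i = A (emb l (w 0 l)) l i.
Proof.
move=> wP; have eP := emb_polydisc l (wP l).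
have := @mholo_line_cst _ _ (emb l (w 0 l)) (w - emb l (w 0 l)) (hb i l) eP.
rewrite [emb l _ + _]addrC subrK => -> // u uP; apply: big1 => k _.
have [->|kl] := eqVneq k l; last by rewrite mixed_partials_zero ?mulr0 // eq_sym.
by rewrite !mxE !eqxx add0r mulr1 subrr mul0r.
Qed.

Let kap l x := B (emb l x) l l l.

Let axis_ode l i x : normc x < 1 ->
  cderiv (fun x => A (emb l x) l i) x (kap l x * A (emb l x) l i).
Proof.
move=> x1; have eP := emb_polydisc l x1.
apply: cderiv_eq (@cderiv_line _ _ (fun w => A w l i) 0 (delta_mx 0 l) x _ (hb i l eP)) _.
rewrite (bigD1 l) //= mxE !eqxx mul1r big1 ?addr0; first exact: pure_partials.
by move=> k kl; rewrite mxE (negPf kl) andbF mul0r.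
Qed.

Let axis_rate l x : normc x < 1 ->
  normc ((1 - normc x ^+ 2)%:C * kap l x - 2 * x^*) <= 2.
Proof. by move=> x1; have [_] := hessian_hyp l (emb_polydisc l x1); rewrite embE. Qed.

(** On the l-th axis the entry solves a linear equation, and its value at the origin is 0 by the
    normalization of the Jacobian. *)
Lemma jacobian_off_diagonal w l i : polydisc w -> l != i -> A w l i = 0.
Proof.
move=> wP li; rewrite jacobian_decoupled //.
have s1 : (1 : R) = 1 \/ (1 : R) = -1 by left.
apply: (@ray_zero _ (fun x => A (emb l x) l i) (kap l) _ _ _ (wP l) 1 s1) => //.
- by move=> x; exact: axis_ode.
- exact: axis_rate.
- by rewrite emb0 A0 (negPf li).
Qed.

Lemma component_structure : exists h c kp : 'I_m -> R[i] -> R[i],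
  [/\ forall w i, polydisc w -> f w 0 i = h i (w 0 i),
      forall w l i, polydisc w -> A w l i = if l == i then c l (w 0 l) else 0,
      forall l, h l 0 = 0 /\ c l 0 = 1,
      forall l x, normc x < 1 -> cderiv (h l) x (c l x) /\ cderiv (c l) x (kp l x * c l x)
    & forall l x, normc x < 1 -> normc ((1 - normc x ^+ 2)%:C * kp l x - 2 * x^*) <= 2].
Proof.
exists (fun l x => f (emb l x) 0 l), (fun l x => A (emb l x) l l), kap; split.
- move=> w i wP; have eP := emb_polydisc i (wP i).
  have := @mholo_line_cst _ _ (emb i (w 0 i)) (w - emb i (w 0 i)) (hf i) eP.
  rewrite [emb i _ + _]addrC subrK => -> // u uP; apply: big1 => k _.
  have [->|ki] := eqVneq k i; last by rewrite jacobian_off_diagonal ?mulr0.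
  by rewrite !mxE !eqxx add0r mulr1 subrr mul0r.
- move=> w l i wP; case: eqVneq => [<-|li]; first exact: jacobian_decoupled.
  exact: jacobian_off_diagonal.
- by move=> l; rewrite emb0 f0 mxE A0 eqxx.
- move=> l x x1; split; last exact: axis_ode.
  have eP := emb_polydisc l x1.
  apply: cderiv_eq (@cderiv_line _ _ (fun w => f w 0 l) 0 (delta_mx 0 l) x _ (hf l eP)) _.
  rewrite (bigD1 l) //= mxE !eqxx mul1r big1 ?addr0 //.
  by move=> k kl; rewrite mxE (negPf kl) andbF mul0r.
- exact: axis_rate.
Qed.

End Decoupling.

(** * The metric *)

Section Metric.
Variables (R : realType) (m : nat) (t : R) (k : nat).
Hypotheses (ht : 0 <= t) (hk : (2 <= k)%N).
Implicit Types (al be : 'I_m -> R).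

(** The squared metric up to the factor 1 / (1 + t), as a function of the quotients |v_l| / (1 -
    |z_l|^2). Monotonicity and homogeneity of degree 2 in these are what the comparison uses. *)
Definition metric_form al : R :=
  \sum_l al l ^+ 2 + t * (\sum_l al l ^+ (2 * k)) `^ k%:R^-1.

Lemma metricFE (z v : 'rV[R[i]]_m) : metricF t k z v ^+ 2 =
  (1 + t)^-1 * metric_form (fun l => normc (v 0 l) / (1 - normc (z 0 l) ^+ 2)).
Proof.
have t1 : 0 < 1 + t by rewrite ltr_pwDl.
rewrite /metricF exprMn exprVn [Num.sqrt (1 + t) ^+ 2]sqr_sqrtr ?ltW // sqr_sqrtr.
  by congr (_ * (_ + _ * _ `^ _)); apply: eq_bigr => l _; rewrite expr_div_n.
apply: addr_ge0; last by rewrite mulr_ge0 ?powR_ge0.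
by apply: sumr_ge0 => l _; rewrite divr_ge0 ?sqr_ge0.
Qed.

Lemma metric_form_le al be : (forall l, 0 <= al l <= be l) ->
  metric_form al <= metric_form be.
Proof.
move=> H; have a0 l : 0 <= al l by have /andP[] := H l.
have ab l : al l <= be l by have /andP[] := H l.
have b0 l : 0 <= be l by exact: le_trans (ab l).
apply: lerD; first by apply: ler_sum => l _; rewrite lerXn2r ?nnegrE.
apply: ler_wpM2l => //; apply: ge0_ler_powR; rewrite ?invr_ge0 ?ler0n //.
- by rewrite nnegrE sumr_ge0 // => l _; rewrite exprn_ge0.
- by rewrite nnegrE sumr_ge0 // => l _; rewrite exprn_ge0.
- by apply: ler_sum => l _; rewrite lerXn2r ?nnegrE.
Qed.

Lemma root_exprM (C : R) : 0 <= C -> (C ^+ (2 * k)) `^ k%:R^-1 = C ^+ 2.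
Proof.
move=> C0; have k0 : k%:R != 0 :> R by rewrite pnatr_eq0 -lt0n; apply: leq_trans hk.
rewrite exprM -[_ ^+ k]powR_mulrn ?sqr_ge0 // -powRrM divff // powRr1 ?sqr_ge0 //.
Qed.

Lemma metric_form_scale (C : R) al : 0 <= C -> (forall l, 0 <= al l) ->
  metric_form (fun l => C * al l) = C ^+ 2 * metric_form al.
Proof.
move=> C0 a0; rewrite /metric_form mulrDr mulr_sumr; congr (_ + _).
  by apply: eq_bigr => l _; rewrite exprMn.
rewrite [in RHS]mulrCA; congr (_ * _); rewrite -root_exprM // -powRM; last 2 first.
- by rewrite exprn_ge0.
- by rewrite sumr_ge0 // => l _; rewrite exprn_ge0.
by congr (_ `^ _); rewrite mulr_sumr; apply: eq_bigr => l _; rewrite exprMn.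
Qed.

Lemma metric_form_single l0 (a : R) : 0 <= a ->
  metric_form (fun l => if l == l0 then a else 0) = (1 + t) * a ^+ 2.
Proof.
have k0 : (2 * k)%N != 0%N by rewrite muln_eq0 /=; case: k hk.
move=> a0; rewrite /metric_form (bigD1 l0) //= (bigD1 l0 (F := fun l => _ ^+ (2 * k))) //=.
rewrite !eqxx !big1 ?addr0 ?root_exprM //; first by ring.
  by move=> l /negPf ->; rewrite expr0n (negPf k0).
by move=> l /negPf ->; rewrite expr0n.
Qed.

End Metric.

(** * From the convex mapping to its components *)

Section NormalizedConvex.
Variables (R : realType) (m : nat) (f : 'rV[R[i]]_m -> 'rV[R[i]]_m).
Hypothesis hf : normalized_biholomorphic_convex f.

Lemma normalized_convex_structure : exists h c kp : 'I_m -> R[i] -> R[i],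
  [/\ forall w i, polydisc w -> f w 0 i = h i (w 0 i),
      forall w l i, polydisc w -> 'J f w l i = if l == i then c l (w 0 l) else 0,
      forall l, h l 0 = 0 /\ c l 0 = 1,
      forall l x, normc x < 1 -> cderiv (h l) x (c l x) /\ cderiv (c l) x (kp l x * c l x)
    & forall l x, normc x < 1 -> normc ((1 - normc x ^+ 2)%:C * kp l x - 2 * x^*) <= 2].
Proof.
case: hf => [[fholo _ [g [gholo gf]]] fconv f0 Jf0].
pose A w l i := 'J f w l i; pose G y i j := 'J g y i j.
have hA i : mholo (fun w => f w 0 i) (fun w l => A w l i).
  by move=> z zP; apply: differentiable_mdiff; exact: fholo.
have hG z : polydisc z -> forall j, mdiff (fun w => g w 0 j) (f z) (fun i => G (f z) i j).
  by move=> zP j; apply: differentiable_mdiff; apply: gholo; exists z.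
(* Convexity of the image enters here, at the parameter 1/2. *)
have mid z w : polydisc z -> polydisc w ->
    exists2 u, polydisc u & f u = 2^-1 *: (f z + f w).
  move=> zP wP.
  have h0 : 0 <= 2^-1 :> R[i] by rewrite invr_ge0 ler0n.
  have h1 : 2^-1 <= 1 :> R[i] by rewrite invf_le1 ?ler1n ?ltr0n.
  have := fconv (f z) (f w) (Itv01 h0 h1).
  rewrite !inE => /(_ (ex_intro2 _ _ z zP erefl) (ex_intro2 _ _ w wP erefl)) [u uP fu].
  exists u => //; rewrite fu scalerDr; congr (_ + _ *: _).
  by rewrite -[LHS]/(1 - 2^-1); field.
have hb0 i := mholo_gradient (hA i).
pose b w i := projT1 (cid (hb0 i)) w.
have hb i l : mholo (fun w => A w l i) (fun w => b w i l).
  by have [H _] := projT2 (cid (hb0 i)); exact: H.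
have bC w i l k : polydisc w -> b w i l k = b w i k l.
  by have [_ H] := projT2 (cid (hb0 i)); exact: H.
apply: (component_structure hA hG gf mid hb bC f0).
by move=> l i; rewrite /A Jf0 mxE.
Qed.

End NormalizedConvex.

(** * Comparison of the metrics and the equality case *)

Section MainEstimates.
Variables (R : realType) (m : nat) (t : R) (k : nat) (f : 'rV[R[i]]_m -> 'rV[R[i]]_m)
  (h c kp : 'I_m -> R[i] -> R[i]).
Hypotheses (ht : 0 <= t) (hk : (2 <= k)%N).
Hypothesis fE : forall w i, polydisc w -> f w 0 i = h i (w 0 i).
Hypothesis JE : forall w l i, polydisc w -> 'J f w l i = if l == i then c l (w 0 l) else 0.
Hypothesis hc0 : forall l, h l 0 = 0 /\ c l 0 = 1.
Hypothesis dh : forall l x, normc x < 1 ->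
  cderiv (h l) x (c l x) /\ cderiv (c l) x (kp l x * c l x).
Hypothesis hkp : forall l x, normc x < 1 ->
  normc ((1 - normc x ^+ 2)%:C * kp l x - 2 * x^*) <= 2.
Implicit Types z v : 'rV[R[i]]_m.

Let N z : R := gauge_polydisc z.

Lemma tangent_mapE z v l : polydisc z -> tangent_map f z v 0 l = v 0 l * c l (z 0 l).
Proof.
move=> zP; rewrite /tangent_map mxE (bigD1 l) //= JE // eqxx big1 ?addr0 // => i il.
by rewrite JE // (negPf il) mulr0.
Qed.

Lemma metricF_tangent z v : polydisc z -> metricF t k 0 (tangent_map f z v) ^+ 2 =
  (1 + t)^-1 * metric_form t k (fun l => normc (v 0 l) * normc (c l (z 0 l))).
Proof.
move=> zP; rewrite metricFE //; congr (_ * metric_form _ _ _); apply: funext => l.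
by rewrite tangent_mapE // normcM mxE normc0 expr0n subr0 divr1.
Qed.

Lemma distortion_upper l x : normc x < 1 -> normc (c l x) * (1 - normc x) ^+ 2 <= 1.
Proof.
move=> x1; have s1 : (1 : R) = 1 \/ (1 : R) = -1 by left.
have := distortion (fun x x1 => (dh l x1).2) (hkp l) x1 s1 (hc0 l).2.
have n0 : 0 <= normc (c l x) * (1 - normc x) ^+ 2 by rewrite mulr_ge0 ?normc_ge0 ?sqr_ge0.
rewrite !mul1r => H; rewrite -(@ler_pXn2r _ 2) ?nnegrE //.
by rewrite exprMn -exprM expr1n.
Qed.

Lemma distortion_lower l x : normc x < 1 -> 1 <= normc (c l x) * (1 + normc x) ^+ 2.
Proof.
move=> x1; have s1 : (-1 : R) = 1 \/ (-1 : R) = -1 by right.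
have := distortion (fun x x1 => (dh l x1).2) (hkp l) x1 s1 (hc0 l).2.
have n0 : 0 <= normc (c l x) * (1 + normc x) ^+ 2 by rewrite mulr_ge0 ?normc_ge0 ?sqr_ge0.
rewrite !mulN1r lerN2 opprK => H; rewrite -(@ler_pXn2r _ 2) ?nnegrE //.
by rewrite exprMn -exprM expr1n.
Qed.

(** With r = |z_l|, (1 - r)^-2 equals (1 + r) / (1 - r) divided by 1 - r^2, and (1 + r) / (1 - r)
    increases with r up to the value at p(z). The lower bound is the mirror image. *)
Lemma slope_upper z l : polydisc z ->
  normc (c l (z 0 l)) <= (1 + N z) / (1 - N z) / (1 - normc (z 0 l) ^+ 2).
Proof.
move=> zP; have := distortion_upper l (zP l); have rp := normc_le_gauge z l.
have p1 : gauge_polydisc z < 1 by apply/polydisc_gauge.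
have r0 := normc_ge0 (z 0 l); have d0 := normc_ge0 (c l (z 0 l)).
rewrite -/(N z) in rp p1; move: (normc (z 0 l)) (normc (c l (z 0 l))) (N z) rp p1 r0 d0.
move=> r d p rp p1 r0 d0 H.
have r2 : 0 < 1 - r ^+ 2 by rewrite subr_gt0 expr_lt1 //; lra.
rewrite ler_pdivlMr // ler_pdivlMr; last by lra.
have q : 0 < 1 - r by lra.
rewrite -(ler_pM2r q).
have -> : d * (1 - r ^+ 2) * (1 - p) * (1 - r) = d * (1 - r) ^+ 2 * ((1 + r) * (1 - p)) by ring.
apply: (@le_trans _ _ (1 * ((1 + r) * (1 - p)))).
  by apply: ler_wpM2r => //; apply: mulr_ge0; lra.
nra.
Qed.

Lemma slope_lower z l : polydisc z ->
  (1 - N z) / (1 + N z) / (1 - normc (z 0 l) ^+ 2) <= normc (c l (z 0 l)).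
Proof.
move=> zP; have := distortion_lower l (zP l); have rp := normc_le_gauge z l.
have p1 : gauge_polydisc z < 1 by apply/polydisc_gauge.
have r0 := normc_ge0 (z 0 l); have d0 := normc_ge0 (c l (z 0 l)).
rewrite -/(N z) in rp p1; move: (normc (z 0 l)) (normc (c l (z 0 l))) (N z) rp p1 r0 d0.
move=> r d p rp p1 r0 d0 H.
have r2 : 0 < 1 - r ^+ 2 by rewrite subr_gt0 expr_lt1 //; lra.
rewrite ler_pdivrMr // ler_pdivrMr; last by lra.
have q : 0 < 1 + r by lra.
rewrite -(ler_pM2r q).
have -> : d * (1 - r ^+ 2) * (1 + p) * (1 + r) = d * (1 + r) ^+ 2 * ((1 - r) * (1 + p)) by ring.
apply: (@le_trans _ _ (1 * ((1 - r) * (1 + p)))); first by nra.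
by apply: ler_wpM2r => //; apply: mulr_ge0; lra.
Qed.

Let al z v l := normc (v 0 l) / (1 - normc (z 0 l) ^+ 2).

Let al_ge0 z v l : polydisc z -> 0 <= al z v l.
Proof.
move=> zP; rewrite divr_ge0 ?normc_ge0 // subr_ge0 expr_le1 ?normc_ge0 // ltW //; exact: zP.
Qed.

Lemma metricF_scaled z v (C : R) : 0 <= C -> polydisc z ->
  C ^+ 2 * metricF t k z v ^+ 2 = (1 + t)^-1 * metric_form t k (fun l => C * al z v l).
Proof.
move=> C0 zP; rewrite metricFE // metric_form_scale //; first by rewrite mulrCA.
by move=> l; exact: al_ge0.
Qed.

Lemma metric_bounds z v : polydisc z ->
  ((1 - N z) / (1 + N z)) ^+ 2 * metricF t k z v ^+ 2
       <= metricF t k 0 (tangent_map f z v) ^+ 2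
     /\ metricF t k 0 (tangent_map f z v) ^+ 2
       <= ((1 + N z) / (1 - N z)) ^+ 2 * metricF t k z v ^+ 2.
Proof.
move=> zP; have p1 : N z < 1 by apply/polydisc_gauge.
have p0 : 0 <= N z := gauge_ge0 z.
have t1 : 0 <= (1 + t)^-1 by rewrite invr_ge0 addr_ge0.
have C1 : 0 <= (1 - N z) / (1 + N z) by rewrite divr_ge0 //; lra.
have C2 : 0 <= (1 + N z) / (1 - N z) by rewrite divr_ge0 //; lra.
rewrite !metricF_scaled // metricF_tangent //; split; apply: ler_wpM2l => //.
  apply: metric_form_le => // l; rewrite mulr_ge0 ?al_ge0 //= /al mulrCA.
  by apply: ler_wpM2l; [exact: normc_ge0|exact: slope_lower].
apply: metric_form_le => // l; rewrite mulr_ge0 ?normc_ge0 //= /al [leRHS]mulrCA.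
by apply: ler_wpM2l; [exact: normc_ge0|exact: slope_upper].
Qed.

(* Testing an equality of the two metrics on the l-th coordinate vector. *)
Lemma slope_of_equality z (C : R) l : polydisc z -> 0 <= C ->
  (forall v, C ^+ 2 * metricF t k z v ^+ 2 = metricF t k 0 (tangent_map f z v) ^+ 2) ->
  normc (c l (z 0 l)) = C / (1 - normc (z 0 l) ^+ 2).
Proof.
move=> zP C0 /(_ (delta_mx 0 l)); rewrite metricF_scaled // metricF_tangent //.
have t1 : 0 < 1 + t by rewrite ltr_pwDl.
have D : 0 <= C / (1 - normc (z 0 l) ^+ 2).
  rewrite divr_ge0 // subr_ge0 expr_le1 ?normc_ge0 // ltW //; exact: zP.
rewrite (_ : (fun l0 => C * _) = (fun i => if i == l then C / (1 - normc (z 0 l) ^+ 2) else 0)).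
  rewrite (_ : (fun l0 => _ * _) = (fun i => if i == l then normc (c l (z 0 l)) else 0)).
    rewrite !metric_form_single ?normc_ge0 // !(mulKf (lt0r_neq0 t1)) => /eqP.
    by rewrite eqf_sqr => /orP[/eqP -> //|/eqP e]; have := normc_ge0 (c l (z 0 l)); lra.
  apply: funext => i; rewrite mxE eqxx /=; case: eqVneq => [->|_]; first by rewrite normc1 mul1r.
  by rewrite normc0 mul0r.
apply: funext => i; rewrite /al mxE eqxx /=; case: eqVneq => [->|_]; first by rewrite normc1 mul1r.
by rewrite normc0 mul0r mulr0.
Qed.

Lemma koebe_cderiv (e x : R[i]) : normc e = 1 -> normc x < 1 ->
  cderiv (fun x => x / (1 - e * x)) x ((1 - e * x) ^- 2).
Proof.
move=> e1 x1; have nz : 1 - e * x != 0.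
  rewrite subr_eq0; apply/eqP => /(congr1 (@normc R)).
  by rewrite normc1 normcM e1 mul1r => E; move: x1; rewrite -E ltxx.
have h1 : cderiv (fun x => 1 - e * x) x (0 - e * 1).
  by apply: cderivB; [exact: cderiv_cst|apply: cderivZ; exact: cderiv_id].
apply: cderiv_eq (cderivM (cderiv_id x) (cderivV h1 nz)) _.
by field.
Qed.

Lemma component_of_slope l (e : R[i]) : normc e = 1 ->
  (forall x, normc x < 1 -> c l x * (1 - e * x) ^+ 2 = 1) ->
  forall x, normc x < 1 -> h l x = x / (1 - e * x).
Proof.
move=> e1 hc x x1; pose D y := h l y - y / (1 - e * y).
have dD y : normc y < 1 -> cderiv D y 0.
  move=> y1; apply: cderiv_eq (cderivB (dh l y1).1 (koebe_cderiv e1 y1)) _.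
  have c2 := hc y y1; have nz : (1 - e * y) ^+ 2 != 0.
    by apply: contra_eq_neq c2 => ->; rewrite mulr0 eq_sym oner_eq0.
  by rewrite -[X in X - _](mulfK nz) c2 div1r subrr.
have := @cderiv_zero_cst _ (fun s => D (s * x)) (fun=> 0).
have D0 : D 0 = 0 by rewrite /D (hc0 l).1 mul0r subr0.
rewrite mul1r mul0r D0 /D => H.
apply/eqP; rewrite -subr_eq0; apply/eqP; apply: H => // s /andP[s0 s1].
have sx1 : normc (0 + x * s%:C) < 1.
  rewrite add0r normcM normc_real ger0_norm //; apply: le_lt_trans x1.
  by rewrite ler_piMr ?normc_ge0.
have := cderiv_affine (dD _ sx1); rewrite mul0r.
rewrite (_ : (fun w => _) = (fun s => D (s * x))) //.
by apply: funext => w; rewrite add0r mulrC.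
Qed.

(** Coordinate vectors yield |c_l(z_l)| = C / (1 - |z_l|^2) with the constant C at p(z). The
    distortion bound at |z_l| <= p(z) allows this only if |z_l| = p(z); then z_l <> 0 and that bound
    is attained, so [distortion_eq] applies to every l. *)
Lemma equality_only_koebe z : polydisc z -> z <> 0 ->
  (forall v, ((1 - N z) / (1 + N z)) ^+ 2 * metricF t k z v ^+ 2
     = metricF t k 0 (tangent_map f z v) ^+ 2) \/
  (forall v, metricF t k 0 (tangent_map f z v) ^+ 2
     = ((1 + N z) / (1 - N z)) ^+ 2 * metricF t k z v ^+ 2) ->
  exists theta : 'I_m -> R, forall z, polydisc z ->
      forall l, f z 0 l = z 0 l / (1 - expi (theta l) * z 0 l).
Proof.
move=> zP z0 Heq; have p1 : N z < 1 by apply/polydisc_gauge.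
have p0 : 0 < N z.
  by rewrite lt_def gauge_ge0 andbT; apply/eqP => /gauge_eq0.
suff H l : exists e : R[i], normc e = 1 /\
    forall x, normc x < 1 -> c l x * (1 - e * x) ^+ 2 = 1.
  have H2 l : exists theta : R, forall x, normc x < 1 -> h l x = x / (1 - expi theta * x).
    have [e [e1 he]] := H l; have [theta _ eE] := unit_circle_expi e1.
    by exists theta; rewrite -eE; exact: component_of_slope.
  exists (projT1 (choice H2)) => w wP l; rewrite fE //.
  by rewrite (projT2 (choice H2) l) //; exact: wP.
have rp := normc_le_gauge z l; rewrite -/(N z) in rp.
have r0 := normc_ge0 (z 0 l); have zl := zP l.
have r2 : 0 < 1 - normc (z 0 l) ^+ 2 by rewrite subr_gt0 expr_lt1.
have conclude (sg : R) : (sg = 1 \/ sg = -1) -> normc (z 0 l) = N z ->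
    normc (c l (z 0 l)) * (1 - sg * normc (z 0 l)) ^+ 2 = 1 ->
    exists e : R[i], normc e = 1 /\ forall x, normc x < 1 -> c l x * (1 - e * x) ^+ 2 = 1.
  move=> s1 rN E; have zl0 : z 0 l != 0 by rewrite -normc_gt0 rN.
  have E2 : normc (c l (z 0 l)) ^+ 2 * (1 - sg * normc (z 0 l)) ^+ 4 = 1.
    by rewrite (exprM _ 2 2) -exprMn E expr1n.
  have [e e1 he] := distortion_eq (fun x x1 => (dh l x1).2) (hkp l) zl s1 zl0 (hc0 l).2 E2.
  by exists e.
case: Heq => [Heq|Heq].
  have C0 : 0 <= (1 - N z) / (1 + N z) by rewrite divr_ge0 //; lra.
  have E := slope_of_equality l zP C0 Heq; have := distortion_lower l zl.
  have q : 0 < 1 + N z by lra.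
  rewrite E => L; have {}L : (1 - normc (z 0 l)) * (1 + N z) <= (1 - N z) * (1 + normc (z 0 l)).
    have q2 : 0 < (1 - normc (z 0 l) ^+ 2) * (1 + N z) by rewrite mulr_gt0.
    have q3 : 0 < 1 + normc (z 0 l) by lra.
    rewrite -(ler_pM2r q3); have := L; rewrite -(ler_pM2r q2) mul1r.
    have -> : (1 - N z) / (1 + N z) / (1 - normc (z 0 l) ^+ 2) * (1 + normc (z 0 l)) ^+ 2 *
       ((1 - normc (z 0 l) ^+ 2) * (1 + N z)) = (1 - N z) * (1 + normc (z 0 l)) ^+ 2.
      by field; rewrite !gt_eqF.
    by move=> L2; lra.
  have rN : normc (z 0 l) = N z by apply/eqP; rewrite eq_le rp /=; lra.
  apply: (conclude (-1)) => //; first by right.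
  rewrite E rN mulN1r opprK; have q3 : 0 < 1 - N z by lra.
  have -> : 1 - N z ^+ 2 = (1 - N z) * (1 + N z) by ring.
  by field; rewrite !gt_eqF.
have C0 : 0 <= (1 + N z) / (1 - N z) by rewrite divr_ge0 //; lra.
have E := slope_of_equality l zP C0 (fun v => esym (Heq v)); have := distortion_upper l zl.
have q : 0 < 1 - N z by lra.
rewrite E => L; have {}L : (1 + N z) * (1 - normc (z 0 l)) <= (1 - N z) * (1 + normc (z 0 l)).
  have q2 : 0 < (1 - normc (z 0 l) ^+ 2) * (1 - N z) by rewrite mulr_gt0.
  have q3 : 0 < 1 - normc (z 0 l) by lra.
  rewrite -(ler_pM2r q3); have := L; rewrite -(ler_pM2r q2) mul1r.
  have -> : (1 + N z) / (1 - N z) / (1 - normc (z 0 l) ^+ 2) * (1 - normc (z 0 l)) ^+ 2 *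
     ((1 - normc (z 0 l) ^+ 2) * (1 - N z)) = (1 + N z) * (1 - normc (z 0 l)) ^+ 2.
    by field; rewrite !gt_eqF.
  by move=> L2; lra.
have rN : normc (z 0 l) = N z by apply/eqP; rewrite eq_le rp /=; lra.
apply: (conclude 1) => //; first by left.
rewrite E rN mul1r; have q3 : 0 < 1 + N z by lra.
have -> : 1 - N z ^+ 2 = (1 - N z) * (1 + N z) by ring.
by field; rewrite !gt_eqF.
Qed.

Lemma koebe_equality (theta : 'I_m -> R) : (0 < m)%N ->
  (forall z, polydisc z -> forall l, f z 0 l = z 0 l / (1 - expi (theta l) * z 0 l)) ->
  exists z, [/\ polydisc z, z <> 0 & forall v, metricF t k 0 (tangent_map f z v) ^+ 2
     = ((1 + N z) / (1 - N z)) ^+ 2 * metricF t k z v ^+ 2].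
Proof.
move=> m0 hfz; pose l0 := Ordinal m0.
(* Each coordinate points towards the pole of its component: e^(i theta_l) z_l = 1/2, so |c_l(z_l)|
   = 4. All moduli are 1/2, and 3 / (1 - 1/4) = 4 is the upper bound. *)
have [z zE] : exists z : 'rV[R[i]]_m, forall l, z 0 l = (2^-1)%:C * (expi (theta l))^*.
  by exists (\row_l ((2^-1)%:C * (expi (theta l))^*)) => l; rewrite mxE.
have nz l : normc (z 0 l) = 2^-1.
  by rewrite zE normcM normc_conj normc_expi mulr1 normc_real ger0_norm.
have zP : polydisc z by move=> l; rewrite nz; lra.
have Nz : N z = 2^-1.
  apply/eqP; rewrite eq_le -{2}(nz l0) normc_le_gauge andbT.
  by apply: gauge_le => [|l]; rewrite ?nz.
exists z; split => //.
  by move=> z0; have := nz l0; rewrite z0 mxE normc0; lra.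
move=> v; have C0 : 0 <= (1 + 2^-1) / (1 - 2^-1) :> R by rewrite divr_ge0 //; lra.
rewrite Nz; apply: etrans (metricF_tangent v zP) _.
apply: etrans (esym (metricF_scaled v C0 zP)).
congr (_ * metric_form _ _ _); apply: funext => l; rewrite /al nz.
have hE x : normc x < 1 -> h l x = x / (1 - expi (theta l) * x).
  (* A constant row turns the formula for f on the polydisc into one for [h l] on the disc, as
     needed to differentiate it. *)
  move=> x1; have cP : polydisc (const_mx x : 'rV[R[i]]_m) by move=> i; rewrite mxE.
  by have := hfz _ cP l; rewrite fE // mxE.
have zl1 := zP l.
have d1 : 0 < 1 - normc (z 0 l) by rewrite subr_gt0.
have := cderiv_uniq (cderiv_near d1 _ (dh l zl1).1) (koebe_cderiv (normc_expi (theta l)) zl1).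
move=> H; have {}H : c l (z 0 l) = (1 - expi (theta l) * z 0 l) ^- 2.
  apply: H => w wz; apply: hE; have := le_normcD (w - z 0 l) (z 0 l); rewrite subrK; lra.
have ez : expi (theta l) * z 0 l = (2^-1)%:C.
  by rewrite zE mulrCA mul_conjc normc_expi expr1n mulr1.
rewrite H ez; have -> : 1 - (2^-1)%:C = (2^-1)%:C :> R[i].
  by rewrite -(rmorph1 (real_complex R)) -rmorphB; congr (real_complex _ _); field.
by rewrite normcV normcX normc_real ger0_norm //; field.
Qed.

End MainEstimates.

Theorem theorem1p3 (R : realType) (m : nat) (t : R) (k : nat)
    (f : 'rV[R[i]]_m -> 'rV[R[i]]_m)
    (hm : (2 <= m)%N) (ht : 0 <= t) (hk : (2 <= k)%N)
    (hf : normalized_biholomorphic_convex f) :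
  (forall z v : 'rV[R[i]]_m, polydisc z ->
     ((1 - gauge_polydisc z) / (1 + gauge_polydisc z)) ^+ 2 * metricF t k z v ^+ 2
       <= metricF t k 0 (tangent_map f z v) ^+ 2
     /\ metricF t k 0 (tangent_map f z v) ^+ 2
       <= ((1 + gauge_polydisc z) / (1 - gauge_polydisc z)) ^+ 2 * metricF t k z v ^+ 2)
  /\
  ((exists z : 'rV[R[i]]_m,
      [/\ polydisc z, z <> 0 &
          (forall v : 'rV[R[i]]_m,
             ((1 - gauge_polydisc z) / (1 + gauge_polydisc z)) ^+ 2 * metricF t k z v ^+ 2
               = metricF t k 0 (tangent_map f z v) ^+ 2)
          \/
          (forall v : 'rV[R[i]]_m,
             metricF t k 0 (tangent_map f z v) ^+ 2
               = ((1 + gauge_polydisc z) / (1 - gauge_polydisc z)) ^+ 2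
                 * metricF t k z v ^+ 2)])
   <->
   (exists theta : 'I_m -> R,
      forall z : 'rV[R[i]]_m, polydisc z ->
      forall l : 'I_m, f z 0 l = z 0 l / (1 - expi (theta l) * z 0 l))).
Proof.
have [h [c [kp [fE JE hc0 dh hkp]]]] := normalized_convex_structure hf.
split; first by move=> z v zP; exact: (metric_bounds ht hk JE hc0 dh hkp).
split=> [[z [zP z0 Heq]]|[theta hth]].
  exact: (equality_only_koebe ht hk fE JE hc0 dh hkp zP z0 Heq).
have [z [zP z0 H]] := koebe_equality ht hk fE JE dh (leq_trans (isT : (0 < 2)%N) hm) hth.
by exists z; split=> //; right.
Qed.
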